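(* Let $(X,\|\cdot\|)$ be a Banach space and assume: (a) the linear operator $\mathcal{A}:D(\mathcal{A})\subset X\to X$ is one-to-one and generates a bounded analytic semigroup $e^{t\mathcal{A}}$ with $\lim_{t\to\infty}\|e^{t\mathcal{A}}x\|=0$ for every $x\in X$; (b) $\mathcal{B}\in\mathscr{L}(X)$ is invertible with inverse $\mathcal{B}^{-1}\in\mathscr{L}(X)$; (c) $\mathcal{S}=\mathcal{B}\mathcal{A}:D(\mathcal{A})\subset X\to X$ generates a bounded analytic semigroup $e^{t\mathcal{S}}$ with $\lim_{t\to\infty}\|e^{t\mathcal{S}}x\|=0$ for every $x\in X$. Let $s\in(0,2)$ and $T\in(0,\infty]$. If $x\in\dot{B}_{X,1}^{-s,\mathcal{S}}$ and $f\in L^1((0,T);\dot{B}_{X,1}^{-s,\mathcal{A}})$, then the Cauchy problem $$\overline{\mathcal{B}}^{-1}u'(t)-\overline{\mathcal{A}}u(t)=f(t),\qquad u(0)=x$$ has a unique strong solution $u$ in the class $$u\in C([0,T);\dot{B}_{X,1}^{-s,\mathcal{S}}),\quad u'\in L^1((0,T);\dot{B}_{X,1}^{-s,\mathcal{S}}),\quad \overline{\mathcal{A}}u\in L^1((0,T);\dot{B}_{X,1}^{-s,\mathcal{A}}).$$ Moreover, $$\|\overline{\mathcal{B}}^{-1}u\|_{L^\infty((0,T);\dot{B}_{X,1}^{-s,\mathcal{A}})}+\|\overline{\mathcal{B}}^{-1}u'\|_{L^1((0,T);\dot{B}_{X,1}^{-s,\mathcal{A}})}+\|\overline{\mathcal{A}}u\|_{L^1((0,T);\dot{B}_{X,1}^{-s,\mathcal{A}})}\le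 C\|\overline{\mathcal{B}}^{-1}x\|_{\dot{B}_{X,1}^{-s,\mathcal{A}}}+C\|f\|_{L^1((0,T);\dot{B}_{X,1}^{-s,\mathcal{A}})},$$ where $C$ depends on $s$, $\|\mathcal{B}\|_{\mathscr{L}(X)}$ and $\|\mathcal{B}^{-1}\|_{\mathscr{L}(X)}$.
   Context: All Banach spaces are real; $\mathscr{L}(X)$ is the space of bounded linear operators on $X$. A bounded analytic semigroup on $X$ is a $C_0$ semigroup $\{\mathcal{T}(t)\}_{t\ge0}$ with $\sup_{t\ge 0}\|\mathcal{T}(t)\|<\infty$ whose generator $\mathcal{G}$ satisfies $\mathcal{T}(t)x\in D(\mathcal{G})$ for all $x\in X$, $t>0$, and $\sup_{t>0}\|t\mathcal{G}\mathcal{T}(t)x\|\le C\|x\|$ for all $x\in X$. For $\mathcal{E}\in\{\mathcal{A},\mathcal{S}\}$ and $s\in(0,2)$, $\dot{B}_{X,1}^{-s,\mathcal{E}}$ is the completion of the range $R(\mathcal{E})$ in the norm $\|x\|_{\dot{B}_{X,1}^{-s,\mathcal{E}}}=\int_0^\infty t^{s/2}\|e^{t\mathcal{E}}x\|\frac{dt}{t}$. The operator $\mathcal{B}|_{R(\mathcal{A})}$ extends to a bounded operator $\overline{\mathcal{B}}:\dot{B}_{X,1}^{-s,\mathcal{A}}\to\dot{B}_{X,1}^{-s,\mathcal{S}}$, which is invertible, with bounded inverse $\overline{\mathcal{B}}^{-1}$ equal to the continuous extension of $\mathcal{B}^{-1}|_{R(\mathcal{S})}$. The operator $\mathcal{A}:D(\mathcal{A})\cap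 R(\mathcal{S})\subset\dot{B}_{X,1}^{-s,\mathcal{S}}\to\dot{B}_{X,1}^{-s,\mathcal{A}}$ is closable, and $\overline{\mathcal{A}}$ denotes its closure. The data $X,\mathcal{A},\mathcal{B}$ are fixed; $C$ is independent of $T$, $x$, $f$. A strong solution is a function $u$ in the stated class taking values in $D(\overline{\mathcal{A}})$ for a.e. $t$, satisfying the equation for a.e. $t\in(0,T)$ and $u(0)=x$. *)

(* Defs.v *)
From HB Require Import structures.
From mathcomp Require Import all_boot all_order all_algebra.
From mathcomp Require Import all_classical all_reals all_analysis.

Set Implicit Arguments.
Unset Strict Implicit.
Unset Printing Implicit Defensive.
Import Order.TTheory GRing.Theory Num.Theory.
Import numFieldNormedType.Exports.

Local Open Scope classical_set_scope.
Local Open Scope ring_scope.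

(** * Unbounded operators *)

(* The values of [app] outside [dom] are irrelevant. *)
Record operator (X Y : Type) := Operator { dom : set X ; app :> X -> Y }.

Section operators.
Context {R : realType}.

Definition op_range {X Y : Type} (A : operator X Y) : set Y := A @` dom A.

Definition linear_operator {X Y : normedModType R} (A : operator X Y) :=
  dom A 0 /\
  forall (a : R) x y, dom A x -> dom A y ->
    dom A (a *: x + y) /\ A (a *: x + y) = a *: A x + A y.

Definition one_to_one {X Y : Type} (A : operator X Y) :=
  forall x y, dom A x -> dom A y -> A x = A y -> x = y.

(* [B A] with domain [dom A], for [B] everywhere defined *)
Definition op_comp {X Y Z : Type} (B : Y -> Z) (A : operator X Y) :
  operator X Z := Operator (dom A) (B \o A).

(* The operator whose graph is the closure of [G]; it is only meaningful when
   that closure is a graph, i.e. when the operator of graph [G] is closable. *)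
Definition op_closure {X Y : normedModType R} (G : set (X * Y)) :
    operator X Y :=
  Operator [set x | exists y, closure G (x, y)]
           (fun x => xget 0 [set y | closure G (x, y)]).

Definition two_sided_inverse {X Y : normedModType R} (K : X -> Y) : Y -> X :=
  xget (fun=> 0) [set L : Y -> X | cancel K L /\ cancel L K].

(* Through [jX : E -> X] and [jY : F -> Y], a map [L : E -> F] considered on
   [D] induces a map [jX @` D -> Y]; this is its continuous linear extension to
   [X], which is unique as soon as [jX @` D] is dense. *)
Definition continuous_extension {E F : Type} {X Y : normedModType R}
    (jX : E -> X) (jY : F -> Y) (D : set E) (L : E -> F) : X -> Y :=
  xget (fun=> 0) [set K : X -> Y | [/\ linear K, continuous K &
    forall x, D x -> K (jX x) = jY (L x)]].

End operators.

(** * Semigroups *)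

Section semigroups.
Context {R : realType} {X : normedModType R}.
Implicit Types (S : R -> {linear X -> X}) (G : operator X X).

(* Only the values [S t] with [0 <= t] matter. *)
Definition c0_semigroup S :=
  [/\ forall t, 0 <= t -> continuous (S t),
      forall x, S 0 x = x,
      forall s t x, 0 <= s -> 0 <= t -> S (s + t) x = S s (S t x) &
      forall x, S t x @[t --> 0^'+] --> x].

Definition generator S G :=
  forall x y, (dom G x /\ G x = y) <->
    (h^-1 *: (S h x - x)) @[h --> 0^'+] --> y.

Definition bounded_analytic_semigroup S G :=
  [/\ c0_semigroup S, generator S G,
      exists M : R, forall t x, 0 <= t -> `|S t x| <= M * `|x| &
      (forall t x, 0 < t -> dom G (S t x)) /\
      exists C : R, forall t x, 0 < t -> `|t *: G (S t x)| <= C * `|x|].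

Definition decays S := forall x, S t x @[t --> +oo] --> (0 : X).

End semigroups.

(** * Homogeneous Besov spaces of negative order *)

Section besov.
Context {R : realType} {X : normedModType R}.

Definition besov_norm (s : R) (S : R -> {linear X -> X}) (x : X) : \bar R :=
  (\int[lebesgue_measure]_(t in `]0%R, +oo[)
    (t `^ (s / 2) * `|S t x| / t)%:E)%E.

(* [Y], with [j] restricted to the range of [G], is the completion of that range
   in the norm [besov_norm s S]. *)
Definition besov_completion (s : R) (S : R -> {linear X -> X})
    (G : operator X X) (Y : completeNormedModType R) (j : X -> Y) :=
  [/\ forall (a : R) x y, op_range G x -> op_range G y ->
        j (a *: x + y) = a *: j x + j y,
      forall x, op_range G x -> (`|j x|%:E = besov_norm s S x)%E &
      dense (j @` op_range G)].

End besov.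

(** * Vector-valued functions of a real variable *)

Section bochner.
Context {R : realType}.
Notation mu := (@lebesgue_measure R).

Definition simple_fun {Y : normedModType R} (g : R -> Y) :=
  finite_set (range g) /\ forall y, measurable (g @^-1` [set y]).

Definition strongly_measurable {Y : normedModType R} (D : set R) (f : R -> Y) :=
  exists g : nat -> R -> Y,
    (forall n, simple_fun (g n)) /\
    {ae mu, forall t, D t -> g n t @[n --> \oo] --> f t}.

(* the norm of [L^p(D; Y)] *)
Definition bochner_norm {Y : normedModType R} (p : \bar R) (D : set R)
    (f : R -> Y) : \bar R :=
  Lnorm mu p (fun t => if t \in D then `|f t|%:E else 0%E).

Definition bochner_L1 {Y : normedModType R} (D : set R) (f : R -> Y) :=
  strongly_measurable D f /\ (bochner_norm 1 D f < +oo)%E.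

Definition simple_integrable {Y : normedModType R} (D : set R) (g : R -> Y) :=
  simple_fun g /\
  forall y, y != 0 -> (mu (D `&` g @^-1` [set y]) < +oo)%E.

Definition simple_integral {Y : normedModType R} (D : set R) (g : R -> Y) : Y :=
  \sum_(y \in range g) fine (mu (D `&` g @^-1` [set y])) *: y.

Definition is_bochner_integral {Y : normedModType R} (D : set R) (f : R -> Y)
    (I : Y) :=
  exists g : nat -> R -> Y,
    [/\ forall n, simple_integrable D (g n),
        {ae mu, forall t, D t -> g n t @[n --> \oo] --> f t},
        bochner_norm 1 D (f \- g n) @[n --> \oo] --> 0%E &
        simple_integral D (g n) @[n --> \oo] --> I].

Definition bochner_integral {Y : normedModType R} (D : set R) (f : R -> Y) : Y :=
  xget 0 [set I | is_bochner_integral D f I].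

Definition open_time (T : \bar R) : set R := [set t | 0 < t /\ (t%:E < T)%E].

Definition halfopen_time (T : \bar R) : set R :=
  [set t | 0 <= t /\ (t%:E < T)%E].

(* C^1 functions with compact support in (0, T) *)
Definition test_function (T : \bar R) (phi : R -> R) :=
  [/\ forall t, derivable phi t 1, continuous (derive1 phi) &
      exists a b : R, [/\ 0 < a, (b%:E < T)%E &
        forall t, ~~ (a <= t <= b) -> phi t = 0]].

Definition weak_derivative {Y : normedModType R} (T : \bar R) (u v : R -> Y) :=
  forall phi, test_function T phi ->
    bochner_integral (open_time T) (fun t => derive1 phi t *: u t) =
    - bochner_integral (open_time T) (fun t => phi t *: v t).

(* [u] is a strong solution on (0, T) of [K u' - A u = f], [u(0) = x], and [v]
   is its derivative. *)
Definition strong_solution {Y Z : normedModType R} (T : \bar R)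
    (K : Y -> Z) (A : operator Y Z) (f : R -> Z) (x : Y) (u v : R -> Y) :=
  [/\ {within halfopen_time T, continuous u} /\ u 0 = x,
      weak_derivative T u v /\ bochner_L1 (open_time T) v,
      {ae mu, forall t, open_time T t -> dom A (u t)},
      bochner_L1 (open_time T) (A \o u) &
      {ae mu, forall t, open_time T t -> K (v t) - A (u t) = f t}].

End bochner.

(* Main.v *)
Require Import Defs.
From HB Require Import structures.
From mathcomp Require Import all_boot all_order all_algebra.
From mathcomp Require Import all_classical all_reals all_analysis.
From mathcomp Require Import measurable_realfun ess_sup_inf ring lra.

(** The estimate behind the theorem concerns a single analytic semigroup [T] with
    generator [G]. Put [p = s / 2] and let [N x] be the integral of
    [t^(p - 1) |T t x|] over [t > 0]. Then
    [\int_0^oo N (G (T t x)) dt <= c * N x]: a Besov norm of negative order with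
    summability index 1 has maximal L1 regularity built in. Writing out [N] and
    splitting the inner integral at [r = t], both halves are bounded by the
    integral of [t^p |G (T t x)|]. As [G (T t x) = G (T (t - r) (T r x))] for
    every [r < t], the norm [|G (T t x)|] is at most [c / t] times the mean of
    [|T r x|] over [r < t] ([gen_norm_average]), and Hardy's inequality
    ([hardy_inequality]) bounds the weighted integral of such means by [N x]
    ([bnorm_gen_integral]).

    The bound passes to the completion [Y]: there [T t] and [G (T t)] extend to
    operators [E t] and [S t], with [E] a bounded semigroup and
    [\int_0^oo |S t y| dt <= K |y|] ([completed_smoothing]). A variant of the
    estimate compares the norms of two semigroups whose generators differ by a
    bounded invertible factor ([bnorm_transfer]); hence that factor extends to an
    isomorphism of the two completions. Through it, the equation becomes
    [u' - H u = g], where [H] is the generator of [E]; the closure of the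
    generator seen on the range is [H] ([smooth_graph_closure]).

    Existence is Duhamel's formula. For a forcing that takes one smooth value on
    a set of times of finite measure, the solution is a convolution, and Tonelli's
    theorem with translation invariance bounds [H u] in L1 ([solves_window]).
    General forcings are series of such terms, and the estimates add up
    ([solves_series], [solves_forcing], [mild_solution]). For uniqueness, let [w]
    be a difference of two solutions. Then [E e w] has the continuous weak
    derivative [S e w], so it is continuously differentiable by the lemma of du
    Bois-Reymond, and [E (t - s) (E e (w s))] does not depend on [s]. Letting
    [s] tend to 0 and then [e] tend to 0 gives [w t = 0] ([homogeneous_zero]).

    Integrals and derivatives of vector-valued functions are reduced to scalar
    ones by bounded functionals, of which there are enough by the Hahn-Banach
    theorem ([norm_le_dual], [eq_dual]). *)

Set Implicit Arguments.
Unset Strict Implicit.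
Unset Printing Implicit Defensive.
Import Order.TTheory GRing.Theory Num.Theory.
Import numFieldNormedType.Exports.

Local Open Scope classical_set_scope.
Local Open Scope ring_scope.

(** * Bounded linear maps and norming functionals *)

Section hahn_banach.
Context {R : realType}.

(** A predicate on plain functions rather than a bundled type, because the
    operators on a completion are chosen from existence statements. *)
Definition bop {V W : normedModType R} (K : V -> W) :=
  (forall (a : R) x y, K (a *: x + y) = a *: K x + K y) /\
  exists C : R, forall x, `|K x| <= C * `|x|.

Section bop_lemmas.
Context {V W : normedModType R}.
Variable K : V -> W.
Hypothesis bK : bop K.

Lemma bop0 : K 0 = 0.
Proof.
case: bK => lK _; have := lK 1 0 0.
by rewrite !scale1r addr0 => /eqP; rewrite -subr_eq0 opprD addNKr oppr_eq0 => /eqP.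
Qed.

Lemma bopD x y : K (x + y) = K x + K y.
Proof. by case: bK => lK _; have := lK 1 x y; rewrite !scale1r. Qed.

Lemma bopZ a x : K (a *: x) = a *: K x.
Proof. by case: bK => lK _; have := lK a x 0; rewrite bop0 !addr0. Qed.

Lemma bopN x : K (- x) = - K x.
Proof. by rewrite -scaleN1r bopZ scaleN1r. Qed.

Lemma bopB x y : K (x - y) = K x - K y.
Proof. by rewrite bopD bopN. Qed.

Lemma bop_sum (I : Type) (r : seq I) (P : pred I) (F : I -> V) :
  K (\sum_(i <- r | P i) F i) = \sum_(i <- r | P i) K (F i).
Proof.
elim: r => [|i r IH]; first by rewrite !big_nil bop0.
by rewrite !big_cons; case: ifP => _ //; rewrite bopD IH.
Qed.

Lemma bop_bound : exists2 C : R, 0 < C & forall x, `|K x| <= C * `|x|.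
Proof.
case: bK => _ [C hC]; exists (`|C| + 1); first by rewrite ltr_pwDr.
move=> x; apply: (le_trans (hC x)); rewrite ler_wpM2r //.
by rewrite (le_trans (ler_norm C)) // lerDl.
Qed.

Lemma bop_continuous : continuous K.
Proof.
move=> x; apply/cvgrPdist_lt => e e0.
have [C C0 hC] := bop_bound.
near=> y; rewrite -bopB; apply: (le_lt_trans (hC _)).
rewrite mulrC -ltr_pdivlMr //.
by near: y; apply: cvgr_dist_lt => //; rewrite divr_gt0.
Unshelve. all: by end_near. Qed.

End bop_lemmas.

Lemma bop_comp {U V W : normedModType R} (K : V -> W) (L : U -> V) :
  bop K -> bop L -> bop (K \o L).
Proof.
move=> bK bL; split=> [a x y /=|].
  by rewrite (bopD bL) (bopZ bL) (bopD bK) (bopZ bK).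
have [C C0 hC] := bop_bound bK; have [D D0 hD] := bop_bound bL.
exists (C * D) => x /=; rewrite (le_trans (hC _)) // -mulrA.
by rewrite ler_pM2l.
Qed.

Lemma bop_id {V : normedModType R} : bop (fun x : V => x).
Proof. by split => //; exists 1 => x; rewrite mul1r. Qed.

Section extension.
Context {V : normedModType R}.
Variable v : V.

Let hbP (G : set (V * R)) :=
  [/\ forall (a : R) x y r q, G (x, r) -> G (y, q) -> G (a *: x + y, a * r + q),
      forall x r, G (x, r) -> r <= `|x| & G (v, `|v|)].

(** Zorn's lemma on the linear relations dominated by the norm; being
    dominated makes them graphs. If the domain of a maximal one missed [x0], a
    value [c] at [x0] could be added: any number between the supremum of [r -
    |x - x0|] and the infimum of [|y + x0| - q] over pairs [(x, r)] and [(y,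
    q)] of the graph, and the triangle inequality puts the former below the
    latter. *)
Lemma norming_graph : exists G, hbP G /\ forall x, exists r, G (x, r).
Proof.
pose T := {G : set (V * R) | hbP G}.
pose Rl : rel T := fun s t => `[< sval s `<=` sval t >].
have G0P : hbP [set (a *: v, a * `|v|) | a in [set: R]].
  split.
  - move=> a x y r q [b _ [<- <-]] [c _ [<- <-]]; exists (a * b + c) => //.
    by rewrite scalerDl scalerA mulrDl mulrA.
  - move=> x r [b _ [<- <-]]; rewrite normrZ ler_wpM2r //; exact: ler_norm.
  - by exists 1 => //; rewrite scale1r mul1r.
have [|r s t|s t|A tA|M maxM] := @Zorn T Rl.
- by move=> t; apply/asboolP.
- by move=> /asboolP rs /asboolP st; apply/asboolP/(subset_trans rs st).
- case: s t => [s hs] [t ht] /asboolP /= st /asboolP /= ts.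
  have est : s = t by exact/seteqP.
  by rewrite -est in ht *; congr exist; exact: Prop_irrelevance.
- have [[g Ag]|A0] := pselect (exists g, A g); last first.
    exists (exist _ _ G0P) => s As; exfalso; apply: A0; by exists s.
  suff UP : hbP [set p | exists2 g : T, A g & sval g p].
    by exists (exist _ _ UP) => s As; apply/asboolP => p sp; exists s.
  split.
  + move=> a x y r q [g1 A1 g1r] [g2 A2 g2q].
    have [/asboolP le12|/asboolP le21] := tA _ _ A1 A2.
      by exists g2 => //; case: (svalP g2) => + _ _; apply => //; exact: le12.
    by exists g1 => //; case: (svalP g1) => + _ _; apply => //; exact: le21.
  + by move=> x r [g1 A1 g1r]; case: (svalP g1) => _ + _; apply.
  + by exists g => //; case: (svalP g).
exists (sval M); split; first exact: svalP.
move=> x0; apply: contrapT => nx0.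
case: (svalP M) => Ml Mb Mv.
set G := sval M in nx0 Ml Mb Mv.
have MZ a x r : G (x, r) -> G (a *: x, a * r).
  move=> Gx; have G00 : G (0, 0).
    have := Ml (-1) _ _ _ _ Gx Gx.
    by rewrite scaleN1r mulN1r !addNr.
  by have := Ml a _ _ _ _ Gx G00; rewrite !addr0.
pose E := [set r.2 - `|r.1 - x0| | r in G].
have Eub y q : G (y, q) -> ubound E (`|y + x0| - q).
  move=> Gy _ [[x r] Gx <-] /=.
  have := Mb _ _ (Ml 1 _ _ _ _ Gx Gy); rewrite scale1r mul1r => h.
  have : `|x + y| <= `|x - x0| + `|y + x0|.
    by rewrite (le_trans _ (ler_normD _ _)) // addrACA addNr addr0.
  by lra.
have E0 : has_sup E.
  split; first by exists (`|v| - `|v - x0|), (v, `|v|).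
  by exists (`|v + x0| - `|v|); exact: Eub.
pose c := sup E.
have c1 x r : G (x, r) -> r - `|x - x0| <= c.
  by move=> Gx; apply: ub_le_sup; [case: E0|exists (x, r)].
have c2 y q : G (y, q) -> c <= `|y + x0| - q.
  by move=> Gy; apply: ge_sup; [case: E0|exact: Eub].
have G'P : hbP [set p | exists x r a,
    [/\ G (x, r), p.1 = x + a *: x0 & p.2 = r + a * c]].
  split.
  + move=> a x y r q [x1 [r1 [a1 [G1 /= -> ->]]]] [x2 [r2 [a2 [G2 /= -> ->]]]].
    exists (a *: x1 + x2), (a * r1 + r2), (a * a1 + a2); split.
    * exact: Ml.
    * by rewrite scalerDr scalerDl scalerA addrACA.
    * by ring.
  + move=> _ _ [x [r [a [Gx /= -> ->]]]].
    have [a0|a0|->] := ltgtP a 0; last first.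
    * by rewrite scale0r mul0r !addr0; exact: Mb.
    * have := c2 _ _ (MZ a^-1 _ _ Gx); rewrite lerBrDl => h.
      have : a * (a^-1 * r + c) <= a * `|a^-1 *: x + x0| by rewrite ler_pM2l.
      rewrite -[X in _ <= X * _](gtr0_norm a0) -normrZ scalerDr scalerA mulrDr mulrA.
      by rewrite divff ?gt_eqF // scale1r mul1r.
    * have na0 : 0 < - a by rewrite oppr_gt0.
      have := c1 _ _ (MZ (- a)^-1 _ _ Gx); rewrite lerBlDl -lerBlDr => h.
      have : (- a) * ((- a)^-1 * r - c) <= (- a) * `|(- a)^-1 *: x - x0|.
        by rewrite ler_pM2l.
      rewrite -[X in _ <= X * _](gtr0_norm na0) -normrZ scalerBr scalerA mulrBr mulrA.
      by rewrite divff ?gt_eqF // scale1r mul1r scaleNr opprK mulNr opprK.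
  + by exists v, `|v|, 0; split; rewrite ?scale0r ?mul0r ?addr0.
have := maxM (exist _ _ G'P); rewrite /Rl => h.
have {}h : exist _ _ G'P = M.
  apply: h; apply/asboolP => -[x r] Gx /=.
  by exists x, r, 0; split; rewrite ?scale0r ?mul0r ?addr0.
apply: nx0; exists c; rewrite /G -h /=.
exists 0, 0, 1; split; rewrite ?scale1r ?mul1r ?add0r //.
by have := MZ 0 _ _ Mv; rewrite scale0r mul0r.
Qed.

Lemma hahn_banach : exists l : V -> R^o,
  [/\ bop l, forall x, `|l x| <= `|x| & l v = `|v|].
Proof.
have [G [[Gl Gb Gv] Gt]] := norming_graph.
have fun0 x r q : G (x, r) -> G (x, q) -> r <= q.
  move=> Gr Gq; have := Gb _ _ (Gl (-1) _ _ _ _ Gq Gr).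
  by rewrite scaleN1r addNr normr0 mulN1r addrC subr_le0.
have funG x r q : G (x, r) -> G (x, q) -> r = q.
  by move=> Gr Gq; apply/eqP; rewrite eq_le !(fun0 x).
have /choice[l hl] := Gt.
have l1 x : `|l x| <= `|x|.
  rewrite ler_norml Gb // andbT lerNl.
  have G0 : G (0, 0).
    have := Gl (-1) _ _ _ _ Gv Gv; by rewrite scaleN1r mulN1r !addNr.
  have := Gb _ _ (Gl (-1) _ _ _ _ (hl x) G0).
  by rewrite !addr0 scaleN1r mulN1r normrN.
exists l; split => //.
- split.
    by move=> a x y; apply: (funG (a *: x + y)) => //; exact: Gl.
  by exists 1 => x; rewrite mul1r.
- by apply: (funG v).
Qed.

End extension.

(** Reduces estimates for vector-valued integrals and derivatives to scalar
    ones. *)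
Lemma norm_le_dual {V : normedModType R} (x : V) (c : R) :
  (forall l : V -> R^o, bop l -> (forall y, `|l y| <= `|y|) -> l x <= c) ->
  `|x| <= c.
Proof. by move=> h; have [l [bl l1 <-]] := hahn_banach x; exact: h. Qed.

Lemma eq_dual {V : normedModType R} (x y : V) :
  (forall l : V -> R^o, bop l -> l x = l y) -> x = y.
Proof.
move=> h; apply/eqP; rewrite -subr_eq0 -normr_le0.
by apply: norm_le_dual => l bl _; rewrite (bopB bl) h // subrr.
Qed.

End hahn_banach.

(** * Strongly measurable functions *)

Section null_sets.
Import HBNNSimple.

(** Neither function has to be measurable: a simple function below [f],
    multiplied by the indicator of the complement of [N], is below [g]. This
    matters for integrands that are themselves integrals or Besov norms. *)
Lemma ge0_integral_le_off_null d (T : measurableType d) (R : realType)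
    (mu : {measure set T -> \bar R}) (f g : T -> \bar R) (N : set T) :
  measurable N -> mu N = 0%E ->
  (forall t, (0 <= f t)%E) -> (forall t, (0 <= g t)%E) ->
  (forall t, ~ N t -> (f t <= g t)%E) ->
  (\int[mu]_t f t <= \int[mu]_t g t)%E.
Proof.
move=> mN N0 f0 g0 fg; rewrite (ge0_integralTE mu f0) (ge0_integralTE mu g0).
apply: ge_ereal_sup => _ [h hf <-].
pose k : {nnsfun T >-> R} := mul_nnsfun h (indic_nnsfun R (measurableC mN)).
apply: ereal_sup_ge; exists (sintegral mu k).
  exists k => // t; rewrite /k /= /measurable_realfun.mindic indicE in_setC.
  case: (boolP (t \in N)) => [tN|/negP tN] /=; first by rewrite mulr0.
  by rewrite mulr1 (le_trans (hf t)) // fg // => Nt; apply: tN; rewrite inE.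
rewrite -!integralT_nnsfun; rewrite le_eqVlt; apply/orP; left; apply/eqP; apply: ge0_ae_eq_integral => //.
- exact/measurable_realfun.measurable_EFinP.
- exact/measurable_realfun.measurable_EFinP.
- by move=> t _; rewrite lee_fin.
- by move=> t _; rewrite lee_fin.
exists N; split => // t /= /not_implyP[_]; apply: contra_notP => Nt.
by congr EFin; rewrite /k /= /measurable_realfun.mindic indicE in_setC memNset //= mulr1.
Qed.

End null_sets.

Section strong_measurability.
Context {R : realType}.
Local Notation mu := (@lebesgue_measure R).

Lemma ae_null (P : R -> Prop) : {ae mu, forall t, P t} ->
  exists N : set R, [/\ measurable N, mu N = 0%E & forall t, ~ N t -> P t].
Proof.
move=> [N [mN N0 PN]]; exists N; split => // t Nt.
by apply: contrapT => nP; apply: Nt; exact: PN.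
Qed.

Section simple.
Context {V : normedModType R}.

Lemma simple_preimage (g : R -> V) (A : set V) :
  simple_fun g -> measurable (g @^-1` A).
Proof.
move=> [fg mg].
have -> : g @^-1` A = \bigcup_(y in range g `&` A) (g @^-1` [set y]).
  apply/seteqP; split => [t At|t [y [_ Ay] /= gty]]; last by rewrite /= gty.
  by exists (g t) => //; split => //; exists t.
by apply: fin_bigcup_measurable => //; exact: finite_setIl.
Qed.

Lemma simple_cst (y : V) : simple_fun (fun _ : R => y).
Proof.
split; first by apply: (sub_finite_set _ (finite_set1 y)) => _ [t _ <-].
move=> z; have [->|yz] := pselect (z = y).
  suff -> : (fun=> y) @^-1` [set y] = [set: R] by [].
  by apply/seteqP; split.
suff -> : (fun=> y) @^-1` [set z] = set0 :> set R by [].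
by apply/seteqP; split => // t /= ?; apply: yz.
Qed.

End simple.

(** With finitely many pairs of values, no measurability of [F] is involved;
    this makes the class of simple functions stable under all operations
    below. *)
Lemma simple2 {V1 V2 W : normedModType R} (F : V1 -> V2 -> W)
    (g1 : R -> V1) (g2 : R -> V2) :
  simple_fun g1 -> simple_fun g2 -> simple_fun (fun t => F (g1 t) (g2 t)).
Proof.
move=> s1 s2; have [f1 _] := s1; have [f2 _] := s2; split.
  apply: (@sub_finite_set _ _
    ((fun p => F p.1 p.2) @` (range g1 `*` range g2))).
    by move=> _ [t _ <-]; exists (g1 t, g2 t) => //; split; exists t.
  by apply: finite_image; exact: finite_setX.
move=> w.
have -> : (fun t => F (g1 t) (g2 t)) @^-1` [set w] =
    \bigcup_(y in range g1) ((g1 @^-1` [set y]) `&`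
      (g2 @^-1` [set z | F y z = w])).
  apply/seteqP; split => [t /= tw|t [y _ [/= -> ]]] //.
  by exists (g1 t) => //; exists t.
apply: fin_bigcup_measurable => // y _.
by apply: measurableI; exact: simple_preimage.
Qed.

Lemma simple_indic (E : set R) : measurable E -> simple_fun (\1_E : R -> R^o).
Proof.
move=> mE; split; first exact: fimfunP.
move=> y; rewrite -[X in measurable X]setTI.
exact: (@measurable_indic _ _ R setT E mE measurableT [set y]).
Qed.

(** Convergence at every point, not almost everywhere, so that sums and
    compositions need no exceptional sets; integrable functions get such a
    representative in [bochner_L1_rep]. *)
Definition smeas {V : normedModType R} (f : R -> V) :=
  exists g : nat -> R -> V, (forall n, simple_fun (g n)) /\
    forall t, g n t @[n --> \oo] --> f t.

(** Extension by zero, which makes every integral an integral over the line. *)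
Definition cut {V : normedModType R} (E : set R) (f : R -> V) : R -> V :=
  fun t => if t \in E then f t else 0.

Lemma cutE {V : normedModType R} (E : set R) (f : R -> V) t :
  cut E f t = (\1_E t : R) *: f t.
Proof. by rewrite /cut indicE; case: (t \in E); rewrite ?scale1r ?scale0r. Qed.

Lemma smeas_simple {V : normedModType R} (g : R -> V) :
  simple_fun g -> smeas g.
Proof. by move=> sg; exists (fun=> g); split => // t; exact: cvg_cst. Qed.

Lemma smeas_comp {V W : normedModType R} (K : V -> W) (f : R -> V) :
  continuous K -> smeas f -> smeas (K \o f).
Proof.
move=> cK [g [sg gf]]; exists (fun n => K \o g n); split => [n|t].
  exact: (@simple2 _ _ _ (fun x (_ : V) => K x) _ (g n)).
by apply: (cvg_comp _ _ (gf t)); exact: cK.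
Qed.

Lemma smeasD {V : normedModType R} (f1 f2 : R -> V) :
  smeas f1 -> smeas f2 -> smeas (fun t => f1 t + f2 t).
Proof.
move=> [g1 [s1 c1]] [g2 [s2 c2]]; exists (fun n t => g1 n t + g2 n t); split.
  by move=> n; exact: simple2.
by move=> t; exact: cvgD.
Qed.

Lemma smeasN {V : normedModType R} (f : R -> V) :
  smeas f -> smeas (fun t => - f t).
Proof. by apply: smeas_comp => x; exact: continuousN. Qed.

Lemma smeasB {V : normedModType R} (f1 f2 : R -> V) :
  smeas f1 -> smeas f2 -> smeas (fun t => f1 t - f2 t).
Proof. by move=> s1 s2; apply: smeasD => //; exact: smeasN. Qed.

Lemma smeasZ {V : normedModType R} (k : R -> R^o) (f : R -> V) :
  smeas k -> smeas f -> smeas (fun t => (k t : R) *: f t).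
Proof.
move=> [g1 [s1 c1]] [g2 [s2 c2]].
exists (fun n t => (g1 n t : R) *: g2 n t); split.
  by move=> n; exact: (@simple2 R^o _ _ (fun (a : R) x => a *: x)).
by move=> t; exact: cvgZ.
Qed.

Lemma smeas_cut {V : normedModType R} (E : set R) (f : R -> V) :
  measurable E -> smeas f -> smeas (cut E f).
Proof.
move=> mE sf; rewrite (_ : cut E f = fun t => (\1_E t : R) *: f t).
  by apply: smeasZ => //; apply: smeas_simple; exact: simple_indic.
by apply/funext => t; rewrite cutE.
Qed.

Lemma simple_measurable (g : R -> R^o) :
  simple_fun g -> measurable_fun setT (g : R -> R).
Proof. by move=> sg _ Y mY; rewrite setTI; exact: simple_preimage. Qed.

Lemma smeas_measurable (f : R -> R^o) :
  smeas f -> measurable_fun setT (f : R -> R).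
Proof.
move=> [g [sg gf]].
apply: (@measurable_realfun.measurable_fun_cvg _ _ _ _ (g : nat -> R -> R)).
  by move=> n; exact: simple_measurable.
by move=> t _; exact: gf.
Qed.

Lemma smeas_norm {V : normedModType R} (f : R -> V) :
  smeas f -> measurable_fun setT (fun t => `|f t|).
Proof.
move=> sf; apply: smeas_measurable.
by apply: (@smeas_comp _ R^o (fun x => `|x|)) => // x; exact: norm_continuous.
Qed.

(** The number, counted from [- n], of the cell of length [1 / n] that
    contains [t]. *)
Let grid (n : nat) (t : R) : R^o :=
  if `|t| < n%:R then (Num.truncn ((t + n%:R) * n%:R))%:R else 0.

Let mnorm_lt (a : R) : measurable [set t : R | `|t| < a].
Proof.
rewrite (_ : [set _ | _] = `]-a, a[%classic) //.
by apply/seteqP; split => t; rewrite /= in_itv /= ltr_norml.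
Qed.

Lemma simple_grid n : simple_fun (grid n).
Proof.
split.
  apply: (@sub_finite_set _ _ ((fun i : nat => (i%:R : R^o)) @` `I_(2 * n ^ 2).+1)).
    move=> _ [t _ <-]; rewrite /grid; case: ifPn => [tn|_]; last by exists 0%N.
    exists (Num.truncn ((t + n%:R) * n%:R)) => //=.
    have tn0 : 0 <= (t + n%:R) * n%:R.
      by move: tn; rewrite ltr_norml => /andP[h _]; rewrite mulr_ge0 //; lra.
    have /andP[tn1 _] := truncn_itv tn0.
    rewrite ltnS -(ler_nat R); apply: (le_trans tn1).
    rewrite natrM natrX expr2 mulrA ler_wpM2r //.
    by move: tn; rewrite ltr_norml => /andP[_ h]; lra.
  by apply: finite_image; exact: finite_II.
move=> y; pose h (t : R) : R := (t + n%:R) * n%:R.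
have mh : measurable_fun setT h.
  by apply: measurable_funM => //; apply: measurable_funD.
pose C := [set t : R | `|t| < n%:R].
have mC : measurable C by exact: mnorm_lt.
pose B := [set x : R | 0 <= x /\ (Num.truncn x)%:R = y].
have mB : measurable B.
  have [[k yk]|nk] := pselect (exists k : nat, y = k%:R).
    rewrite (_ : B = `[k%:R, k.+1%:R[%classic) //.
    apply/seteqP; split => x; rewrite /B /= in_itv /=.
      move=> [x0]; rewrite yk => /eqP; rewrite eqr_nat => /eqP kx.
      by rewrite -kx; exact: truncn_itv.
    move=> kx; split; last by rewrite (truncn_def kx) yk.
    by case/andP: kx => + _; apply: le_trans.
  rewrite (_ : B = set0) //; apply/seteqP; split => // x [_ xy].
  by apply: nk; exists (Num.truncn x).
have -> : grid n @^-1` [set y] =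
    (C `&` h @^-1` B) `|` (~` C `&` [set _ | (0 : R) = y]).
  apply/seteqP; split => t.
    rewrite /grid /=; case: ifPn => [tn ty|/negP tn ty]; [left|right] => //.
    split => //; split => //=.
    by move: tn; rewrite ltr_norml => /andP[u _]; rewrite mulr_ge0 //; lra.
  move=> [[Ct [_ ty]]|[nCt ty]]; rewrite /grid /=; first by rewrite Ct.
  by case: ifPn.
apply: measurableU; apply: measurableI => //.
- by rewrite -[X in measurable X]setTI; exact: mh.
- exact: measurableC.
have [->|y0] := pselect (y = 0).
  by rewrite (_ : [set _ | _] = setT) //; apply/seteqP; split.
rewrite (_ : [set _ | _] = set0) //; apply/seteqP; split => // t /= /esym; exact: y0.
Qed.

Lemma cvg_right_seq {U : topologicalType} (f : R -> U) (l : U) (t : R) (p : nat -> R) :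
  f x @[x --> t^'+] --> l -> p n @[n --> \oo] --> t ->
  (\forall n \near \oo, t < p n) -> f (p n) @[n --> \oo] --> l.
Proof.
move=> ft pt tp A /ft; rewrite nbhs_filterE /at_right /within /= => nA.
have h1 : \forall n \near \oo, t < p n -> A (f (p n)) := pt _ nA.
by apply: filterS2 tp h1 => n a b; exact: b.
Qed.

(** Sampling [f] at the right end of the cell of length [1 / n] around [t]
    gives simple functions, and these sampling points tend to [t] strictly
    from the right. Orbits of a semigroup are only known to be right
    continuous at first. *)
Lemma smeas_right {V : normedModType R} (D : set R) (f : R -> V) :
  measurable D -> (forall t, D t -> f x @[x --> t^'+] --> f t) ->
  smeas (cut D f).
Proof.
move=> mD fD.
exists (fun n => cut (D `&` [set t : R | `|t| < n.+1%:R])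
  (fun t => f ((grid n.+1 t + 1) / n.+1%:R - n.+1%:R))); split => [n|t].
  rewrite (_ : cut _ _ = fun t => ((\1_(D `&` [set t : R | `|t| < n.+1%:R]) t : R^o) : R) *:
     f ((grid n.+1 t + 1) / n.+1%:R - n.+1%:R)); last first.
    by apply/funext => t; rewrite cutE.
  apply: (@simple2 R^o R^o V (fun (a : R^o) (b : R^o) =>
     (a : R) *: f (((b : R) + 1) / n.+1%:R - n.+1%:R))).
    apply: simple_indic; apply: measurableI => //.
  exact: simple_grid.
rewrite /cut; case: ifPn => [|/negP tD]; last first.
  rewrite (_ : (fun n => _) = fun=> 0); first exact: cvg_cst.
  apply/funext => n; case: ifPn => //; rewrite in_setI => /andP[+ _].
  by move=> ?; exfalso; exact: tD.
rewrite inE => Dt.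
pose p n := (grid n.+1 t + 1) / n.+1%:R - n.+1%:R : R.
have tlt : \forall n \near \oo, `|t| < n.+1%:R :> R.
  near=> n; rewrite (@lt_le_trans _ _ n%:R) ?ler_nat //.
  by near: n; exact: nbhs_infty_gtr.
have hp n : `|t| < n.+1%:R :> R -> t < p n <= t + n.+1%:R^-1.
  move=> tn; rewrite /p /grid tn.
  have n0 : (0 : R) < n.+1%:R by rewrite ltr0n.
  have tn0 : 0 <= (t + n.+1%:R) * n.+1%:R.
    by move: tn; rewrite ltr_norml => /andP[h _]; rewrite mulr_ge0 //; lra.
  have /andP[h1 h2] := truncn_itv tn0.
  rewrite -[X in _ < X]natr1 in h2.
  have e : (t + n.+1%:R^-1 + n.+1%:R) * n.+1%:R = (t + n.+1%:R) * n.+1%:R + 1.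
    by rewrite addrAC mulrDl mulVf ?gt_eqF.
  by rewrite ltrBrDr ltr_pdivlMr // h2 /= lerBlDr ler_pdivrMr // e lerD2r.
have pt : p n @[n --> \oo] --> t.
  apply/cvgrPdist_lt => e e0; near=> n.
  have /hp/andP[h1 h2] : `|t| < n.+1%:R :> R by near: n.
  rewrite ltr0_norm ?subr_lt0 // opprB ltrBlDl (le_lt_trans h2) // ltrD2l.
  near: n; exact: (near_infty_natSinv_lt (PosNum e0)).
have fp : f (p n) @[n --> \oo] --> f t.
  apply: (cvg_right_seq (fD _ Dt) pt).
  by near=> n; have /hp/andP[] : `|t| < n.+1%:R :> R by near: n.
apply: cvg_trans fp; apply: near_eq_cvg; near=> n.
by rewrite ifT // in_setI mem_set //= mem_set //=; near: n.
Unshelve. all: by end_near. Qed.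

End strong_measurability.

(** * Integrable vector-valued functions *)

Section integrable_functions.
Context {R : realType}.
Local Notation mu := (@lebesgue_measure R).

(** The form in which completeness is used throughout. *)
Lemma cauchy_cvg_bound {V : completeNormedModType R} (u : nat -> V) (e : nat -> R) :
  e n @[n --> \oo] --> (0 : R) ->
  (forall n m, `|u n - u m| <= e n + e m) -> cvgn u.
Proof.
move=> e0 ue; apply/cauchy_cvgP/cauchy_exP => d d0.
have hN : \forall n \near \oo, `|e n| < d / 2.
  move/cvgrPdist_lt: e0 => /(_ (d / 2)); rewrite divr_gt0 // => /(_ isT).
  by apply: filterS => n; rewrite sub0r normrN.
have [N _ {}hN] := hN.
exists (u N); exists N => // n /= Nn; rewrite -ball_normE /ball_ /=.
apply: (le_lt_trans (ue _ _)).
have := hN N (leqnn N); have := hN n Nn.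
by rewrite !ltr_norml => /andP[_ h1] /andP[_ h2]; lra.
Qed.

Definition L1n {V : normedModType R} (f : R -> V) : \bar R :=
  (\int[mu]_t (`|f t|)%:E)%E.

Definition L1 {V : normedModType R} (f : R -> V) := smeas f /\ (L1n f < +oo)%E.

Section L1_theory.
Context {V : normedModType R}.
Implicit Types f g : R -> V.

Lemma L1n_ge0 f : (0 <= L1n f)%E.
Proof. by apply: integral_ge0 => t _; rewrite lee_fin. Qed.

Lemma L1n_fin f : L1 f -> (L1n f = (fine (L1n f))%:E)%E.
Proof. by move=> [_ ?]; rewrite fineK // ge0_fin_numE // L1n_ge0. Qed.

Lemma measurable_normE f : smeas f ->
  measurable_fun setT (fun t => (`|f t|)%:E).
Proof. by move=> sf; apply/measurable_EFinP; exact: smeas_norm. Qed.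

Lemma L1_integrable f : L1 f -> mu.-integrable setT (fun t => (`|f t|)%:E).
Proof.
move=> [sf fo]; apply/integrableP; split; first exact: measurable_normE.
by rewrite (_ : (fun x => _) = (fun t => (`|f t|)%:E)) //; apply/funext => t; rewrite gee0_abs ?lee_fin.
Qed.

End L1_theory.

Lemma L1n_le {V W : normedModType R} (f : R -> V) (g : R -> W) : smeas f -> smeas g ->
  (forall t, `|f t| <= `|g t|) -> (L1n f <= L1n g)%E.
Proof.
move=> sf sg fg; apply: ge0_le_integral => //.
- exact: measurable_normE.
- by apply/measurable_EFinP; exact: smeas_norm.
- by move=> t _; rewrite lee_fin.
Qed.

Lemma L1_le {V W : normedModType R} (f : R -> V) (g : R -> W) : smeas f -> L1 g ->
  (forall t, `|f t| <= `|g t|) -> L1 f.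
Proof.
by move=> sf [sg goo] fg; split => //; rewrite (le_lt_trans (L1n_le sf sg fg)).
Qed.

Section L1_theory.
Context {V : normedModType R}.
Implicit Types f g : R -> V.

Lemma L1nZ (c : R) f : smeas f -> (L1n (fun t => c *: f t)%R = `|c|%:E * L1n f)%E.
Proof.
move=> sf; rewrite /L1n.
under eq_integral do rewrite normrZ EFinM.
by rewrite ge0_integralZl_EFin //; [exact: measurable_normE].
Qed.

Lemma L1nD f g : smeas f -> smeas g ->
  (L1n (fun t => f t + g t)%R <= L1n f + L1n g)%E.
Proof.
move=> sf sg; rewrite /L1n -ge0_integralD //; try exact: measurable_normE.
apply: ge0_le_integral => //.
- by apply: measurable_normE; exact: smeasD.
- by apply: emeasurable_funD; exact: measurable_normE.
- by move=> t _; rewrite -EFinD lee_fin ler_normD.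
Qed.

Lemma L1nN f : L1n (fun t => - f t) = L1n f.
Proof. by apply: eq_integral => t _; rewrite normrN. Qed.

Lemma L1N f : L1 f -> L1 (fun t => - f t).
Proof. by move=> [sf foo]; split; [exact: smeasN|rewrite L1nN]. Qed.

Lemma L1nB f g : smeas f -> smeas g ->
  (L1n (fun t => f t - g t)%R <= L1n f + L1n g)%E.
Proof. by move=> sf sg; rewrite -(L1nN g); apply: L1nD => //; exact: smeasN. Qed.

Lemma L1D f g : L1 f -> L1 g -> L1 (fun t => f t + g t).
Proof.
move=> [sf foo] [sg goo]; split; first exact: smeasD.
by rewrite (le_lt_trans (L1nD sf sg)) // lte_add_pinfty.
Qed.

Lemma L1B f g : L1 f -> L1 g -> L1 (fun t => f t - g t).
Proof. by move=> f1 g1; apply: L1D => //; exact: L1N. Qed.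

Lemma L1_cut (D : set R) f : measurable D -> L1 f -> L1 (cut D f).
Proof.
move=> mD f1; apply: (L1_le _ f1); first by apply: smeas_cut => //; case: f1.
by move=> t; rewrite /cut; case: ifP => //; rewrite normr0.
Qed.

Lemma L1_comp {W : normedModType R} (K : V -> W) f : bop K -> L1 f -> L1 (K \o f).
Proof.
move=> bK [sf foo]; have [C C0 hC] := bop_bound bK.
have sKf : smeas (K \o f) by apply: smeas_comp => //; exact: bop_continuous.
have sCf : smeas (fun t => C *: f t).
  by apply: (smeas_comp (K := fun x => C *: x)) => // x; exact: scaler_continuous.
apply: (L1_le (g := fun t => C *: f t)) => //.
  by split => //; rewrite L1nZ //; apply: lte_mul_pinfty.
by move=> t /=; rewrite normrZ gtr0_norm.
Qed.

Lemma dual_integrable (l : V -> R^o) f : bop l -> L1 f ->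
  mu.-integrable setT (EFin \o (fun t => l (f t) : R)).
Proof.
move=> bl f1; have [sl loo] := L1_comp bl f1.
apply/integrableP; split; first by apply/measurable_EFinP; exact: smeas_measurable.
exact: loo.
Qed.

Lemma dual_int_le (l : V -> R^o) f : bop l -> (forall x, `|l x| <= `|x|) ->
  L1 f -> `|\int[mu]_t (l (f t) : R)| <= fine (L1n f).
Proof.
move=> bl l1 f1; apply: (le_trans (le_normr_Rintegral _ _)) => //.
  exact: dual_integrable.
rewrite /Rintegral /L1n fine_le //.
- rewrite ge0_fin_numE; last by apply: integral_ge0 => t _; rewrite lee_fin.
  by have [_] := L1_comp bl f1.
- by rewrite -/(L1n f) (L1n_fin f1).
- have [sl _] := L1_comp bl f1; have [sf _] := f1.
  by apply: (@L1n_le R^o V (l \o f)) => // t; exact: l1.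
Qed.

(** Truncating the approximating functions to zero where their norm exceeds [2
    |f|] leaves the pointwise limit unchanged and provides a dominating
    function. *)
Lemma simple_approx f : smeas f -> exists s : nat -> R -> V,
  [/\ forall n, simple_fun (s n), forall n t, `|s n t| <= 2 * `|f t| &
      forall t, s n t @[n --> \oo] --> f t].
Proof.
move=> sf; have [g [sg gf]] := sf.
pose E n := [set t | `|g n t| <= 2 * `|f t|].
have mE n : measurable (E n).
  have mh : measurable_fun setT (fun t => 2 * `|f t| - `|g n t|).
    apply: measurable_funB; last by apply: smeas_norm; exact: smeas_simple.
    by apply: measurable_funM => //; exact: smeas_norm.
  rewrite (_ : E n = (fun t => 2 * `|f t| - `|g n t|) @^-1` `[0, +oo[).
    by rewrite -[X in measurable X]setTI; exact: mh.
  by apply/seteqP; split => t; rewrite /E /= in_itv /= andbT subr_ge0.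
exists (fun n => cut (E n) (g n)); split.
- move=> n; rewrite (_ : cut _ _ = fun t => ((\1_(E n) t : R^o) : R) *: g n t).
    by apply: (@simple2 _ R^o _ _ (fun (a : R^o) x => (a : R) *: x)) => //; exact: simple_indic.
  by apply/funext => t; rewrite cutE.
- move=> n t; rewrite /cut; case: ifPn; first by rewrite inE.
  by rewrite normr0 mulr_ge0.
move=> t; have [f0|f0] := eqVneq (f t) 0.
  rewrite (_ : (fun n => _) = fun=> 0); first by rewrite f0; exact: cvg_cst.
  apply/funext => n; rewrite /cut; case: ifPn => //.
  by rewrite inE /E /= f0 normr0 mulr0 normr_le0 => /eqP.
apply: cvg_trans (gf t); apply: near_eq_cvg.
have : \forall n \near \oo, `|g n t| < 2 * `|f t|.
  have : `|g n t| @[n --> \oo] --> `|f t| by exact: cvg_norm.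
  move=> /cvgr_lt; apply; have : 0 < `|f t| by rewrite normr_gt0.
  by lra.
by apply: filterS => n h; rewrite /cut mem_set //; exact: ltW.
Qed.

Lemma simple_L1 (s : R -> V) f : L1 f -> simple_fun s ->
  (forall t, `|s t| <= 2 * `|f t|) -> L1 s.
Proof.
move=> [sf foo] ss sf2.
have s2f : smeas (fun t => 2 *: f t).
  by apply: (smeas_comp (K := fun x => 2 *: x)) => // x; exact: scaler_continuous.
apply: (L1_le (g := fun t => 2 *: f t)); first exact: smeas_simple.
  by split => //; rewrite L1nZ //; apply: lte_mul_pinfty => //.
by move=> t; rewrite normrZ ger0_norm.
Qed.

Lemma simple_L1_integrable (s : R -> V) (D : set R) : measurable D ->
  simple_fun s -> L1 s -> simple_integrable D s.
Proof.
move=> mD ss [_ soo]; split => // y y0.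
have mE : measurable (s @^-1` [set y]) by case: ss.
have y0' : 0 < `|y| by rewrite normr_gt0.
apply: (@le_lt_trans _ _ (mu (s @^-1` [set y]))).
  by rewrite le_measure // inE //; exact: measurableI.
rewrite -(@lte_pmul2l _ `|y|%:E) // mulry gtr0_sg // mul1e.
apply: le_lt_trans soo.
rewrite -[X in mu X]setIT -integral_indic // -ge0_integralZl_EFin //; last first.
  by apply/measurable_EFinP; exact: (@measurable_indic _ _ R).
apply: ge0_le_integral => //.
- by apply/measurable_EFinP; apply: measurable_funM => //; exact: (@measurable_indic _ _ R).
- by apply: measurable_normE; exact: smeas_simple.
move=> t _; rewrite -EFinM lee_fin indicE.
have [|] := boolP (t \in _); rewrite ?mulr0 ?mulr1 //.
by rewrite inE /= => ->.
Qed.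

Lemma L1_approx f : L1 f -> exists s : nat -> R -> V,
  [/\ forall n, simple_fun (s n), forall n, L1 (s n),
      forall t, s n t @[n --> \oo] --> f t &
      L1n (fun t => f t - s n t) @[n --> \oo] --> 0%E].
Proof.
move=> f1; have [sf foo] := f1; have [s [ss s2 sft]] := simple_approx sf.
have s1 n : L1 (s n) by exact: (simple_L1 f1).
exists s; split => //.
have sm n : smeas (fun t => f t - s n t).
  by apply: smeasB => //; exact: smeas_simple.
have := @dominated_convergence _ _ _ mu setT measurableT
  (fun n t => `|f t - s n t|%:E) (cst 0%E) (fun t => (3 * `|f t|)%:E).
case.
- by move=> n; exact: measurable_normE.
- exact: measurable_cst.
- apply: aeW => t _; apply: cvg_EFin; first by near=> n.
  rewrite (_ : (fine \o _) = fun n => `|f t - s n t|) //.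
  rewrite -(normr0 V) -[X in `|X|](subrr (f t)).
  by apply: cvg_norm; apply: cvgB => //; exact: cvg_cst.
- under eq_fun do rewrite EFinM.
  by apply: integrableZl => //; exact: L1_integrable.
- apply: aeW => t n _ /=; rewrite normr_id lee_fin.
  by rewrite (le_trans (ler_normB _ _)) //; have := s2 n t; lra.
by move=> _ _; rewrite integral0.
Unshelve. all: by end_near. Qed.

End L1_theory.
End integrable_functions.

(** * The Bochner integral through functionals *)

Section bochner_theory.
Context {R : realType}.
Local Notation mu := (@lebesgue_measure R).

Lemma bochner_norm1E {V : normedModType R} (D : set R) (f : R -> V) :
  bochner_norm 1 D f = L1n (cut D f).
Proof.
rewrite /bochner_norm Lnorm1; apply: eq_integral => t _; rewrite /cut.
by case: ifP => _; rewrite ?abse_id ?normr0 ?abse0 // gee0_abs ?lee_fin.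
Qed.

Lemma smeas_simple_cut {V : normedModType R} (D : set R) (g : R -> V) :
  measurable D -> simple_fun g -> smeas (cut D g).
Proof. by move=> mD sg; apply: smeas_cut => //; exact: smeas_simple. Qed.

Lemma integral_indicT (E : set R) : measurable E ->
  (\int[mu]_t (\1_E t)%:E = mu E)%E.
Proof. by move=> mE; rewrite integral_indic // setIT. Qed.

Lemma integrable_indic_lty (E : set R) : measurable E -> (mu E < +oo)%E ->
  mu.-integrable setT (EFin \o (\1_E : R -> R)).
Proof.
move=> mE Eoo; apply/integrableP; split.
  by apply/measurable_EFinP; exact: (@measurable_indic _ _ R).
under eq_integral => t _ do rewrite gee0_abs ?lee_fin //.
by rewrite integral_indic // setIT.
Qed.

Section pettis.
Context {V : normedModType R}.
Variables (D : set R) (mD : measurable D).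

Lemma pettis_simple (g : R -> V) (l : V -> R^o) : bop l ->
  simple_integrable D g ->
  mu.-integrable setT (EFin \o (fun t => l (cut D g t) : R)) /\
  (l (simple_integral D g) : R) = \int[mu]_t (l (cut D g t) : R).
Proof.
move=> bl [sg gD]; have [fg mg] := sg.
pose E y := D `&` g @^-1` [set y].
have mE y : measurable (E y) by exact: measurableI.
have El y : mu.-integrable setT (fun t => ((l y : R) * \1_(E y) t)%:E) /\
   (\int[mu]_t ((l y : R) * \1_(E y) t)%:E = (fine (mu (E y)) * l y)%:E)%E.
  have [->|y0] := eqVneq y 0.
    rewrite (bop0 bl); split.
      apply: (eq_integrable measurableT (cst 0%E)); last exact: integrable0.
      by move=> t _; rewrite /= mul0r.
    by under eq_integral do rewrite mul0r; rewrite integral0 mulr0.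
  have iE : mu.-integrable setT (EFin \o \1_(E y)).
    by apply: integrable_indic_lty => //; exact: gD.
  under eq_fun do rewrite EFinM.
  split; first exact: integrableZl.
  rewrite integralZl // [X in (_ * X)%E](_ : _ = mu (E y)); last first.
    exact: integral_indicT.
  rewrite mulrC EFinM fineK //.
  by rewrite ge0_fin_numE //; exact: gD.
pose s := finmap.enum_fset (fset_set (range g)).
have us : uniq s by exact: finmap.fset_uniq.
have gs t : g t \in s by rewrite in_fset_set // inE; exists t.
have lE t : (l (cut D g t) : R) = \sum_(y <- s) (l y : R) * \1_(E y) t.
  rewrite /cut; case: ifPn => tD.
    rewrite (bigD1_seq (g t)) //= big1 ?addr0.
      by rewrite indicE mem_set ?mulr1 //; split => //; exact: set_mem.
    move=> y ygt; rewrite indicE memNset ?mulr0 // => -[_ /= e].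
    by rewrite e eqxx in ygt.
  rewrite (bop0 bl) big1 // => y _; rewrite indicE memNset ?mulr0 // => -[Dt _].
  by move: tD; rewrite mem_set.
have lE' : (EFin \o (fun t => l (cut D g t) : R)) =
   (fun t => \sum_(y <- s) ((l y : R) * \1_(E y) t)%:E)%E.
  by apply/funext => t; rewrite /= lE sumEFin.
split.
  by rewrite lE'; apply: integrable_sum => // y _; case: (El y).
rewrite /Rintegral; under eq_integral do rewrite lE -sumEFin.
rewrite integral_sum //; last by move=> y; case: (El y).
rewrite (eq_bigr (fun y => (fine (mu (E y)) * (l y : R))%:E)); last first.
  by move=> y _; case: (El y).
rewrite sumEFin /= /simple_integral fsbig_finite //= (bop_sum bl).
by apply: eq_bigr => y _; rewrite (bopZ bl).
Qed.

(** The Bochner integral is the vector whose image under every functional is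
    the scalar integral; all later identities between integrals are proved in
    this form. *)
Lemma pettis_int (f : R -> V) (I : V) (l : V -> R^o) : bop l ->
  L1 (cut D f) -> is_bochner_integral D f I ->
  (l I : R) = \int[mu]_t (l (cut D f t) : R).
Proof.
move=> bl fD [g [sg gf gI lI]]; have [C C0 hC] := bop_bound bl.
have lf := dual_integrable bl fD.
apply/esym/(@cvg_unique _ (@norm_hausdorff R R^o) (l (simple_integral D (g n)) @[n --> \oo])); last first.
  by apply: (cvg_comp _ _ lI); exact: bop_continuous.
apply/cvgrPdist_le => e e0.
have : \forall n \near \oo, (bochner_norm 1 D (f \- g n)%R < (e / C)%:E)%E.
  have eC : (0 < (e / C)%:E)%E by rewrite lte_fin divr_gt0.
  have /fine_cvgP[ffin fcv] := gI.
  have fe : \forall n \near \oo, fine (bochner_norm 1 D (f \- g n)) < e / C.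
    by apply: (cvgr_lt _ fcv); rewrite divr_gt0.
  by apply: filterS2 ffin fe => n hn; rewrite -lte_fin /= fineK.
apply: filterS => n; rewrite bochner_norm1E => hn.
have [lg ->] := pettis_simple bl (sg n).
rewrite -RintegralB //.
have sd : smeas (cut D (f \- g n)).
  rewrite (_ : cut D _ = fun t => cut D f t - cut D (g n) t).
    by apply: smeasB; [case: fD|apply: smeas_simple_cut => //; case: (sg n)].
  by apply/funext => t; rewrite /cut; case: ifP; rewrite ?subr0.
have d1 : L1 (cut D (f \- g n)) by split => //; apply: (lt_trans hn); rewrite ltry.
rewrite (_ : (fun x => _) = (fun t => l (cut D (f \- g n) t) : R)); last first.
  by apply/funext => t; rewrite -(bopB bl) /cut; case: ifP; rewrite ?subr0.
apply: (le_trans (le_normr_Rintegral _ (dual_integrable bl d1))) => //.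
rewrite -lee_fin /Rintegral fineK; last first.
  rewrite ge0_fin_numE; last by apply: integral_ge0 => t _; rewrite lee_fin.
  by have [_] := L1_comp bl d1.
apply: (@le_trans _ _ (C%:E * L1n (cut D (f \- g n)%R))%E); last first.
  by move/ltW: hn; rewrite -(@lee_pmul2l _ C%:E) // -EFinM mulrCA divff ?mulr1 // gt_eqF.
rewrite -ge0_integralZl_EFin ?(ltW C0) //; last exact: measurable_normE.
apply: ge0_le_integral => //.
- by apply: measurable_normE; apply: smeas_comp sd; exact: bop_continuous.
- by apply/measurable_EFinP; apply: measurable_funM => //; exact: smeas_norm.
- by move=> t _; rewrite -EFinM lee_fin.
Qed.

End pettis.

(** The integrals of approximating simple functions form a Cauchy sequence,
    since functionals of norm at most 1 see differences bounded by the L1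
    distance. *)
Lemma bochner_ex {V : completeNormedModType R} (D : set R) (f : R -> V) :
  measurable D -> L1 (cut D f) -> exists I, is_bochner_integral D f I.
Proof.
move=> mD fD; have [s [ss s1 sft sn]] := L1_approx fD.
have si n := simple_L1_integrable mD (ss n) (s1 n).
have dle n : (L1n (fun t => cut D f t - cut D (s n) t)%R <=
    L1n (fun t => cut D f t - s n t)%R)%E.
  apply: L1n_le.
  - by apply: smeasB; [case: fD|apply: smeas_simple_cut].
  - by apply: smeasB; [case: fD|apply: smeas_simple].
  - by move=> t; rewrite /cut; case: ifP => //; rewrite subr0 normr0.
pose e n := fine (L1n (fun t => cut D f t - s n t)).
have e0 : e n @[n --> \oo] --> (0 : R) by apply: (fine_cvg sn).
have cvgI : cvgn (fun n => simple_integral D (s n)).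
  apply: (cauchy_cvg_bound e0) => n m; apply: norm_le_dual => l bl l1.
  rewrite (bopB bl); have [i1 ->] := pettis_simple mD bl (si n).
  have [i2 ->] := pettis_simple mD bl (si m).
  rewrite -RintegralB //.
  rewrite (_ : (fun x => _) = (fun t => l (cut D (s n) t - cut D (s m) t) : R)); last first.
    by apply/funext => t; rewrite (bopB bl).
  have d1 : L1 (fun t => cut D (s n) t - cut D (s m) t).
    by apply: L1B; exact: L1_cut.
  apply: (le_trans (ler_norm _)); apply: (le_trans (dual_int_le bl l1 d1)).
  have dn k : L1 (fun t => cut D f t - s k t) by apply: L1B.
  rewrite -lee_fin -(L1n_fin d1) EFinD -!(L1n_fin (dn _)).
  have dk k : L1 (fun t => cut D f t - cut D (s k) t) by apply: L1B => //; exact: L1_cut.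
  rewrite (_ : (fun t => _) = (fun t =>
     (cut D f t - cut D (s m) t) - (cut D f t - cut D (s n) t))); last first.
    by apply/funext => t; rewrite opprB [RHS]addrC addrA subrK.
  apply: (le_trans (L1nB _ _)); [by case: (dk m)|by case: (dk n)|].
  by rewrite addeC leeD.
exists (limn (fun n => simple_integral D (s n))); exists s; split => //.
- apply: aeW => t Dt; have := sft t; rewrite /cut mem_set //.
- apply: (squeeze_cvge _ (cvg_cst 0%E) sn); near=> n.
  rewrite bochner_norm1E L1n_ge0 /=; apply: le_trans (dle n).
  rewrite (_ : cut D (f \- s n) = (fun t => cut D f t - cut D (s n) t)) //.
  by apply/funext => t; rewrite /cut; case: ifP; rewrite ?subr0.
Unshelve. all: by end_near. Qed.

End bochner_theory.

(** * Series in L1 *)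

Section L1_limits.
Context {R : realType}.
Local Notation mu := (@lebesgue_measure R).

(** The sum of the [h n] has a finite integral by monotone convergence, so it
    is finite almost everywhere. *)
Lemma ae_summable (h : nat -> R -> R) :
  (forall n, measurable_fun setT (h n)) -> (forall n t, 0 <= h n t) ->
  (\sum_(0 <= n <oo) \int[mu]_t (h n t)%:E < +oo)%E ->
  exists N : set R, [/\ measurable N, mu N = 0%E &
    forall t, ~ N t -> cvgn (series (fun n => h n t))].
Proof.
move=> mh h0 hoo; apply: ae_null.
have mhE n : measurable_fun setT (fun t => (h n t)%:E) by exact/measurable_EFinP.
pose G t := (\sum_(0 <= n <oo) (h n t)%:E)%E.
have G0 t : (0 <= G t)%E by apply: nneseries_ge0 => n _ _; rewrite lee_fin.
have mG : measurable_fun setT G.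
  by apply: ge0_emeasurable_sum => // n t _ _; rewrite lee_fin.
have iG : mu.-integrable setT G.
  apply/integrableP; split => //.
  under eq_integral => t _ do rewrite gee0_abs //.
  by rewrite integral_nneseries // => n t _; rewrite lee_fin.
have := integrable_ae measurableT iG; apply: filterS => t /(_ I) Gfin.
apply: nondecreasing_is_cvgn.
  by apply/nondecreasing_seqP => n; rewrite /series /= big_nat_recr //= lerDl.
exists (fine (G t)) => _ [n _ <-]; rewrite -lee_fin fineK // /series /= -sumEFin.
by apply: nneseries_lim_ge => k _; rewrite lee_fin.
Qed.

Lemma nneseries_le_ub (u : nat -> \bar R) (c : \bar R) : (forall n, (0 <= u n)%E) ->
  (forall N, (\sum_(0 <= n < N) u n <= c)%E) -> (\sum_(0 <= n <oo) u n <= c)%E.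
Proof.
move=> u0 uc; apply: lime_le; first by apply: is_cvg_nneseries => n _ _.
by near=> n.
Unshelve. all: by end_near. Qed.

(** Sets the limit to zero on the exceptional set, which turns almost
    everywhere convergence into convergence at every point. *)
Lemma smeas_lim_off_null {V : normedModType R} (f : R -> V) (g : nat -> R -> V)
    (N : set R) : measurable N -> (forall n, simple_fun (g n)) ->
  (forall t, ~ N t -> g n t @[n --> \oo] --> f t) ->
  smeas (cut (~` N) f).
Proof.
move=> mN sg gf; exists (fun n => cut (~` N) (g n)); split => [n|t].
  rewrite (_ : cut _ _ = fun t => ((\1_(~` N) t : R^o) : R) *: g n t).
    apply: (@simple2 _ R^o _ _ (fun (a : R^o) x => (a : R) *: x)) => //.
    by apply: simple_indic; exact: measurableC.
  by apply/funext => t; rewrite cutE.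
rewrite /cut; case: ifPn => [|_]; last exact: cvg_cst.
by rewrite inE => /gf.
Qed.

Lemma L1_sum {V : normedModType R} (f : nat -> R -> V) n :
  (forall k, L1 (f k)) -> L1 (fun t => \sum_(0 <= k < n) f k t).
Proof.
move=> sf; elim: n => [|n IH].
  under eq_fun do rewrite big_nil; split; first exact: smeas_simple (simple_cst _).
  by rewrite /L1n; under eq_integral do rewrite normr0; rewrite integral0 ltry.
under eq_fun do rewrite big_nat_recr //=; exact: L1D.
Qed.

Lemma series_norm_tail {V : completeNormedModType R} (u : nat -> V) N :
  cvgn [normed series u] ->
  `|limn (series u) - series u N| <= limn [normed series u].
Proof.
move=> cu; have cs := normed_cvg cu.
have cd : `|series u n - series u N| @[n --> \oo] --> `|limn (series u) - series u N|.
  by apply: cvg_norm; apply: cvgB => //; exact: cvg_cst.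
rewrite -(cvg_lim (@norm_hausdorff R R^o) cd); apply: limr_le; first by apply: cvgP cd.
near=> n; have Nn : (N <= n)%N by near: n; exact: nbhs_infty_ge.
rewrite sub_series Nn; apply: (le_trans (ler_norm_sum _ _ _)).
apply: (@le_trans _ _ ([normed series u] n)).
  by rewrite /series /= [leRHS](big_cat_nat _ Nn) //= lerDr sumr_ge0.
apply: nondecreasing_cvgn_le => //.
have h : {homo series (fun n => `|u n|) : n m / (n <= m)%N >-> n <= m}.
  by apply/nondecreasing_seqP => k; rewrite /series /= big_nat_recr //= lerDl.
exact: h.
Unshelve. all: by end_near. Qed.

(** Completeness of L1. Approximating the partial sum of rank [N] by a simple
    function with error [2^-N] in L1 makes the errors summable, hence
    pointwise null almost everywhere, so that the sum is a limit of simple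
    functions. The last clause keeps track of supports. *)
Lemma L1_series {V : completeNormedModType R} (f : nat -> R -> V) (c : \bar R) :
  (forall n, L1 (f n)) -> (c < +oo)%E ->
  (forall N, (\sum_(0 <= n < N) L1n (f n) <= c)%E) ->
  exists F : R -> V, [/\ L1 F, (L1n F <= c)%E,
    {ae mu, forall t, series (fun n => f n t) N @[N --> \oo] --> F t},
    L1n (fun t => F t - series (fun n => f n t) N) @[N --> \oo] --> 0%E &
    forall t, (forall n, f n t = 0) -> F t = 0].
Proof.
move=> f1 coo fc; have sf n : smeas (f n) by case: (f1 n).
have m_ n := measurable_normE (sf n).
have fsum : (\sum_(0 <= n <oo) L1n (f n) <= c)%E.
  by apply: nneseries_le_ub => // n; exact: L1n_ge0.
have [N1 [mN1 N10 hN1]] := @ae_summable (fun n t => `|f n t|)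
  (fun n => smeas_norm (sf n)) (fun n t => normr_ge0 _) (le_lt_trans fsum coo).
pose P N t := series (fun n => f n t) N.
have P1 N : L1 (P N) by exact: L1_sum.
have /choice[s hs] : forall N, exists s : R -> V, [/\ simple_fun s, L1 s &
    (L1n (fun t => P N t - s t)%R <= (2^-1 ^+ N)%:E)%E].
  move=> N; have [s [ss s1 _ sP]] := L1_approx (P1 N).
  have /fine_cvgP[ffin fcv] := sP.
  have p2 : 0 < (2^-1 : R) ^+ N by rewrite exprn_gt0 // invr_gt0.
  have fe : \forall n \near \oo, fine (L1n (fun t => P N t - s n t)) < 2^-1 ^+ N.
    by apply: (cvgr_lt _ fcv).
  have [n [h1 h2]] : exists n, L1n (fun t => P N t - s n t) \is a fin_num /\
      fine (L1n (fun t => P N t - s n t)) < 2^-1 ^+ N.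
    have [M _ hM] : \forall n \near \oo, L1n (fun t => P N t - s n t) \is a fin_num /\
      fine (L1n (fun t => P N t - s n t)) < 2^-1 ^+ N by apply: filterS2 ffin fe.
    by exists M; apply: hM => /=.
  by exists (s n); split => //; rewrite -(fineK h1) lee_fin ltW.
have d1 N : L1 (fun t => P N t - s N t) by apply: L1B => //; case: (hs N).
have sd : (\sum_(0 <= n <oo) L1n (fun t => P n t - s n t)%R < +oo)%E.
  apply: (@le_lt_trans _ _ 2%:E); last exact: ltry.
  apply: nneseries_le_ub => [n|N]; first exact: L1n_ge0.
  apply: (@le_trans _ _ (\sum_(0 <= n < N) (2^-1 ^+ n)%:E)%E).
    by apply: lee_sum => i _; case: (hs i).
  rewrite sumEFin lee_fin big_mkord.
  have := subrX1 (2^-1 : R) N; have : 0 < (2^-1 : R) ^+ N by rewrite exprn_gt0 // invr_gt0.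
  by move: (_ ^+ N) (\sum_(i < N) _) => a b; lra.
have [N2 [mN2 N20 hN2]] := @ae_summable (fun N t => `|P N t - s N t|)
  (fun n => smeas_norm (d1 n).1) (fun n t => normr_ge0 _) sd.
pose N := N1 `|` N2.
have mN : measurable N by exact: measurableU.
have N0 : mu N = 0%E by apply: null_set_setU.
pose F := cut (~` N) (fun t => limn (P ^~ t)).
have PF t : ~ N t -> P n t @[n --> \oo] --> F t.
  move=> Nt; rewrite /F /cut mem_set //.
  by apply: normed_cvg; apply: hN1 => ?; apply: Nt; left.
have sF : smeas F.
  apply: (@smeas_lim_off_null _ _ s) => //; first by move=> n; case: (hs n).
  move=> t Nt.
  have := PF t Nt; rewrite /F /cut mem_set // => PFt.
  have /cvg_series_cvg_0 d0 : cvgn (series (fun n => `|P n t - s n t|)).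
    by apply: hN2 => ?; apply: Nt; right.
  have : (P n t - s n t) @[n --> \oo] --> (0 : V) by apply/norm_cvg0P.
  move=> /(cvgB PFt); rewrite subr0; apply: cvg_trans.
  by under [X in _ --> X @ _]eq_fun do rewrite opprB addrC subrK.
pose g t := (\sum_(0 <= n <oo) (`|f n t|)%:E)%E.
have g0 t : (0 <= g t)%E by apply: nneseries_ge0 => n _ _; rewrite lee_fin.
have mg : measurable_fun setT g.
  by apply: ge0_emeasurable_sum => // n t _ _; rewrite lee_fin.
have ig : (\int[mu]_t g t <= c)%E.
  by rewrite integral_nneseries // => n t _; rewrite lee_fin.
have tail t M : ~ N t -> ((`|F t - P M t|)%:E <= g t)%E.
  move=> Nt; have cf : cvgn [normed series (fun n => f n t)].
    by apply: hN1 => ?; apply: Nt; left.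
  rewrite /F /cut mem_set //; apply: (@le_trans _ _
     (limn [normed series (fun n => f n t)])%:E).
    by rewrite lee_fin; exact: series_norm_tail.
  have e : (fun n => (\sum_(0 <= k < n) (`|f k t|)%:E)%E) =
      EFin \o [normed series (fun n => f n t)].
    by apply/funext => n; rewrite sumEFin.
  by rewrite /g e EFin_lim.
have Fg : (L1n F <= c)%E.
  apply: le_trans ig.
  apply: (@ge0_integral_le_off_null _ _ R mu _ _ N mN N0) => // t Nt.
  by have := tail t 0%N Nt; rewrite /P /series /= big_nil subr0.
exists F; split => //.
- by split => //; exact: le_lt_trans Fg _.
- by exists N; split => // t /= h; apply: contrapT => Nt; apply: h; exact: PF.
- have sFP M : smeas (fun t => F t - P M t) by apply: smeasB => //; case: (P1 M).
  have := @dominated_convergence _ _ _ mu setT measurableT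
    (fun n t => `|F t - P n t|%:E) (cst 0%E) g.
  case => //.
  + by move=> n; exact: measurable_normE.
  + exists N; split => // t /= h; apply: contrapT => Nt; apply: h => _.
    apply: cvg_EFin; first by near=> n.
    rewrite (_ : (fine \o _) = fun n => `|F t - P n t|) //.
    rewrite -(normr0 V) -[X in `|X|](subrr (F t)).
    by apply: cvg_norm; apply: cvgB; [exact: cvg_cst|exact: PF].
  + apply/integrableP; split => //.
    under eq_integral => t _ do rewrite gee0_abs //.
    exact: le_lt_trans ig coo.
  + exists N; split => // t /= h; apply: contrapT => Nt; apply: h => n _.
    by rewrite /= normr_id; exact: tail.
  by move=> _ _; rewrite integral0.
- move=> t ft; rewrite /F /cut; case: ifP => // _.
  rewrite (_ : P ^~ t = fun=> 0) ?lim_cst //.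
  by apply/funext => n; rewrite /P /series /= big1 // => i _; rewrite ft.
Unshelve. all: by end_near. Qed.

End L1_limits.

(** * Weak derivatives *)

Section weak_derivatives.
Context {R : realType}.
Local Notation mu := (@lebesgue_measure R).

Lemma ae_imp (P Q : R -> Prop) : (forall t, P t -> Q t) ->
  {ae mu, forall t, P t} -> {ae mu, forall t, Q t}.
Proof.
move=> PQ [N [mN N0 PN]]; exists N; split => // t nQ.
by apply: PN => Pt; apply: nQ; exact: PQ.
Qed.

Lemma ae_imp2 (P Q S : R -> Prop) : (forall t, P t -> Q t -> S t) ->
  {ae mu, forall t, P t} -> {ae mu, forall t, Q t} -> {ae mu, forall t, S t}.
Proof.
move=> PQS /ae_null[N [mN N0 PN]] /ae_null[M [mM M0 QM]]; exists (N `|` M); split.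
- exact: measurableU.
- exact: null_set_setU.
- move=> t nS; apply: contrapT => /not_orP[Nt Mt]; apply: nS.
  by apply: PQS; [exact: PN|exact: QM].
Qed.

Section representatives.
Context {V : normedModType R}.
Variables (D : set R) (mD : measurable D).
Implicit Types f g : R -> V.

Lemma bochner_norm1_le_ae f g :
  {ae mu, forall t, D t -> f t = g t} -> (L1n (cut D f) <= L1n (cut D g))%E.
Proof.
move=> /ae_null[N [mN N0 fg]].
apply: (@ge0_integral_le_off_null _ _ R mu _ _ N mN N0) => // t Nt.
rewrite /cut; case: ifP => //; rewrite inE => Dt.
by rewrite fg.
Qed.

Lemma ae_eq_sym_on f g :
  {ae mu, forall t, D t -> f t = g t} -> {ae mu, forall t, D t -> g t = f t}.
Proof. by apply: ae_imp => t h /h. Qed.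

Lemma bochner_norm1_ae f g :
  {ae mu, forall t, D t -> f t = g t} -> L1n (cut D f) = L1n (cut D g).
Proof.
move=> fg; apply/eqP; rewrite eq_le !bochner_norm1_le_ae //.
exact: ae_eq_sym_on.
Qed.

Lemma cut_id f : (forall t, ~ D t -> f t = 0) -> cut D f = f.
Proof.
move=> f0; apply/funext => t; rewrite /cut; case: ifPn => // /negP tD.
by rewrite f0 // => Dt; apply: tD; rewrite inE.
Qed.

(** A representative defined on the whole line, measurable at every point of
    it and zero outside [D]. *)
Lemma bochner_L1_rep f : bochner_L1 D f -> exists g, [/\ L1 g,
  forall t, ~ D t -> g t = 0, {ae mu, forall t, D t -> f t = g t} &
  L1n g = bochner_norm 1 D f].
Proof.
move=> [[h [sh hf]] foo].
have [N [mN N0 hN]] := ae_null hf.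
pose g := cut (~` N) (cut D f).
have fg : {ae mu, forall t, D t -> f t = g t}.
  exists N; split => // t /= ngt; apply: contrapT => Nt; apply: ngt => Dt.
  by rewrite /g /cut !mem_set.
have g0 t : ~ D t -> g t = 0.
  by move=> Dt; rewrite /g /cut; case: ifP => // _; rewrite memNset.
have gn : L1n g = bochner_norm 1 D f.
  by rewrite bochner_norm1E (bochner_norm1_ae fg) cut_id.
exists g; split => //; split; last by rewrite gn.
rewrite /g (_ : cut (~` N) (cut D f) = cut (~` (N `|` ~` D)) f); last first.
  apply/funext => t; rewrite /cut.
  have [tN|tN] := pselect (N t).
    by rewrite memNset ?memNset //= => -[]; left.
  have [tD|tD] := pselect (D t); first by rewrite !mem_set //= => -[].
  by rewrite mem_set // !memNset //= => -[]; right.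
apply: (smeas_lim_off_null _ sh).
  by apply: measurableU => //; exact: measurableC.
move=> t /not_orP[Nt /contrapT Dt]; exact: hN.
Qed.

Lemma bochner_L1_of f g : L1 g -> {ae mu, forall t, D t -> f t = g t} ->
  bochner_L1 D f.
Proof.
move=> g1 fg; have [[h [sh hg]] _] := g1; split.
  exists h; split => //; apply: ae_imp fg => t fg /fg ->; exact: hg.
rewrite bochner_norm1E (bochner_norm1_ae fg); by case: (L1_cut mD g1).
Qed.

Lemma is_bochner_integral_ae f g I : {ae mu, forall t, D t -> f t = g t} ->
  is_bochner_integral D f I -> is_bochner_integral D g I.
Proof.
move=> fg [s [sh sf sn sI]]; exists s; split => //.
  by apply: ae_imp2 fg sf => t e h Dt; rewrite -e //; exact: h.
rewrite (_ : (fun n => _) = (fun n => bochner_norm 1 D (f \- s n))) //.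
apply/funext => n; rewrite !bochner_norm1E; apply: bochner_norm1_ae.
by apply: ae_imp fg => t e Dt /=; rewrite e.
Qed.

End representatives.

Lemma bochner_integral_dual {V : completeNormedModType R} (D : set R)
    (f g : R -> V) (l : V -> R^o) : measurable D -> bop l -> L1 (cut D g) ->
  {ae mu, forall t, D t -> f t = g t} ->
  (l (bochner_integral D f) : R) = \int[mu]_t (l (cut D g t) : R).
Proof.
move=> mD bl g1 fg; apply: pettis_int => //.
apply: (is_bochner_integral_ae (D := D) fg); apply: xgetPex.
have [I gI] := bochner_ex mD g1; exists I.
exact: (is_bochner_integral_ae (ae_eq_sym_on fg)).
Qed.

Lemma open_time_measurable (T : \bar R) : measurable (open_time T).
Proof.
case: T => [r| |].
- rewrite (_ : open_time _ = `]0, r[%classic) //.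
  apply/seteqP; split => t; rewrite /open_time /= in_itv /= lte_fin.
    by move=> [-> ->].
  by move=> /andP[-> ->].
- rewrite (_ : open_time _ = `]0, +oo[%classic) //.
  apply/seteqP; split => t; rewrite /open_time /= in_itv /= andbT ltry.
    by case.
  by move=> ->.
- rewrite (_ : open_time _ = set0) //.
  by apply/seteqP; split => t // -[].
Qed.

Lemma continuous_bounded_itv (g : R -> R) (a b : R) :
  (forall t, a <= t <= b -> {for t, continuous g}) ->
  exists2 M, 0 <= M & forall t, a <= t <= b -> `|g t| <= M.
Proof.
move=> cg; have [ab|ba] := leP a b; last first.
  by exists 0 => // t /andP[h1 h2]; have := le_trans h1 h2; rewrite leNgt ba.
have cn : {within `[a, b], continuous (fun t => `|g t|)}.
  apply: continuous_in_subspaceT => t; rewrite inE /= in_itv /= => tab.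
  by apply: cvg_norm; exact: cg.
have [c _ hc] := EVT_max ab cn; exists `|g c| => // t tab; exact: hc.
Qed.

(** The support is enclosed in the open interval, slightly wider than the
    given one, so that the derivative vanishes outside it as well, end points
    included. *)
Lemma test_functionE (T : \bar R) (phi : R -> R) : (0 < T)%E ->
  test_function T phi -> exists a b M : R, [/\ 0 < a < b, (b%:E < T)%E,
    continuous phi /\ continuous (derive1 phi),
    forall t, ~~ (a < t < b) -> phi t = 0 /\ derive1 phi t = 0 &
    forall t, `|phi t| <= M /\ `|derive1 phi t| <= M].
Proof.
move=> T0 [dphi cd [a0 [b0 [a00 b0T phi0]]]].
have cphi : continuous phi.
  by move=> t; apply/differentiable_continuous/derivable1_diffP.
have [b [b0b bT b00]] : exists b, [/\ b0 < b, (b%:E < T)%E & 0 < b].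
  case: T T0 b0T {dphi} => [r| |] //= r0 br; last first.
    exists (`|b0| + 1); split; [|exact: ltry|by rewrite ltr_wpDl].
    by rewrite (le_lt_trans (ler_norm _)) // ltrDl.
  rewrite !lte_fin in r0 br.
  exists (Num.max ((b0 + r) / 2) (r / 2)); split.
  - by rewrite lt_max; apply/orP; left; lra.
  - by rewrite lte_fin gt_max; apply/andP; split; lra.
  - by rewrite lt_max; apply/orP; right; lra.
pose a := Num.min a0 b / 2.
have a0' : 0 < a by rewrite divr_gt0 // lt_min a00.
have aa : a < a0.
  rewrite /a ltr_pdivrMr // (@le_lt_trans _ _ a0) ?ge_min ?lexx //; lra.
have ab : a < b.
  rewrite /a ltr_pdivrMr // (@le_lt_trans _ _ b) ?ge_min ?lexx ?orbT //; lra.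
have z t : ~~ (a < t < b) -> phi t = 0 /\ derive1 phi t = 0.
  move=> tab; have hz : \forall u \near t, phi u = 0.
    move: tab; rewrite negb_and -!leNgt => /orP[ta|bt].
      near=> u; apply: phi0; rewrite negb_and -!ltNge; apply/orP; left.
      near: u; apply: lt_nbhsl; exact: le_lt_trans aa.
    near=> u; apply: phi0; rewrite negb_and -!ltNge; apply/orP; right.
    near: u; apply: lt_nbhsr; exact: lt_le_trans b0b _.
  split; first exact: (nbhs_singleton hz).
  rewrite derive1E (near_eq_derive (g := cst 0)) ?derive_cst //.
have [M1 M10 h1] := continuous_bounded_itv (fun t _ => cphi t) (a := a) (b := b).
have [M2 M20 h2] := continuous_bounded_itv (fun t _ => cd t) (a := a) (b := b).
exists a, b, (Num.max M1 M2); split => //; first by rewrite a0'.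
move=> t; have [tab|/z[-> ->]] := boolP (a < t < b).
  have tab' : a <= t <= b by case/andP: tab => *; rewrite !ltW.
  by rewrite !le_max h1 // h2 // orbT.
by rewrite normr0 le_max M10.
Unshelve. all: by end_near. Qed.

Lemma smeas_continuous {V : normedModType R} (f : R -> V) :
  continuous f -> smeas f.
Proof.
move=> cf; rewrite -(@cut_id V setT f); last first.
  by move=> t nt; exfalso; exact: nt.
apply: smeas_right => // t _; apply: cvg_at_right_filter; exact: cf.
Qed.

Lemma L1_cst_itv {V : normedModType R} (a b : R) (y : V) :
  L1 (cut `[a, b]%classic (fun=> y)).
Proof.
split; first by apply: smeas_simple_cut => //; exact: simple_cst.
rewrite /L1n (_ : (fun t => _) = (fun t => (`|y|)%:E * (\1_(`[a, b]%classic : set R) t)%:E)%E).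
  rewrite ge0_integralZl_EFin //.
    rewrite integral_indicT // lte_mul_pinfty //.
    by have := @lebesgue_measure_itv R `[a, b]; rewrite /= => ->; case: ifP; rewrite ?ltry.
  by apply/measurable_EFinP; exact: (@measurable_indic _ _ R).
apply/funext => t; rewrite /cut indicE; case: (t \in _) => /=.
  by rewrite mule1.
by rewrite normr0 mule0.
Qed.

Lemma L1_bounded_itv {V : normedModType R} (f : R -> V) (a b M : R) :
  smeas f -> (forall t, ~~ (a <= t <= b) -> f t = 0) ->
  (forall t, `|f t| <= M) -> L1 f.
Proof.
move=> sf f0 fM; apply: (L1_le sf (L1_cst_itv a b (M : R^o))) => t.
rewrite /cut; case: ifPn => [_|]; first by rewrite (le_trans (fM t)) // ler_norm.
by rewrite notin_setE /= in_itv /= => /negP/f0 ->; rewrite !normr0.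
Qed.

(** The weak derivative, read through functionals as an identity between
    scalar integrals over the line; [v] is meant to vanish outside the time
    interval. *)
Definition dual_derivative {V : normedModType R} (T : \bar R) (u v : R -> V) :=
  forall phi, test_function T phi -> forall l : V -> R^o, bop l ->
    \int[mu]_t (derive1 phi t * l (cut (open_time T) u t) : R) =
    - \int[mu]_t (phi t * l (v t) : R).

Lemma L1_test {V : normedModType R} (phi : R -> R) (M : R) (v : R -> V) :
  continuous phi -> (forall t, `|phi t| <= M) -> L1 v ->
  L1 (fun t => phi t *: v t).
Proof.
move=> cphi phiM v1; have sv := v1.1.
have M0 : 0 <= M by apply: le_trans (phiM 0).
apply: (L1_le (g := fun t => M *: v t)).
- by apply: (@smeasZ R V phi) => //; exact: (@smeas_continuous R^o).
- by apply: (L1_comp (K := fun x => M *: x)) v1; split;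
  [move=> a x y; rewrite scalerDr !scalerA mulrC|exists `|M| => x; rewrite normrZ].
- by move=> t; rewrite !normrZ ler_wpM2r // (le_trans (phiM t)) // ler_norm.
Qed.

Lemma open_time_open (T : \bar R) : open (open_time T).
Proof.
case: T => [r| |].
- rewrite (_ : open_time _ = `]0, r[%classic); first exact: interval_open.
  apply/seteqP; split => t; rewrite /open_time /= in_itv /= lte_fin.
    by move=> [-> ->].
  by move=> /andP[-> ->].
- rewrite (_ : open_time _ = `]0, +oo[%classic); first exact: interval_open.
  apply/seteqP; split => t; rewrite /open_time /= in_itv /= andbT ltry.
    by case.
  by move=> ->.
- rewrite (_ : open_time _ = set0); first exact: open0.
  by apply/seteqP; split => t // -[].
Qed.

Lemma halfopen_continuous {U : topologicalType} (T : \bar R) (u : R -> U) t :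
  {within halfopen_time T, continuous u} -> open_time T t ->
  {for t, continuous u}.
Proof.
move=> cu Tt.
have : {within open_time T, continuous u}.
  by apply: continuous_subspaceW cu => s [s0 sT]; split => //; exact: ltW.
rewrite continuous_open_subspace; last exact: open_time_open.
by apply; rewrite inE.
Qed.

Lemma L1_test_cut {V : normedModType R} (T : \bar R) (phi : R -> R) (a b M : R)
    (u : R -> V) :
  {within halfopen_time T, continuous u} -> continuous phi ->
  0 < a -> (b%:E < T)%E -> (forall t, ~~ (a < t < b) -> phi t = 0) ->
  L1 (fun t => phi t *: cut (open_time T) u t).
Proof.
move=> cu cphi a0 bT phi0.
have inT t : a <= t <= b -> open_time T t.
  move=> /andP[h1 h2]; split; first exact: lt_le_trans h1.
  by apply: le_lt_trans bT; rewrite lee_fin.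
have sm : smeas (fun t => phi t *: cut (open_time T) u t).
  apply: (@smeasZ R V phi); first exact: (@smeas_continuous R^o).
  apply: smeas_right; first exact: open_time_measurable.
  by move=> t Tt; apply: cvg_at_right_filter; exact: halfopen_continuous Tt.
pose g t := `|phi t *: cut (open_time T) u t|.
have [M' M0 hM] : exists2 M, 0 <= M & forall t, a <= t <= b -> `|phi t * `|u t| | <= M.
  apply: continuous_bounded_itv => t tab; apply: cvgM; first exact: cphi.
  by apply: cvg_norm; apply: (halfopen_continuous cu); exact: inT.
apply: (@L1_bounded_itv _ _ a b M') => //.
  move=> t tab; rewrite phi0 ?scale0r //; apply: contraNN tab => /andP[h1 h2].
  by rewrite !ltW.
move=> t; have [tab|tab] := boolP (a < t < b); last by rewrite phi0 // scale0r normr0.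
have tab' : a <= t <= b by case/andP: tab => *; rewrite !ltW.
have := hM t tab'; rewrite normrM normr_id normrZ /cut mem_set //; exact: inT.
Qed.

(** Functionals commute with the Bochner integral and separate points. *)
Lemma weak_derivativeP {V : completeNormedModType R} (T : \bar R)
    (u v0 v : R -> V) : (0 < T)%E ->
  {within halfopen_time T, continuous u} -> L1 v ->
  (forall t, ~ open_time T t -> v t = 0) ->
  {ae mu, forall t, open_time T t -> v0 t = v t} ->
  weak_derivative T u v0 <-> dual_derivative T u v.
Proof.
move=> T0 cu v1 v00 v0v.
have mT := open_time_measurable T.
have key phi (l : V -> R^o) : test_function T phi -> bop l ->
   (l (bochner_integral (open_time T) (fun t => derive1 phi t *: u t)) =
     \int[mu]_t (derive1 phi t * l (cut (open_time T) u t) : R)) /\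
   (l (bochner_integral (open_time T) (fun t => phi t *: v0 t)) =
     \int[mu]_t (phi t * l (v t) : R)).
  move=> tphi bl.
  have [a [b [M [/andP[a0 ab] bT [cphi cd] phi0 phiM]]]] := test_functionE T0 tphi.
  have cutZ (k : R -> R) (w : R -> V) : cut (open_time T) (fun t => k t *: w t) =
      fun t => k t *: cut (open_time T) w t.
    by apply/funext => t; rewrite /cut; case: ifP; rewrite ?scaler0.
  split.
    rewrite (@bochner_integral_dual _ _ _ (fun t => derive1 phi t *: u t)) //.
    - apply: eq_Rintegral => t _; rewrite cutZ (bopZ bl) //.
    - rewrite cutZ; apply: (@L1_test_cut _ _ _ a b M) => // t /phi0[] //.
    - exact: aeW.
  rewrite (@bochner_integral_dual _ _ _ (fun t => phi t *: v t)) //.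
  - apply: eq_Rintegral => t _; rewrite cutZ cut_id // (bopZ bl) //.
  - rewrite cutZ cut_id //; apply: (@L1_test _ _ M) => // t; by case: (phiM t).
  - by apply: ae_imp v0v => t h /h ->.
split=> [w phi tphi l bl|d phi tphi].
  by have [<- <-] := key _ _ tphi bl; rewrite (w _ tphi) (bopN bl).
apply: eq_dual => l bl; rewrite (bopN bl).
by have [-> ->] := key _ _ tphi bl; exact: d.
Qed.

End weak_derivatives.

(** * Calculus along one-parameter semigroups *)

Section calculus.
Context {R : realType}.
Local Notation mu := (@lebesgue_measure R).

(** Inequalities instead of limits of quotients: this form is inherited by
    compositions with bounded maps and is produced directly by semigroup
    estimates. *)
Definition vderiv {V : normedModType R} (F : R -> V) (t : R) (d : V) :=
  forall e : R, 0 < e -> exists2 a : R, 0 < a &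
    forall h, `|h| < a -> `|F (t + h) - F t - h *: d| <= e * `|h|.

Lemma near_dist (t a : R) : 0 < a -> \forall s \near t, `|t - s| < a.
Proof. by move=> a0; exists a. Qed.

Lemma vderiv_bop {V W : normedModType R} (K : V -> W) (F : R -> V) t d :
  bop K -> vderiv F t d -> vderiv (K \o F) t (K d).
Proof.
move=> bK Fd e e0; have [C C0 hC] := bop_bound bK.
have [a a0 ha] := Fd (e / C) (divr_gt0 e0 C0); exists a => // h /ha hh /=.
rewrite -(bopZ bK) -!(bopB bK); apply: (le_trans (hC _)).
by rewrite mulrC -ler_pdivlMr // (le_trans hh) // mulrAC.
Qed.

Lemma quot_dist {V : normedModType R} (h e : R) (x w : V) : h != 0 ->
  (`|w - h^-1 *: x| <= e) = (`|x - h *: w| <= e * `|h|).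
Proof.
move=> h0; rewrite -ler_pdivrMr ?normr_gt0 //; congr (_ <= _).
have -> : x - h *: w = h *: (h^-1 *: x - w).
  by rewrite scalerBr scalerA divff // scale1r.
by rewrite normrZ mulrC mulKf ?normr_eq0 // distrC.
Qed.

Lemma vderiv_is_derive (F : R -> R) t d :
  vderiv (F : R -> R^o) t d -> is_derive t 1 F d.
Proof.
move=> Fd.
have cF : (h^-1 *: ((F \o shift t) (h *: (1 : R)) - F t)) @[h --> (0 : R)^'] --> d.
  apply/cvgrPdist_le => e e0; have [a a0 ha] := Fd e e0.
  near=> h.
  have h0 : h != 0 by near: h; exact: nbhs_dnbhs_neq.
  have hh : `|h| < a by near: h; exact: dnbhs0_lt.
  have := ha h hh; rewrite /= [h *: 1]mulr1 (addrC h t).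
  by rewrite -(@quot_dist R^o).
apply: DeriveDef; first exact: (cvgP _ cF).
exact: (cvg_lim (@norm_hausdorff R R^o) cF).
Unshelve. all: by end_near. Qed.

Lemma continuous_itv_integrable (a b : R) (k : R -> R) : continuous k ->
  mu.-integrable `[a, b] (EFin \o k).
Proof.
move=> ck; apply: continuous_compact_integrable; first exact: segment_compact.
exact: continuous_subspaceT.
Qed.

Lemma ftc2 (a b : R) (F k : R -> R) : a < b -> continuous F -> continuous k ->
  (forall t, a < t < b -> vderiv (F : R -> R^o) t (k t)) ->
  \int[mu]_(t in `[a, b]) k t = F b - F a.
Proof.
move=> ab cF ck Fk.
have FD t : t \in `]a, b[ -> is_derive t 1 F (k t).
  by rewrite in_itv /= => /Fk/vderiv_is_derive.
rewrite /Rintegral (@continuous_FTC2 _ k F) //.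
- exact: continuous_subspaceT.
- split.
  + by move=> t /FD[].
  + by apply: cvg_at_right_filter; exact: cF.
  + by apply: cvg_at_left_filter; exact: cF.
- by move=> t /FD[_ <-]; rewrite derive1E.
Qed.

Lemma parts (phi r k : R -> R) (a b : R) : a < b ->
  (forall t, derivable phi t 1) -> continuous (derive1 phi) ->
  continuous r -> continuous k ->
  (forall t, a < t < b -> vderiv (r : R -> R^o) t (k t)) ->
  \int[mu]_(t in `[a, b]) (derive1 phi t * r t) =
  phi b * r b - phi a * r a - \int[mu]_(t in `[a, b]) (phi t * k t).
Proof.
move=> ab dphi cd cr ck rk.
have rD t : t \in `]a, b[ -> is_derive t 1 r (k t).
  by rewrite in_itv /= => /rk/vderiv_is_derive.
have cphi : continuous phi.
  by move=> t; apply/differentiable_continuous/derivable1_diffP.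
have c1 : continuous (fun t => phi t * k t) by move=> t; apply: cvgM; [exact: cphi|exact: ck].
have c2 : continuous (fun t => derive1 phi t * r t) by move=> t; apply: cvgM; [exact: cd|exact: cr].
have h1 : derivable_oo_LRcontinuous phi a b.
  split; first by move=> t _; exact: dphi.
  - by apply: cvg_at_right_filter; exact: cphi.
  - by apply: cvg_at_left_filter; exact: cphi.
have h2 : derivable_oo_LRcontinuous r a b.
  split; first by move=> t /rD[].
  - by apply: cvg_at_right_filter; exact: cr.
  - by apply: cvg_at_left_filter; exact: cr.
have h : (\int[mu]_(x in `[a, b]) (phi x * k x)%:E)%E =
   ((phi b * r b - phi a * r a)%:E -
     \int[mu]_(x in `[a, b]) (derive1 phi x * r x)%:E)%E.
  have wd := continuous_subspaceT (A := `[a, b]%classic) cd.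
  have wk := continuous_subspaceT (A := `[a, b]%classic) ck.
  apply: (integration_by_parts ab wd h1 (fun _ _ => erefl) wk h2).
  by move=> t /rD[_ <-]; rewrite derive1E.
have mI : measurable (`[a, b]%classic : set R) by exact: measurable_itv.
have f1 : (\int[mu]_(x in `[a, b]) (phi x * k x)%:E)%E \is a fin_num.
  by apply: integrable_fin_num => //; exact: continuous_itv_integrable.
have f2 : (\int[mu]_(x in `[a, b]) (derive1 phi x * r x)%:E)%E \is a fin_num.
  by apply: integrable_fin_num => //; exact: continuous_itv_integrable.
move: h f1 f2; rewrite /Rintegral /=.
by case: (integral _ _ _) => // x; case: (integral _ _ _) => // y [->] _ _ /=; lra.
Qed.

(** The scalar fundamental theorem applied to a functional of norm 1 that
    attains the norm of the increment. *)
Lemma ftc_norm {V : normedModType R} (F k : R -> V) (a b : R) : a < b ->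
  continuous F -> continuous k ->
  (forall t, a < t < b -> vderiv F t (k t)) ->
  ((`|F b - F a|)%:E <= \int[mu]_(t in `[a, b]) (`|k t|)%:E)%E.
Proof.
move=> ab cF ck Fk.
have cn : continuous (fun t => `|k t|) by move=> t; apply: cvg_norm; exact: ck.
have mI : measurable (`[a, b]%classic : set R) by exact: measurable_itv.
have fn : (\int[mu]_(x in `[a, b]) (`|k x|)%:E)%E \is a fin_num.
  by apply: integrable_fin_num => //; exact: continuous_itv_integrable.
rewrite -(fineK fn) lee_fin; apply: norm_le_dual => l bl l1.
have lc := bop_continuous bl.
have ckl : continuous (fun t => l (k t) : R) by move=> t; apply: (cvg_comp _ _ (ck t)); exact: lc.
have -> : l (F b - F a) = \int[mu]_(t in `[a, b]) (l (k t) : R).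
  rewrite (bopB bl); symmetry.
    apply: (@ftc2 a b (fun t => l (F t)) (fun t => l (k t))) => //.
    by move=> t; apply: (cvg_comp _ _ (cF t)); exact: lc.
  by move=> t /Fk; exact: vderiv_bop.
apply: le_Rintegral => //; [exact: continuous_itv_integrable|exact: continuous_itv_integrable|].
by move=> t _; rewrite (le_trans (ler_norm _)) // l1.
Qed.

(** The mean value theorem holds with equality only for real functions; a
    functional that attains the norm of the increment reduces to that case. *)
Lemma mean_value {V : normedModType R} (F k : R -> V) (a b c : R) : a <= b ->
  continuous F -> (forall t, a < t < b -> vderiv F t (k t)) ->
  (forall t, a < t < b -> `|k t| <= c) -> `|F b - F a| <= c * (b - a).
Proof.
rewrite le_eqVlt => /predU1P[->|ab] cF Fk kc; first by rewrite !subrr normr0 mulr0.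
apply: norm_le_dual => l bl l1; rewrite (bopB bl).
have [|t|t tab ->] := @MVT R (fun t => l (F t)) (fun t => l (k t)) a b ab.
- move=> t; rewrite in_itv /= => /Fk Ft; apply: vderiv_is_derive.
  exact: (vderiv_bop bl Ft).
- by apply: continuous_subspaceT => s; apply: (cvg_comp _ _ (cF s)); exact: bop_continuous.
rewrite ler_wpM2r ?subr_ge0 ?(ltW ab) // (le_trans (ler_norm _)) // (le_trans (l1 _)) //.
by apply: kc; move: tab; rewrite in_itv.
Qed.

End calculus.

Section semigroup_theory.
Context {R : realType} {V : normedModType R}.

Definition bounded_semigroup (M : R) (E : R -> V -> V) :=
  [/\ forall t, 0 <= t -> forall (a : R) x y, E t (a *: x + y) = a *: E t x + E t y,
      forall t x, 0 <= t -> `|E t x| <= M * `|x|,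
      forall x, E 0 x = x,
      forall s t x, 0 <= s -> 0 <= t -> E (s + t) x = E s (E t x) &
      forall x, E t x @[t --> 0^'+] --> x].

(** The orbit is continued by its initial value to negative times, so that it
    becomes a continuous function on the line. *)
Definition flow (E : R -> V -> V) (x : V) (t : R) := E (Num.max t 0) x.

(** The graph of the generator. *)
Definition right_gen (E : R -> V -> V) (z w : V) :=
  forall e : R, 0 < e -> exists2 a : R, 0 < a &
    forall h, 0 < h < a -> `|E h z - z - h *: w| <= e * h.

Lemma right_genP E z w : right_gen E z w <->
  (h^-1 *: (E h z - z)) @[h --> 0^'+] --> w.
Proof.
split=> [g|g e e0].
  apply/cvgrPdist_le => e e0; have [a a0 ha] := g e e0; near=> h.
  have h0 : 0 < h by near: h; exact: nbhs_right_gt.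
  have hh : 0 < h < a by rewrite h0; near: h; exact: nbhs_right_lt.
  by rewrite quot_dist ?gt_eqF // gtr0_norm //; exact: ha.
have /cvgrPdist_le/(_ e e0) := g.
rewrite /at_right near_withinE => -[a /= a0 ha]; exists a => // h /andP[h0 hb].
have := ha h; rewrite /ball_ /= sub0r normrN gtr0_norm // => /(_ hb h0).
by rewrite quot_dist ?gt_eqF // gtr0_norm.
Unshelve. all: by end_near. Qed.

Lemma bounded_semigroup_bop M E t : bounded_semigroup M E -> 0 <= t -> bop (E t).
Proof. by case=> lE bE _ _ _ t0; split; [exact: lE|exists M => x; exact: bE]. Qed.

Lemma right_cont_modulus M E x (e : R) : bounded_semigroup M E -> 0 < e ->
  exists2 a : R, 0 < a & forall h, 0 <= h < a -> `|E h x - x| <= e.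
Proof.
move=> [_ _ E0 _ cE] e0; have /cvgrPdist_le/(_ e e0) := cE x.
rewrite /at_right near_withinE => -[a /= a0 ha]; exists a => // h /andP[].
rewrite le_eqVlt => /predU1P[<- _|h0 hb]; first by rewrite E0 subrr normr0 ltW.
have := ha h; rewrite /ball_ /= sub0r normrN gtr0_norm // => /(_ hb h0).
by rewrite distrC.
Qed.

Lemma semigroup_bound_ge0 M E : bounded_semigroup M E -> (forall x : V, x = 0) \/ 0 <= M.
Proof.
move=> [_ bE E0 _ _]; have [[x x0]|nx] := pselect (exists x : V, x != 0).
  right; have := bE 0 x (lexx _); rewrite E0 => h.
  have x0' : 0 < `|x| by rewrite normr_gt0.
  by rewrite -(ler_pM2r x0') mul0r (le_trans _ h).
by left => x; apply/eqP; apply: contrapT => /negP x0; apply: nx; exists x.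
Qed.

Lemma semigroup_diff M E x s t : bounded_semigroup M E -> 0 <= s -> 0 <= t ->
  `|E s x - E t x| <= M * `|E (`|s - t|) x - x|.
Proof.
move=> bE; wlog st : s t / s <= t => [H s0 t0|s0 t0].
  have [st|/ltW ts] := leP s t; first exact: H.
  by rewrite distrC (distrC s t); exact: H.
rewrite distrC (distrC s t) ger0_norm ?subr_ge0 //.
case: (bE) => lE MbE _ DE _.
have -> : E t x = E s (E (t - s) x) by rewrite -DE ?subr_ge0 // addrC subrK.
rewrite -(bopB (bounded_semigroup_bop bE s0)).
exact: MbE.
Qed.

Lemma max0_dist (s t : R) : `|Num.max s 0 - Num.max t 0| <= `|s - t|.
Proof.
rewrite !maxEle; case: ifP => s0; case: ifP => t0.
- by rewrite subrr normr0.
- by move/negbT: t0; rewrite -ltNge => t0; rewrite sub0r normrN gtr0_norm // ler0_norm; lra.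
- by move/negbT: s0; rewrite -ltNge => s0; rewrite subr0 gtr0_norm // ger0_norm; lra.
- by [].
Qed.

Lemma flow_continuous M E x : bounded_semigroup M E -> continuous (flow E x).
Proof.
move=> bE t; apply/cvgrPdist_le => e e0.
have [v0|M0] := semigroup_bound_ge0 bE.
  by near=> s; rewrite (v0 (_ - _)) normr0 ltW.
have M1 : 0 < M + 1 by rewrite ltr_wpDl.
have [a a0 ha] := right_cont_modulus x bE (divr_gt0 e0 M1).
near=> s; rewrite /flow.
have m0 (u : R) : 0 <= Num.max u 0 by rewrite le_max lexx orbT.
apply: (le_trans (semigroup_diff _ bE (m0 _) (m0 _))).
have : `|E `|Num.max t 0 - Num.max s 0| x - x| <= e / (M + 1).
  have hs : `|t - s| < a by near: s; exact: near_dist.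
  by apply: ha; rewrite normr_ge0 /= (le_lt_trans (max0_dist _ _)).
rewrite ler_pdivlMr // => h; apply: le_trans h.
by rewrite mulrC ler_wpM2l // lerDl.
Unshelve. all: by end_near. Qed.

Lemma flowE E x t : 0 <= t -> flow E x t = E t x.
Proof. by move=> t0; rewrite /flow max_l. Qed.

(** Only the right derivative at time 0 is given. On the left of [t], the
    factor [E (t - h)] is taken out, and strong continuity moves [E h w] back
    to [w]. *)
Lemma flow_vderiv M E z w t : bounded_semigroup M E -> right_gen E z w -> 0 < t ->
  vderiv (flow E z) t (E t w).
Proof.
move=> bE zw t0 e e0; case: (bE) => lE MbE E0 DE _.
have [v0|M0] := semigroup_bound_ge0 bE.
  by exists 1 => // h _; rewrite (v0 (_ - _)) normr0 mulr_ge0 // ltW.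
have d0 : 0 < 2 * (M + 1) by rewrite mulr_gt0 // ltr_wpDl.
pose d := e / (2 * (M + 1)); have d0' : 0 < d by rewrite divr_gt0.
have dE : M * d + M * d <= e.
  have : d * (2 * (M + 1)) = e by rewrite divfK // gt_eqF.
  by lra.
have [a1 a10 h1] := zw d d0'.
have [a2 a20 h2] := right_cont_modulus w bE d0'.
exists (Num.min t (Num.min a1 a2)); first by rewrite !lt_min t0 a10.
move=> h; rewrite !lt_min => /and3P[ht ha1 ha2].
have th : 0 <= t + h by move: ht; rewrite ltr_norml => /andP[? _]; lra.
rewrite !flowE ?(ltW t0) //.
have [h0|h0] := leP 0 h.
  move: h0; rewrite le_eqVlt => /predU1P[<-|h0].
    by rewrite addr0 subrr scale0r subr0 !normr0 mulr0.
  have bt := bounded_semigroup_bop bE (ltW t0).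
  rewrite DE ?(ltW t0) ?(ltW h0) // -(bopB bt) -(bopZ bt) -(bopB bt).
  apply: (le_trans (MbE _ _ (ltW t0))).
  have := h1 h; rewrite gtr0_norm // h0 => h3.
  rewrite gtr0_norm // in ha1; have {}h3 := h3 ha1.
  apply: (@le_trans _ _ (M * (d * h))); first by rewrite ler_wpM2l.
  have Md : 0 <= M * d by rewrite mulr_ge0 // (ltW d0').
  by rewrite mulrA ler_pM2r //; lra.
have [k kE] : exists k : R, h = - k by exists (- h); rewrite opprK.
have k0 : 0 < k by rewrite kE oppr_lt0 in h0.
have hk : `|h| = k by rewrite kE normrN gtr0_norm.
have tk : 0 <= t - k by rewrite -kE.
rewrite {1 2}kE.
have bt := bounded_semigroup_bop bE tk.
have Et x : E t x = E (t - k) (E k x) by rewrite -DE ?subrK // ltW.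
rewrite (Et z) (Et w) scaleNr opprK. rewrite -(bopB bt). rewrite -(bopZ bt) -(bopD bt).
rewrite hk; apply: (le_trans (MbE _ _ tk)).
have -> : z - E k z + k *: E k w = - (E k z - z - k *: w) + k *: (E k w - w).
  by rewrite scalerBr !opprB [RHS]addrC addrA subrK addrC.
have n1 : `|E k z - z - k *: w| <= d * k by apply: h1; rewrite k0 -hk.
have n2 : `|k *: (E k w - w)| <= k * d.
  rewrite normrZ gtr0_norm // ler_pM2l //; apply: h2.
  by rewrite (ltW k0) -hk.
apply: (@le_trans _ _ (M * (d * k + k * d))).
  by rewrite ler_wpM2l // (le_trans (ler_normD _ _)) // normrN lerD.
by rewrite mulrDr [k * d]mulrC mulrA -mulrDl ler_pM2r.
Qed.

End semigroup_theory.

(** * Power weights *)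

Section hardy.
Context {R : realType}.
Local Notation mu := (@lebesgue_measure R).

Lemma integral_itv_indic (A : set R) (f : R -> R) :
  (\int[mu]_(t in A) (f t)%:E = \int[mu]_t (f t * \1_A t)%:E)%E.
Proof.
rewrite integral_mkcond; apply: eq_integral => t _.
rewrite patchE indicE; case: (t \in A) => /=; first by rewrite mulr1.
by rewrite mulr0.
Qed.

Lemma scaled_integral_indic (A : set R) (c : R) (f : R -> R) :
  measurable A -> measurable_fun setT f -> 0 <= c -> (forall t, 0 <= f t) ->
  (c%:E * \int[mu]_(t in A) (f t)%:E = \int[mu]_t (c * f t * \1_A t)%:E)%E.
Proof.
move=> mA mf c0 f0; rewrite integral_itv_indic.
under [RHS]eq_integral do rewrite -mulrA EFinM.
rewrite ge0_integralZl_EFin // => [t _|]; first by rewrite lee_fin mulr_ge0.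
by apply/measurable_EFinP; apply: measurable_funM.
Qed.

(** Tonelli's theorem on the half-plane below the diagonal; the measurability
    of the inner integrals comes with it. *)
Lemma tonelli_triangle (k phi : R -> R) :
  measurable_fun setT k -> measurable_fun setT phi ->
  (forall t, 0 <= k t) -> (forall t, 0 <= phi t) ->
  [/\ measurable_fun setT
        (fun t => (k t)%:E * \int[mu]_(r in `]-oo, t]) (phi r)%:E)%E,
      measurable_fun setT
        (fun r => (phi r)%:E * \int[mu]_(t in `[r, +oo[) (k t)%:E)%E &
      (\int[mu]_t ((k t)%:E * \int[mu]_(r in `]-oo, t]) (phi r)%:E) =
       \int[mu]_r ((phi r)%:E * \int[mu]_(t in `[r, +oo[) (k t)%:E))%E].
Proof.
move=> mk mphi k0 phi0.
pose D := [set z : R * R | z.2 <= z.1].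
have mD : measurable D.
  rewrite (_ : D = (fun z : R * R => z.1 - z.2) @^-1` `[0, +oo[).
    rewrite -[X in measurable X]setTI.
    have m1 : measurable_fun setT (fun z : R * R => z.1 - z.2).
      by apply: measurable_funB; [exact: measurable_fst|exact: measurable_snd].
    by apply: m1 => //; exact: measurable_itv.
  by apply/seteqP; split => z; rewrite /D /= in_itv /= andbT subr_ge0.
pose f (z : R * R) := (k z.1 * phi z.2 * \1_D z)%:E.
have mf : measurable_fun setT f.
  apply/measurable_EFinP; apply: measurable_funM.
    apply: measurable_funM.
    - by apply: (measurableT_comp mk); exact: measurable_fst.
    - by apply: (measurableT_comp mphi); exact: measurable_snd.
  exact: (@measurable_indic _ _ R).
have f0 z : (0 <= f z)%E by rewrite lee_fin !mulr_ge0 // indicE.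
have hG r : ((phi r)%:E * \int[mu]_(t in `[r, +oo[) (k t)%:E =
    \int[mu]_t f (t, r))%E.
  rewrite scaled_integral_indic //.
  apply: eq_integral => t _; rewrite /f [phi r * _]mulrC /=; congr (EFin (_ * _)).
  rewrite !indicE; congr (_%:R); congr nat_of_bool.
  by apply/idP/idP; rewrite !inE /D /= in_itv /= andbT.
have hF t : ((k t)%:E * \int[mu]_(r in `]-oo, t]) (phi r)%:E =
    \int[mu]_r f (t, r))%E.
  by rewrite scaled_integral_indic.
split.
- rewrite (_ : (fun t => _) = fubini_F mu f); last by apply/funext => t; rewrite hF.
  exact: measurable_fun_fubini_tonelli_F.
- rewrite (_ : (fun r => _) = fubini_G mu f); last by apply/funext => r; rewrite hG.
  exact: measurable_fun_fubini_tonelli_G.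
transitivity (\int[mu]_t \int[mu]_r f (t, r))%E.
  by apply: eq_integral => t _; rewrite hF.
rewrite (@fubini_tonelli _ _ _ _ R mu mu f mf f0).
by apply: eq_integral => r _; rewrite hG.
Qed.

Lemma powR_pred (t r : R) : 0 < t -> t `^ (r - 1) = t `^ r / t.
Proof.
move=> t0; rewrite powRD; last by rewrite (gt_eqF t0) implybT.
by rewrite powR_inv1 // ltW.
Qed.

Lemma powR_continuous (t r : R) : 0 < t -> {for t, continuous (fun u => u `^ r)}.
Proof.
move=> t0; have [d _] := is_derive1_powR r t0.
exact/differentiable_continuous/derivable1_diffP.
Qed.

Lemma power_itv (a b r : R) : 0 < a -> a < b -> r != 0 ->
  (\int[mu]_(t in `[a, b]) (t `^ (r - 1))%:E = ((b `^ r - a `^ r) / r)%:E)%E.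
Proof.
move=> a0 ab r0.
have pos t : t \in `[a, b] -> 0 < t.
  by rewrite in_itv /= => /andP[h _]; exact: lt_le_trans h.
have poso t : t \in `]a, b[ -> 0 < t.
  by rewrite in_itv /= => /andP[h _]; exact: lt_trans h.
have cw q : {within `[a, b], continuous (fun u : R => u `^ q)}.
  apply: continuous_in_subspaceT => t; rewrite inE => /pos; exact: powR_continuous.
rewrite (@continuous_FTC2 _ _ (fun t : R => r^-1 * t `^ r)) //.
- by rewrite -EFinB -mulrBr mulrC.
- split.
  + move=> t /poso t0; apply: derivableM => //.
    by case: (is_derive1_powR r t0).
  + apply: cvg_at_right_filter; apply: cvgMr; exact: powR_continuous.
  + apply: cvg_at_left_filter; apply: cvgMr; apply: powR_continuous.
    exact: lt_trans ab.
- move=> t /poso t0; rewrite derive1E.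
  have d : is_derive t 1 (fun u : R => r^-1 * u `^ r) (t `^ (r - 1)).
    have := is_deriveZ r^-1 (is_derive1_powR r t0).
    by rewrite /GRing.scale /= mulKf.
  by rewrite (@derive_val _ _ _ _ _ _ _ d).
Qed.

Lemma ge0_integral_bigcup_le (F : nat -> set R) (f : R -> R) (c : \bar R) :
  {homo F : n m / (n <= m)%N >-> n `<=` m} -> (forall n, measurable (F n)) ->
  measurable_fun setT f -> (forall n t, F n t -> 0 <= f t) ->
  (forall n, (\int[mu]_(t in F n) (f t)%:E <= c)%E) ->
  (\int[mu]_(t in \bigcup_n F n) (f t)%:E <= c)%E.
Proof.
move=> ndF mF mf f0 fc.
have mfE : measurable_fun setT (EFin \o f) by exact/measurable_EFinP.
have h : (\int[mu]_(t in F n) (f t)%:E)%E @[n --> \oo] -->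
    (\int[mu]_(t in \bigcup_n F n) (f t)%:E)%E.
  apply: ge0_nondecreasing_set_cvg_integral => //.
  - by move=> n m nm; apply/subsetPset; exact: ndF.
  - by move=> n; exact: (measurable_funTS mfE).
rewrite -(cvg_lim _ h) //; apply: lime_le; first exact: (cvgP _ h).
by near=> n; exact: fc.
Unshelve. all: by end_near. Qed.

Lemma power_0itv (b r : R) : 0 < b -> 0 < r ->
  (\int[mu]_(t in `]0%R, b]) (t `^ (r - 1))%:E <= (b `^ r / r)%:E)%E.
Proof.
move=> b0 r0.
pose F (n : nat) : set R := `[b / n.+2%:R, b]%classic.
have Fpos n : 0 < b / n.+2%:R by rewrite divr_gt0.
have -> : `]0, b]%classic = \bigcup_n F n.
  apply/seteqP; split => t; rewrite /= in_itv /=.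
    move=> /andP[t0 tb].
    have : \forall n \near \oo, n.+1%:R^-1 < t / b.
      exact: (near_infty_natSinv_lt (PosNum (divr_gt0 t0 b0))).
    move=> [n _ /(_ n (leqnn n)) /= nt].
    exists n => //; rewrite /F /= in_itv /= tb andbT.
    rewrite mulrC -ler_pdivlMr // ltW // (le_lt_trans _ nt) //.
    by rewrite lef_pV2 ?posrE // ler_nat.
  by move=> [n _]; rewrite /F /= in_itv /= => /andP[h ->]; rewrite andbT (lt_le_trans _ h).
apply: ge0_integral_bigcup_le.
- move=> n m nm t; rewrite /F /= !in_itv /= => /andP[h ->]; rewrite andbT.
  apply: le_trans h; rewrite ler_pM2l // lef_pV2 ?posrE // ler_nat //.
- by move=> n; exact: measurable_itv.
- exact: measurable_powR.
- by move=> n t _; exact: powR_ge0.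
move=> n; rewrite power_itv ?gt_eqF //; last first.
  by rewrite ltr_pdivrMr // ltr_pMr // ltr1n.
by rewrite lee_fin ler_pM2r ?invr_gt0 // lerBlDr lerDl powR_ge0.
Qed.

Lemma power_itvy (a r : R) : 0 < a -> 0 < r ->
  (\int[mu]_(t in `[a, +oo[) (t `^ (- r - 1))%:E <= (a `^ (- r) / r)%:E)%E.
Proof.
move=> a0 r0.
pose F (n : nat) : set R := `[a, a + n.+1%:R]%classic.
have -> : `[a, +oo[%classic = \bigcup_n F n.
  apply/seteqP; split => t; rewrite /= in_itv /=.
    rewrite andbT => ta; exists (Num.truncn (t - a)) => //.
    rewrite /F /= in_itv /= ta /= -lerBlDl.
    have ta0 : 0 <= t - a by rewrite subr_ge0.
    by have /andP[_ /ltW] := truncn_itv ta0.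
  by move=> [n _]; rewrite /F /= in_itv /= => /andP[-> _].
apply: ge0_integral_bigcup_le.
- move=> n m nm t; rewrite /F /= !in_itv /= => /andP[-> h] /=.
  by rewrite (le_trans h) // lerD2l ler_nat.
- by move=> n; exact: measurable_itv.
- exact: measurable_powR.
- by move=> n t _; exact: powR_ge0.
move=> n; rewrite power_itv ?oppr_eq0 ?gt_eqF // ?ltrDl //.
rewrite lee_fin invrN mulrN -mulNr opprB ler_pM2r ?invr_gt0 //.
by rewrite lerBlDr lerDl powR_ge0.
Qed.

End hardy.

(** * Hardy's inequality *)

Section weights.
Context {R : realType}.
Local Notation mu := (@lebesgue_measure R).
Local Notation P := (`]0, +oo[%classic : set R).
Variable p : R.
Hypothesis p01 : 0 < p < 1.

Lemma cutP (V : normedModType R) (f : R -> V) t : cut P f t = if 0 < t then f t else 0.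
Proof.
rewrite /cut; case: ifPn; first by rewrite inE /= in_itv /= andbT => ->.
by rewrite notin_setE /= in_itv /= andbT => /negP/negbTE ->.
Qed.

Lemma cutP_gt0 (V : normedModType R) (f : R -> V) t : 0 < t -> cut P f t = f t.
Proof. by rewrite cutP => ->. Qed.

Lemma cut_ge0 (f : R -> R) t : (forall t, 0 < t -> 0 <= f t) ->
  0 <= (cut P (f : R -> R^o) t : R).
Proof. by move=> f0; rewrite cutP; case: ifPn => // /f0. Qed.

Lemma cut_measurable (f : R -> R) : measurable_fun setT f ->
  measurable_fun setT (cut P (f : R -> R^o) : R -> R).
Proof.
move=> mf; rewrite (_ : cut _ _ = (fun t => \1_P t * f t)).
  by apply: measurable_funM => //; exact: (@measurable_indic _ _ R).
by apply/funext => t; rewrite cutE.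
Qed.

(** The three kernels vanish on the negative half-line, so that triangle
    integrals over the line are triangle integrals over positive times. *)
Definition hardy_weight : R -> R := cut P ((fun t => t `^ (p - 1 - 1)) : R -> R^o).
Definition besov_weight : R -> R := cut P ((fun t => t `^ (p - 1)) : R -> R^o).
Definition half_line : R -> R := cut P ((fun t => 1) : R -> R^o).

Lemma measurable_hardy_weight : measurable_fun setT hardy_weight.
Proof. by apply: cut_measurable; exact: measurable_powR. Qed.

Lemma measurable_besov_weight : measurable_fun setT besov_weight.
Proof. by apply: cut_measurable; exact: measurable_powR. Qed.

Lemma hardy_weightE t : 0 < t -> hardy_weight t = t `^ p / t / t.
Proof. by move=> t0; rewrite /hardy_weight cutP_gt0 // !powR_pred. Qed.

Lemma besov_weightE t : 0 < t -> besov_weight t = t `^ p / t.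
Proof. by move=> t0; rewrite /besov_weight cutP_gt0 // powR_pred. Qed.

Lemma measurable_half_line : measurable_fun setT half_line.
Proof. by apply: cut_measurable. Qed.

Lemma hardy_weight_ge0 t : 0 <= hardy_weight t.
Proof. by apply: cut_ge0 => u u0; exact: powR_ge0. Qed.

Lemma besov_weight_ge0 t : 0 <= besov_weight t.
Proof. by apply: cut_ge0 => u u0; exact: powR_ge0. Qed.

Lemma half_line_ge0 t : 0 <= half_line t.
Proof. by apply: cut_ge0. Qed.

Lemma hardy_weight_int r : 0 < r ->
  (\int[mu]_(t in `[r, +oo[) (hardy_weight t)%:E <= (r `^ p / r / (1 - p))%:E)%E.
Proof.
move=> r0; case/andP: p01 => p0 p1.
have := @power_itvy R r (1 - p) r0; rewrite subr_gt0 => /(_ p1).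
rewrite -(powR_pred _ r0) opprB => h; apply: le_trans h.
rewrite le_eqVlt; apply/orP; left; apply/eqP; apply: eq_integral => t.
rewrite inE /= in_itv /= andbT => rt; have t0 := lt_le_trans r0 rt.
by rewrite /hardy_weight cutP_gt0.
Qed.

Lemma besov_weight_int t : 0 < t ->
  (\int[mu]_(r in `]-oo, t]) (besov_weight r)%:E <= (t `^ p / p)%:E)%E.
Proof.
move=> t0; case/andP: p01 => p0 p1; apply: le_trans (power_0itv t0 p0).
rewrite le_eqVlt; apply/orP; left; apply/eqP.
rewrite (integral_itv_indic `]-oo, t]) (integral_itv_indic `]0, t]).
apply: eq_integral => r _.
rewrite /besov_weight cutP !indicE; case: ifPn => r0.
  congr (EFin (_ * _%:R)); congr nat_of_bool.
  by apply/idP/idP; rewrite !inE /= !in_itv /= r0.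
rewrite mul0r memNset ?mulr0 //= in_itv /=.
by rewrite (negbTE r0).
Qed.

Lemma half_line_int r : 0 < r -> (\int[mu]_(t in `]-oo, r]) (half_line t)%:E = r%:E)%E.
Proof.
move=> r0; transitivity (\int[mu]_t (\1_(`]0, r]%classic : set R) t)%:E)%E.
  rewrite integral_itv_indic; apply: eq_integral => t _.
  rewrite /half_line cutP !indicE; case: ifPn => t0.
    rewrite mul1r; congr (EFin _%:R); congr nat_of_bool.
    by apply/idP/idP; rewrite !inE /= !in_itv /= t0.
  by rewrite mul0r memNset //= in_itv /= (negbTE t0).
rewrite integral_indicT; last exact: measurable_itv.
by have := @lebesgue_measure_itv R `]0, r]; rewrite /= lte_fin r0 sube0.
Qed.

Definition weighted (phi : R -> R) : \bar R := (\int[mu]_r (besov_weight r * phi r)%:E)%E.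

(** After exchanging the order of integration, the inner integral of [t^(p -
    2)] over [t >= r] is [r^(p - 1) / (1 - p)]. *)
Lemma hardy_inequality (phi : R -> R) : measurable_fun setT phi ->
  (forall t, 0 <= phi t) -> (forall t, t <= 0 -> phi t = 0) ->
  (\int[mu]_t ((hardy_weight t)%:E * \int[mu]_(r in `]-oo, t]) (phi r)%:E) <=
   ((1 - p)^-1)%:E * weighted phi)%E.
Proof.
move=> mphi phi0 phiN; case/andP: p01 => p0 p1.
have p1' : 0 < 1 - p by rewrite subr_gt0.
have [_ _ ->] := tonelli_triangle measurable_hardy_weight mphi hardy_weight_ge0 phi0.
rewrite -ge0_integralZl_EFin //; last first.
- by rewrite invr_ge0 ltW.
- by apply/measurable_EFinP; apply: measurable_funM => //; exact: measurable_besov_weight.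
- by move=> t _; rewrite lee_fin mulr_ge0 // besov_weight_ge0.
apply: (@ge0_integral_le_off_null _ _ R mu _ _ set0) => //.
- by move=> t; rewrite mule_ge0 ?lee_fin //; apply: integral_ge0 => u _; rewrite lee_fin hardy_weight_ge0.
- by move=> t; rewrite -EFinM lee_fin !mulr_ge0 ?besov_weight_ge0 // invr_ge0 ltW.
move=> t _; have [t0|t0] := leP t 0.
  by rewrite phiN // mul0e mulr0 mule0.
apply: (@le_trans _ _ ((phi t)%:E * (t `^ p / t / (1 - p))%:E)%E).
  by rewrite lee_pmul // ?lee_fin ?integral_ge0 // ?hardy_weight_int // => u _; rewrite lee_fin hardy_weight_ge0.
by rewrite -!EFinM lee_fin besov_weightE // [leLHS]mulrCA mulrA [leLHS]mulrC.
Qed.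

Lemma integrated_tail (phi : R -> R) : measurable_fun setT phi ->
  (forall t, 0 <= phi t) -> (forall t, t <= 0 -> phi t = 0) ->
  (\int[mu]_t ((half_line t)%:E * \int[mu]_(r in `[t, +oo[) (phi r)%:E) =
   \int[mu]_r (r * phi r)%:E)%E.
Proof.
move=> mphi phi0 phiN.
have [_ _ <-] := tonelli_triangle mphi measurable_half_line phi0 half_line_ge0.
apply: eq_integral => t _; have [t0|t0] := leP t 0.
  by rewrite phiN // mul0e mulr0.
by rewrite half_line_int // -EFinM mulrC.
Qed.

End weights.

(** * Analytic semigroups in the Besov norm *)

Section analytic_semigroup.
Context {R : realType} {X : normedModType R}.
Local Notation mu := (@lebesgue_measure R).
Local Notation P := (`]0, +oo[%classic : set R).

(** The boundedness and smoothing constants are made explicit, and the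
    operators are plain functions, so that two semigroups can be compared
    quantitatively. *)
Record analytic (M C : R) (T : R -> X -> X) (G : operator X X) := Analytic {
  an_sg : bounded_semigroup M T;
  an_M0 : 0 <= M;
  an_C0 : 0 <= C;
  an_lin : linear_operator G;
  an_gen : forall x y, (dom G x /\ G x = y) <-> right_gen T x y;
  an_dom : forall t x, 0 < t -> dom G (T t x);
  an_bound : forall t x, 0 < t -> `|G (T t x)| <= C / t * `|x| }.

Lemma analytic_of (S : R -> {linear X -> X}) (G : operator X X) :
  bounded_analytic_semigroup S G -> linear_operator G ->
  exists M C, analytic M C (fun t => S t : X -> X) G.
Proof.
move=> [[_ S0 SD Sc] Sgen [M0 hM] [Sdom [C0 hC]]] lG.
exists `|M0|, `|C0|; split => //.
- split => //.
  + by move=> t _ a x y; rewrite linearP.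
  + by move=> t x t0; rewrite (le_trans (hM t x t0)) // ler_wpM2r // ler_norm.
- move=> x y; rewrite right_genP; exact: Sgen.
- move=> t x t0; have := hC t x t0; rewrite normrZ gtr0_norm // => h.
  by rewrite mulrAC ler_pdivlMr // mulrC (le_trans h) // ler_wpM2r // ler_norm.
Qed.

Section theory.
Variables (M C : R) (T : R -> X -> X) (G : operator X X).
Hypothesis hT : analytic M C T G.

Let bT := an_sg hT.

Lemma an_bopT t : 0 <= t -> bop (T t).
Proof. exact: bounded_semigroup_bop bT. Qed.

Lemma an_T0 x : T 0 x = x.
Proof. by case: bT. Qed.

Lemma an_TD s t x : 0 <= s -> 0 <= t -> T (s + t) x = T s (T t x).
Proof. by case: bT => _ _ _ + _; exact. Qed.

Lemma an_TM t x : 0 <= t -> `|T t x| <= M * `|x|.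
Proof. by case: bT => _ + _ _ _; exact. Qed.

Lemma an_G x y : dom G x -> G x = y -> right_gen T x y.
Proof. by move=> Dx Gx; apply/(an_gen hT). Qed.

Lemma an_comm t x : 0 <= t -> dom G x -> dom G (T t x) /\ G (T t x) = T t (G x).
Proof.
move=> t0 Dx; apply/(an_gen hT) => e e0.
have M1 : 0 < M + 1 by rewrite ltr_wpDl // (an_M0 hT).
have [a a0 ha] := an_G Dx erefl (divr_gt0 e0 M1).
exists a => // h h0a; have h0 : 0 < h by case/andP: h0a.
have -> : T h (T t x) = T t (T h x) by rewrite -!an_TD ?(ltW h0) // addrC.
have bt := an_bopT t0.
rewrite -(bopB bt) -(bopZ bt) -(bopB bt) (le_trans (an_TM _ t0)) //.
apply: (@le_trans _ _ ((M + 1) * (e / (M + 1) * h))).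
  rewrite ler_pM ?(an_M0 hT) //; [by rewrite lerDl|exact: ha].
by rewrite mulrA [(M + 1) * _]mulrC divfK // gt_eqF.
Qed.

Lemma an_linB x y : dom G x -> dom G y -> dom G (x - y) /\ G (x - y) = G x - G y.
Proof.
move=> Dx Dy; have [_ lG] := an_lin hT.
have [h1 h2] := lG (-1) y x Dy Dx.
by rewrite scaleN1r addrC in h1 h2; split => //; rewrite h2 scaleN1r addrC.
Qed.

Lemma an_GT s t x : 0 <= s -> 0 < t -> G (T (s + t) x) = T s (G (T t x)).
Proof.
move=> s0 t0; rewrite an_TD ?(ltW t0) //.
by have [_] := an_comm s0 (an_dom hT x t0).
Qed.

Lemma an_smeas x : smeas (cut P (fun t => T t x)).
Proof.
apply: smeas_right => // t; rewrite /= in_itv /= andbT => t0.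
have := @flow_continuous _ _ M T x bT t; rewrite /continuous_at flowE ?(ltW t0) //.
move=> /cvg_at_right_filter; apply: cvg_trans; apply: near_eq_cvg; near=> s.
have ts : t < s by near: s; exact: nbhs_right_gt.
by rewrite /flow max_l // ltW // (lt_trans t0).
Unshelve. all: by end_near. Qed.

Lemma an_GT_right x t : 0 < t -> (fun s => G (T s x)) s @[s --> t^'+] --> G (T t x).
Proof.
move=> t0; have c := @flow_continuous _ _ M T (G (T t x)) bT 0.
have : flow T (G (T t x)) (s - t) @[s --> t] --> G (T t x).
  rewrite -[in X in _ --> X](an_T0 (G (T t x))) -(flowE T _ (lexx 0)).
  have ct : (fun s => s - t) s @[s --> t] --> (0 : R).
    by rewrite -[X in _ --> X](subrr t); apply: cvgB; [exact|exact: cvg_cst].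
  exact: (cvg_comp _ _ ct c).
move=> /cvg_at_right_filter; apply: cvg_trans; apply: near_eq_cvg; near=> s.
have ts : t < s by near: s; exact: nbhs_right_gt.
by rewrite flowE ?subr_ge0 ?(ltW ts) // -an_GT ?subr_ge0 ?(ltW ts) // subrK.
Unshelve. all: by end_near. Qed.

Lemma an_smeasG x : smeas (cut P (fun t => G (T t x))).
Proof.
apply: smeas_right => // t; rewrite /= in_itv /= andbT; exact: an_GT_right.
Qed.

Definition orbit_norm (x : X) (t : R) : R := `|cut P (fun t => T t x) t|.
Definition gen_norm (x : X) (t : R) : R := `|cut P (fun t => G (T t x)) t|.

Lemma orbit_norm_ge0 x t : 0 <= orbit_norm x t.
Proof. exact: normr_ge0. Qed.
Lemma gen_norm_ge0 x t : 0 <= gen_norm x t.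
Proof. exact: normr_ge0. Qed.
Hint Resolve orbit_norm_ge0 gen_norm_ge0 : core.

Lemma orbit_normE x t : 0 < t -> orbit_norm x t = `|T t x|.
Proof. by move=> t0; rewrite /orbit_norm cutP_gt0. Qed.
Lemma gen_normE x t : 0 < t -> gen_norm x t = `|G (T t x)|.
Proof. by move=> t0; rewrite /gen_norm cutP_gt0. Qed.
Lemma orbit_normN x t : t <= 0 -> orbit_norm x t = 0.
Proof. by move=> t0; rewrite /orbit_norm cutP ltNge t0 normr0. Qed.
Lemma gen_normN x t : t <= 0 -> gen_norm x t = 0.
Proof. by move=> t0; rewrite /gen_norm cutP ltNge t0 normr0. Qed.
Lemma orbit_norm_measurable x : measurable_fun setT (orbit_norm x).
Proof. by apply: smeas_norm; exact: an_smeas. Qed.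
Lemma gen_norm_measurable x : measurable_fun setT (gen_norm x).
Proof. by apply: smeas_norm; exact: an_smeasG. Qed.

(** The increment of an orbit is the integral of its derivative [T r (G y)]. *)
Lemma orbit_increment y t : 0 < t -> dom G y ->
  ((`|y - T t y|)%:E <= \int[mu]_(r in `]-oo, t]) (orbit_norm (G y) r)%:E)%E.
Proof.
move=> t0 Dy.
have := @ftc_norm R X (flow T y) (flow T (G y)) 0 t t0
  (@flow_continuous _ _ M T y bT) (@flow_continuous _ _ M T (G y) bT).
rewrite flowE ?(ltW t0) // flowE // an_T0 distrC => h.
apply: le_trans (h _) _.
  move=> r /andP[r0 _]; rewrite flowE ?(ltW r0) //.
  by apply: (flow_vderiv bT _ r0); exact: an_G.
rewrite (integral_itv_indic `[0, t]) (integral_itv_indic `]-oo, t]).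
have m0 : measurable ([set 0] : set R) by exact: measurable_set1.
apply: (@ge0_integral_le_off_null _ _ R mu _ _ [set 0] m0) => //.
- exact: lebesgue_measure_set1.
- by move=> r; rewrite lee_fin mulr_ge0.
move=> r /= r0; rewrite lee_fin !indicE.
have [|rt] := boolP (r \in `[0, t]%classic); last by rewrite mulr0 mulr_ge0 //.
rewrite inE /= in_itv /= => /andP[r0' rt]; rewrite mem_set //=.
rewrite flowE // orbit_normE //.
by rewrite lt_neqAle r0' andbT eq_sym; apply/eqP.
Qed.

(** For [r <= t / 2], [|G (T t x)| = |G (T (t - r) (T r x))|] is at most [2 C
    / t * |T r x|]; this is averaged over such [r]. *)
Lemma gen_norm_average x t : 0 < t ->
  ((gen_norm x t)%:E <= (4 * C / t / t)%:E * \int[mu]_(r in `]-oo, t]) (orbit_norm x r)%:E)%E.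
Proof.
move=> t0; have C0 := an_C0 hT.
have t2 : 0 < t / 2 by rewrite divr_gt0.
have mI : measurable (`]0, t / 2]%classic : set R) by exact: measurable_itv.
have e1 : ((t / 2 * gen_norm x t)%:E =
    \int[mu]_r (gen_norm x t * \1_(`]0%R, (t / 2)%R]%classic : set R) r)%:E)%E.
  under eq_integral do rewrite EFinM.
  rewrite ge0_integralZl_EFin //; last first.
    by apply/measurable_EFinP; exact: (@measurable_indic _ _ R).
  rewrite integral_indicT // EFinM muleC; congr (_ * _)%E.
  by have := @lebesgue_measure_itv R `]0, (t / 2)]; rewrite /= lte_fin t2 sube0.
have q0 : 0 <= 2 * C / t by rewrite divr_ge0 ?(ltW t0) // mulr_ge0.
have e2 : (\int[mu]_r (gen_norm x t * \1_(`]0%R, (t / 2)%R]%classic : set R) r)%:E <=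
   (2 * C / t)%:E * \int[mu]_(r in `]-oo, t]) (orbit_norm x r)%:E)%E.
  rewrite scaled_integral_indic //; last exact: orbit_norm_measurable.
  apply: (@ge0_integral_le_off_null _ _ R mu _ _ set0) => //.
  - by move=> r; rewrite lee_fin mulr_ge0 //.
  - by move=> r; rewrite lee_fin; do 2 (apply: mulr_ge0 => //).
  move=> r _; rewrite lee_fin !indicE.
  have [|rt] := boolP (r \in `]0, (t / 2)]%classic); last first.
    by rewrite mulr0; do 2 (apply: mulr_ge0 => //).
  rewrite inE /= in_itv /= => /andP[r0 rt]; rewrite mem_set /=; last first.
    by rewrite in_itv /=; lra.
  rewrite !mulr1 gen_normE // orbit_normE //.
  have tr : 0 < t - r by lra.
  have -> : T t x = T (t - r) (T r x) by rewrite -an_TD ?(ltW tr) ?(ltW r0) // subrK.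
  apply: (le_trans (an_bound hT _ tr)); rewrite ler_wpM2r //.
  rewrite [2 * C]mulrC -mulrA ler_wpM2l // -[2 / t]invf_div lef_pV2 ?posrE //.
  lra.
have ep : (0 < (t / 2)%:E)%E by rewrite lte_fin.
rewrite -(@lee_pmul2l _ (t / 2)%:E) // -EFinM e1 (le_trans e2) // muleA -EFinM.
rewrite lee_wpmul2r //; first by apply: integral_ge0 => r _; rewrite lee_fin.
rewrite lee_fin le_eqVlt; apply/orP; left; apply/eqP.
by field; rewrite gt_eqF.
Qed.

Variable p : R.
Hypothesis p01 : 0 < p < 1.

Definition bnorm (x : X) : \bar R := weighted p (orbit_norm x).

Lemma bnorm_ge0 x : (0 <= bnorm x)%E.
Proof. by apply: integral_ge0 => t _; rewrite lee_fin; apply: mulr_ge0 => //; exact: besov_weight_ge0. Qed.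

(** Hardy's inequality applied to the averages of the preceding lemma. *)
Lemma gen_norm_weighted x :
  (\int[mu]_t (t `^ p * gen_norm x t)%:E <= (4 * C / (1 - p))%:E * bnorm x)%E.
Proof.
have C0 := an_C0 hT.
have C4 : 0 <= 4 * C by rewrite mulr_ge0.
pose phi r := 4 * C * orbit_norm x r.
have mphi : measurable_fun setT phi.
  by apply: measurable_funM => //; exact: orbit_norm_measurable.
have phi0 t : 0 <= phi t by exact: mulr_ge0.
have phiN t : t <= 0 -> phi t = 0 by move=> t0; rewrite /phi orbit_normN ?mulr0.
have iphi t : (\int[mu]_(r in `]-oo, t]) (phi r)%:E =
   (4 * C)%:E * \int[mu]_(r in `]-oo, t]) (orbit_norm x r)%:E)%E.
  rewrite -ge0_integralZl_EFin // => [r _|]; first by rewrite lee_fin.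
  by apply/measurable_EFinP; apply: measurable_funTS; exact: orbit_norm_measurable.
have wphi : weighted p phi = ((4 * C)%:E * bnorm x)%E.
  rewrite /bnorm /weighted -ge0_integralZl_EFin //.
  - by apply: eq_integral => t _; rewrite -EFinM mulrCA.
  - by move=> t _; rewrite lee_fin mulr_ge0 // besov_weight_ge0.
  - apply/measurable_EFinP; apply: measurable_funM; first exact: measurable_besov_weight.
    exact: orbit_norm_measurable.
have := hardy_inequality p01 mphi phi0 phiN.
rewrite wphi muleA -EFinM [_^-1 * _]mulrC => h; apply: le_trans h.
have i0 t : (0 <= \int[mu]_(r in `]-oo, t]) (orbit_norm x r)%:E)%E.
  by apply: integral_ge0 => r _; rewrite lee_fin.
apply: (@ge0_integral_le_off_null _ _ R mu _ _ set0) => //.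
- by move=> t; rewrite lee_fin mulr_ge0 // powR_ge0.
- by move=> t; rewrite iphi !mule_ge0 // lee_fin ?hardy_weight_ge0.
move=> t _; have [t0|t0] := leP t 0.
  by rewrite gen_normN // mulr0 iphi !mule_ge0 // lee_fin ?hardy_weight_ge0.
apply: (@le_trans _ _ ((t `^ p)%:E * ((4 * C / t / t)%:E * \int[mu]_(r in `]-oo, t]) (orbit_norm x r)%:E))%E).
  by rewrite EFinM lee_wpmul2l ?lee_fin ?powR_ge0 //; exact: gen_norm_average.
rewrite iphi !muleA -!EFinM hardy_weightE //.
rewrite lee_wpmul2r // lee_fin le_eqVlt; apply/orP; left; apply/eqP.
by field; rewrite gt_eqF.
Qed.

(** Maximal regularity of the orbits. In [bnorm (G (T t x))], the integral
    over [r <= t] is at most [M * t^p / p * |G (T t x)|]. On [r >= t], [T r (G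
    (T t x)) = T t (G (T r x))] has norm at most [M |G (T r x)|], and
    integrating over [t <= r] produces the factor [r]. Both parts lead to the
    integral bounded in [gen_norm_weighted]. *)
Lemma bnorm_gen_integral x :
  (\int[mu]_t (if (0 < t)%R then bnorm (G (T t x)) else 0) <=
    ((M / p + M) * (4 * C / (1 - p)))%:E * bnorm x)%E.
Proof.
have C0 := an_C0 hT; have M0 := an_M0 hT; have [p0 p1] := andP p01.
pose psi r := besov_weight p r * gen_norm x r.
have mpsi : measurable_fun setT psi.
  by apply: measurable_funM; [exact: measurable_besov_weight|exact: gen_norm_measurable].
have psi0 t : 0 <= psi t by apply: mulr_ge0 => //; exact: besov_weight_ge0.
have psiN t : t <= 0 -> psi t = 0 by move=> t0; rewrite /psi gen_normN ?mulr0.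
have rpsi r : r * psi r = r `^ p * gen_norm x r.
  have [r0|r0] := leP r 0; first by rewrite psiN // gen_normN // !mulr0.
  by rewrite /psi besov_weightE // mulrA mulrCA divff ?mulr1 // gt_eqF.
have mg : measurable_fun setT (fun t => t `^ p * gen_norm x t).
  by apply: measurable_funM; [exact: measurable_powR|exact: gen_norm_measurable].
have pt t : 0 < t -> (bnorm (G (T t x)) <=
   (M / p * (t `^ p * gen_norm x t))%:E +
   M%:E * \int[mu]_(r in `[t, +oo[) (psi r)%:E)%E.
  move=> t0.
  have mA : measurable_fun setT (fun r => M * gen_norm x t * besov_weight p r * \1_(`]-oo, t]%classic : set R) r).
    apply: measurable_funM; last exact: (@measurable_indic _ _ R).
    by apply: measurable_funM => //; exact: measurable_besov_weight.
  have mB : measurable_fun setT (fun r => M * psi r * \1_(`[t, +oo[%classic : set R) r).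
    apply: measurable_funM; last exact: (@measurable_indic _ _ R).
    by apply: measurable_funM.
  have A0 r : 0 <= M * gen_norm x t * besov_weight p r * \1_(`]-oo, t]%classic : set R) r.
    by do 2 (apply: mulr_ge0 => //); [exact: mulr_ge0|exact: besov_weight_ge0].
  have B0 r : 0 <= M * psi r * \1_(`[t, +oo[%classic : set R) r.
    by do 2 (apply: mulr_ge0 => //).
  have step : (bnorm (G (T t x)) <= \int[mu]_r
     (M * gen_norm x t * besov_weight p r * \1_(`]-oo, t]%classic : set R) r +
      M * psi r * \1_(`[t, +oo[%classic : set R) r)%:E)%E.
    apply: (@ge0_integral_le_off_null _ _ R mu _ _ set0) => //.
    - by move=> r; rewrite lee_fin; apply: mulr_ge0 => //; exact: besov_weight_ge0.
    - by move=> r; rewrite lee_fin addr_ge0.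
    move=> r _; rewrite lee_fin; have [r0|r0] := leP r 0.
      by rewrite orbit_normN // mulr0 addr_ge0.
    rewrite orbit_normE //; have [rt|tr] := leP r t.
      apply: (@le_trans _ _ (M * gen_norm x t * besov_weight p r)).
        rewrite mulrC ler_wpM2r ?besov_weight_ge0 // gen_normE //; apply: an_TM; exact: ltW.
      rewrite !indicE mem_set; last by rewrite /= in_itv.
      by rewrite mulr1 lerDl.
    apply: (@le_trans _ _ (M * psi r)); last first.
      have -> : \1_(`[t, +oo[%classic : set R) r = 1 :> R.
        by rewrite indicE mem_set //= in_itv /= andbT ltW.
      by rewrite mulr1 lerDr.
    rewrite /psi mulrCA ler_wpM2l ?besov_weight_ge0 // gen_normE //.
    rewrite -an_GT ?(ltW r0) // addrC an_GT ?(ltW t0) //.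
    by apply: an_TM; exact: ltW.
  apply: (le_trans step); under eq_integral do rewrite EFinD.
  rewrite ge0_integralD //; last 4 first.
  - by move=> r _; rewrite lee_fin.
  - exact/measurable_EFinP.
  - by move=> r _; rewrite lee_fin.
  - exact/measurable_EFinP.
  apply: leeD.
    rewrite -scaled_integral_indic ?mulr_ge0 //; [|exact: measurable_besov_weight|by move=> ?; exact: besov_weight_ge0].
    apply: le_trans (lee_wpmul2l _ (besov_weight_int p01 t0)) _; first by rewrite lee_fin mulr_ge0.
    rewrite -EFinM lee_fin le_eqVlt; apply/orP; left; apply/eqP.
    by field; rewrite gt_eqF.
  by rewrite -scaled_integral_indic.
have gw := gen_norm_weighted x.
pose tl t := (\int[mu]_(r in `[t, +oo[) (psi r)%:E)%E.
have tl0 t : (0 <= tl t)%E by apply: integral_ge0 => r _; rewrite lee_fin.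
have it := integrated_tail mpsi psi0 psiN.
have [_ mtl _] := tonelli_triangle mpsi (@measurable_half_line R) psi0 (@half_line_ge0 R).
apply: (@le_trans _ _ (\int[mu]_t ((M / p)%:E * (t `^ p * gen_norm x t)%:E + M%:E * ((half_line t)%:E * tl t)))%E).
  apply: (@ge0_integral_le_off_null _ _ R mu _ _ set0) => //.
  - by move=> t; case: ifP => // _; exact: bnorm_ge0.
  - move=> t; rewrite adde_ge0 // mule_ge0 // ?lee_fin ?divr_ge0 ?(ltW p0) //.
      by rewrite mulr_ge0 // powR_ge0.
    by rewrite mule_ge0 // lee_fin half_line_ge0.
  move=> t _; case: ifPn => t0; last first.
    rewrite adde_ge0 // mule_ge0 // ?lee_fin ?divr_ge0 ?(ltW p0) //.
      by rewrite mulr_ge0 // powR_ge0.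
    by rewrite mule_ge0 // lee_fin half_line_ge0.
  by rewrite /half_line cutP_gt0 // mul1e -EFinM; exact: pt.
have e1 : (\int[mu]_t ((M / p)%:E * (t `^ p * gen_norm x t)%:E) =
    (M / p)%:E * \int[mu]_t (t `^ p * gen_norm x t)%:E)%E.
  rewrite ge0_integralZl_EFin ?divr_ge0 ?(ltW p0) //; last exact/measurable_EFinP.
  by move=> t _; rewrite lee_fin mulr_ge0 // powR_ge0.
have e2 : (\int[mu]_t (M%:E * ((half_line t)%:E * tl t)) = M%:E * \int[mu]_r (r * psi r)%:E)%E.
  rewrite ge0_integralZl_EFin //; first by rewrite it.
  by move=> t _; rewrite mule_ge0 // lee_fin half_line_ge0.
rewrite ge0_integralD //; last 4 first.
- by move=> t _; rewrite -EFinM lee_fin mulr_ge0 ?divr_ge0 ?(ltW p0) // mulr_ge0 // powR_ge0.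
- under eq_fun do rewrite -EFinM.
  by apply/measurable_EFinP; apply: measurable_funM.
- by move=> t _; rewrite !mule_ge0 // lee_fin half_line_ge0.
- exact: measurable_funeM.
rewrite e1 e2; under [X in (_ + M%:E * X)%E]eq_integral do rewrite rpsi.
rewrite -ge0_muleDl ?lee_fin ?divr_ge0 ?(ltW p0) //.
rewrite -EFinD EFinM -muleA; apply: lee_wpmul2l gw.
by rewrite lee_fin addr_ge0 // divr_ge0 // ltW.
Qed.

Lemma orbit_norm_T t x r : 0 <= t -> orbit_norm (T t x) r <= M * orbit_norm x r.
Proof.
move=> t0; have [r0|r0] := leP r 0; first by rewrite !orbit_normN // mulr0.
rewrite !orbit_normE // -an_TD ?(ltW r0) // addrC an_TD ?(ltW r0) //.
exact: an_TM.
Qed.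

Lemma bnorm_le x y c : 0 <= c -> (forall r, 0 < r -> `|T r x| <= c * `|T r y|) ->
  (bnorm x <= c%:E * bnorm y)%E.
Proof.
move=> c0 h; rewrite /bnorm /weighted -ge0_integralZl_EFin //; last 2 first.
- by move=> t _; rewrite lee_fin mulr_ge0 // besov_weight_ge0.
- apply/measurable_EFinP; apply: measurable_funM; first exact: measurable_besov_weight.
  exact: orbit_norm_measurable.
apply: (@ge0_integral_le_off_null _ _ R mu _ _ set0) => //.
- by move=> t; rewrite lee_fin mulr_ge0 // besov_weight_ge0.
- by move=> t; rewrite -EFinM lee_fin !mulr_ge0 // besov_weight_ge0.
move=> t _; rewrite -EFinM lee_fin mulrCA ler_wpM2l ?besov_weight_ge0 //.
have [r0|r0] := leP t 0; first by rewrite !orbit_normN // mulr0.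
by rewrite !orbit_normE //; exact: h.
Qed.

Lemma bnorm_T t x : 0 <= t -> (bnorm (T t x) <= M%:E * bnorm x)%E.
Proof.
move=> t0; apply: bnorm_le; first exact: an_M0 hT.
move=> r r0; have := orbit_norm_T x r t0; by rewrite !orbit_normE.
Qed.

Lemma bnorm_GT t x : 0 < t -> (bnorm (G (T t x)) <= (C / t)%:E * bnorm x)%E.
Proof.
move=> t0; apply: bnorm_le; first by rewrite divr_ge0 ?(ltW t0) // (an_C0 hT).
move=> r r0; rewrite -an_GT ?(ltW r0) // addrC an_TD ?(ltW r0) ?(ltW t0) //.
exact: (an_bound hT).
Qed.

(** Dominated convergence: pointwise convergence of the orbits, with a
    dominating orbit of finite norm, implies convergence in the Besov norm. *)
Lemma bnorm_cvg0 (u : nat -> X) (x : X) (c : R) : 0 <= c -> (bnorm x < +oo)%E ->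
  (forall n r, 0 < r -> `|T r (u n)| <= c * `|T r x|) ->
  (forall r, 0 < r -> T r (u n) @[n --> \oo] --> (0 : X)) ->
  bnorm (u n) @[n --> \oo] --> 0%E.
Proof.
move=> c0 xoo hdom hu.
have mw y : measurable_fun setT (fun t => besov_weight p t * orbit_norm y t).
  by apply: measurable_funM; [exact: measurable_besov_weight|exact: orbit_norm_measurable].
have := @dominated_convergence _ _ _ mu setT measurableT
  (fun n t => (besov_weight p t * orbit_norm (u n) t)%:E) (cst 0%E)
  (fun t => (c%:E * (besov_weight p t * orbit_norm x t)%:E)%E).
case => //.
- by move=> n; apply/measurable_EFinP; exact: mw.
- apply: aeW => t _; apply: cvg_EFin; first by near=> n.
  rewrite (_ : (fine \o _) = fun n => besov_weight p t * orbit_norm (u n) t) //.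
  have [t0|t0] := leP t 0.
    rewrite (_ : (fun n => _) = fun=> 0); first exact: cvg_cst.
    by apply/funext => n; rewrite orbit_normN // mulr0.
  rewrite -[X in _ --> X](mulr0 (besov_weight p t)); apply: cvgMr.
  rewrite (_ : (fun n => _) = fun n => `|T t (u n)|); last first.
    by apply/funext => n; rewrite orbit_normE.
  by rewrite -(normr0 X); apply: cvg_norm; exact: hu.
- apply: integrableZl => //; apply/integrableP; split.
    by apply/measurable_EFinP; exact: mw.
  rewrite (_ : (\int[_]_(_ in _) _)%E = bnorm x) //.
  apply: eq_integral => t _; rewrite gee0_abs // lee_fin mulr_ge0 //.
  exact: besov_weight_ge0.
- apply: aeW => t n _; rewrite -EFinM /= lee_fin ger0_norm; last first.
    by rewrite mulr_ge0 // besov_weight_ge0.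
  rewrite mulrCA ler_wpM2l ?besov_weight_ge0 //.
  have [t0|t0] := leP t 0; first by rewrite !orbit_normN // mulr0.
  by rewrite !orbit_normE //; exact: hdom.
by move=> _ _; rewrite integral0.
Unshelve. all: by end_near. Qed.

End theory.

(** Decompose [T2 t (G2 y) = G2 (T2 t (y - T1 t y)) + T2 t (G2 (T1 t y))]. The
    first term is at most [C2 / t] times the integral of [|T1 r (G1 y)|] over
    [r <= t], to which Hardy's inequality applies; the second is controlled by
    [|T1 t (G1 y)|] since [G2] is bounded relative to [G1]. *)
Lemma bnorm_transfer (M1 C1 M2 C2 b p : R) (T1 T2 : R -> X -> X)
    (G1 G2 : operator X X) y :
  analytic M1 C1 T1 G1 -> analytic M2 C2 T2 G2 -> 0 < p < 1 -> 0 <= b ->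
  dom G1 = dom G2 -> (forall x, dom G1 x -> `|G2 x| <= b * `|G1 x|) ->
  dom G1 y ->
  (bnorm T2 p (G2 y) <= (C2 / (1 - p) + M2 * b)%:E * bnorm T1 p (G1 y))%E.
Proof.
move=> h1 h2 p01 b0 Dd Gb Dy; have Dy2 : dom G2 y by rewrite -Dd.
have C0 := an_C0 h2; have M0 := an_M0 h2; have [p0 p1] := andP p01.
pose n1 := orbit_norm T1 (G1 y).
have mn1 : measurable_fun setT n1 by exact: (orbit_norm_measurable h1).
have n10 t : 0 <= n1 t by exact: normr_ge0.
have n1N t : t <= 0 -> n1 t = 0 by exact: orbit_normN.
pose phi t := C2 * n1 t.
have mphi : measurable_fun setT phi by apply: measurable_funM.
have phi0 t : 0 <= phi t by exact: mulr_ge0.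
have phiN t : t <= 0 -> phi t = 0 by move=> t0; rewrite /phi n1N ?mulr0.
have iphi t : (\int[mu]_(r in `]-oo, t]) (phi r)%:E =
   C2%:E * \int[mu]_(r in `]-oo, t]) (n1 r)%:E)%E.
  rewrite -ge0_integralZl_EFin // => [r _|]; first by rewrite lee_fin.
  by apply/measurable_EFinP; exact: measurable_funTS.
have mw : measurable_fun setT (fun r => besov_weight p r * n1 r).
  by apply: measurable_funM => //; exact: measurable_besov_weight.
have w0 r : 0 <= besov_weight p r * n1 r by rewrite mulr_ge0 // besov_weight_ge0.
have wphi : weighted p phi = (C2%:E * bnorm T1 p (G1 y))%E.
  rewrite /bnorm /weighted -ge0_integralZl_EFin //.
  - by apply: eq_integral => t _; rewrite -EFinM mulrCA.
  - by move=> t _; rewrite lee_fin; exact: w0.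
  - by apply/measurable_EFinP; exact: mw.
have hardy := hardy_inequality p01 mphi phi0 phiN.
pose hd t := ((hardy_weight p t)%:E * \int[mu]_(r in `]-oo, t]) (phi r)%:E)%E.
have hd0 t : (0 <= hd t)%E.
  by rewrite mule_ge0 ?lee_fin ?hardy_weight_ge0 //; apply: integral_ge0 => r _; rewrite lee_fin.
have [mhd _ _] := tonelli_triangle (measurable_hardy_weight p) mphi (@hardy_weight_ge0 R p) phi0.
have pt t : 0 < t -> ((`|T2 t (G2 y)|)%:E <= (C2 / t)%:E *
    \int[mu]_(r in `]-oo, t]) (n1 r)%:E + (M2 * b * n1 t)%:E)%E.
  move=> t0; have [Dt _] := an_comm h1 (ltW t0) Dy.
  have Dt2 : dom G2 (T1 t y) by rewrite -Dd.
  have [Dm Gm] := an_linB h2 Dy2 Dt2.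
  have -> : T2 t (G2 y) = G2 (T2 t (y - T1 t y)) + T2 t (G2 (T1 t y)).
    have [_ ->] := an_comm h2 (ltW t0) Dm.
    by rewrite Gm -(bopD (an_bopT h2 (ltW t0))) subrK.
  apply: (@le_trans _ _ ((`|G2 (T2 t (y - T1 t y))|)%:E + (`|T2 t (G2 (T1 t y))|)%:E)%E).
    by rewrite -EFinD lee_fin ler_normD.
  apply: leeD.
    apply: (@le_trans _ _ ((C2 / t)%:E * (`|y - T1 t y|)%:E)%E).
      by rewrite -EFinM lee_fin; exact: (an_bound h2).
    apply: lee_wpmul2l; first by rewrite lee_fin divr_ge0 // ltW.
    exact: (orbit_increment h1).
  rewrite lee_fin (le_trans (an_TM h2 _ (ltW t0))) // -mulrA ler_wpM2l //.
  rewrite (le_trans (Gb _ Dt)) // ler_wpM2l // /n1 orbit_normE //.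
  by have [_ ->] := an_comm h1 (ltW t0) Dy.
apply: (@le_trans _ _ (\int[mu]_t (hd t + (M2 * b)%:E * (besov_weight p t * n1 t)%:E))%E).
  apply: (@ge0_integral_le_off_null _ _ R mu _ _ set0) => //.
  - by move=> t; rewrite lee_fin mulr_ge0 ?besov_weight_ge0 // orbit_norm_ge0.
  - by move=> t; rewrite adde_ge0 // -EFinM lee_fin !mulr_ge0 // besov_weight_ge0.
  move=> t _; have [t0|t0] := leP t 0.
    by rewrite orbit_normN // mulr0 adde_ge0 // -EFinM lee_fin !mulr_ge0 // besov_weight_ge0.
  rewrite EFinM orbit_normE //.
  apply: (le_trans (lee_wpmul2l _ (pt t t0))); first by rewrite lee_fin besov_weight_ge0.
  rewrite ge0_muleDr; last 2 first.
  - rewrite mule_ge0 ?lee_fin ?divr_ge0 // ?(ltW t0) //.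
    by apply: integral_ge0 => r _; rewrite lee_fin.
  - by rewrite lee_fin !mulr_ge0.
  apply: leeD; last by rewrite -!EFinM lee_fin mulrCA.
  rewrite /hd iphi !muleA -!EFinM lee_wpmul2r //.
    by apply: integral_ge0 => r _; rewrite lee_fin.
  rewrite lee_fin hardy_weightE // besov_weightE // le_eqVlt; apply/orP; left; apply/eqP.
  by field; rewrite gt_eqF.
rewrite ge0_integralD //; last 2 first.
- by move=> t _; rewrite -EFinM lee_fin !mulr_ge0 // besov_weight_ge0.
- by apply: measurable_funeM; exact/measurable_EFinP.
rewrite ge0_integralZl_EFin ?mulr_ge0 //; last 2 first.
- by move=> t _; rewrite lee_fin.
- exact/measurable_EFinP.
rewrite EFinD ge0_muleDl ?lee_fin ?mulr_ge0 ?invr_ge0 ?subr_ge0 ?(ltW p1) //.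
apply: leeD => //; apply: (le_trans hardy).
by rewrite wphi muleA -EFinM [_^-1 * _]mulrC.
Qed.

End analytic_semigroup.

(** * The semigroup on the completion *)

Section density_extension.
Context {R : realType}.

Lemma dense_approx {X : Type} {Y : normedModType R} (j : X -> Y) (D : set X) y (e : R) :
  dense (j @` D) -> 0 < e -> exists2 x, D x & `|y - j x| < e.
Proof.
move=> dD e0.
have [|z [yz [x Dx xz]]] := dD (ball y e) _ (ball_open y e).
  by exists y; exact: ballxx.
by exists x => //; move: yz; rewrite -xz -ball_normE.
Qed.

Lemma bop_eq_dense {X : Type} {Y Z : normedModType R} (j : X -> Y) (D : set X)
    (K L : Y -> Z) : dense (j @` D) -> bop K -> bop L ->
  (forall x, D x -> K (j x) = L (j x)) -> forall y, K y = L y.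
Proof.
move=> dD bK bL KL y.
have [C C0 hC] := bop_bound bK; have [C' C'0 hC'] := bop_bound bL.
apply/eqP; rewrite -subr_eq0 -normr_le0; apply/ler_addgt0Pl => e e0.
have [x Dx yx] := dense_approx y dD (divr_gt0 e0 (addr_gt0 C0 C'0)).
rewrite addr0 (_ : K y - L y = K (y - j x) - L (y - j x)); last first.
  by rewrite (bopB bK) (bopB bL) KL // opprB addrA subrK.
rewrite (le_trans (ler_normB _ _)) // (le_trans (lerD (hC _) (hC' _))) //.
by rewrite -mulrDl mulrC -ler_pdivlMr ?addr_gt0 // ltW.
Qed.

(** The closure of the graph of [L]: the bound makes it single valued, and
    density with completeness makes it total. *)
Lemma density_extension {X Y : normedModType R} {Z : completeNormedModType R}
    (j : X -> Y) (D : set X) (L : X -> Z) (c : R) : 0 <= c -> dense (j @` D) ->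
  (forall (a : R) x y, D x -> D y -> D (a *: x + y)) ->
  (forall (a : R) x y, D x -> D y -> j (a *: x + y) = a *: j x + j y) ->
  (forall (a : R) x y, D x -> D y -> L (a *: x + y) = a *: L x + L y) ->
  (forall x, D x -> `|L x| <= c * `|j x|) ->
  exists K : Y -> Z, [/\ bop K, forall y, `|K y| <= c * `|y| &
    forall x, D x -> K (j x) = L x].
Proof.
move=> c0 dD Dl jl Ll Lc.
pose Gr y z := forall e : R, 0 < e -> exists x, [/\ D x, `|y - j x| <= e & `|z - L x| <= e].
have Grb y z : Gr y z -> `|z| <= c * `|y|.
  move=> Gyz; apply/ler_addgt0Pl => e e0.
  have c1 : 0 < 1 + c by rewrite ltr_wpDr.
  have [x [Dx h1 h2]] := Gyz _ (divr_gt0 e0 c1).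
  have h3 : `|j x| <= `|y| + e / (1 + c).
    rewrite -[j x](subrK y) (le_trans (ler_normD _ _)) // addrC lerD2l.
    by rewrite distrC.
  have h4 : `|z| <= e / (1 + c) + c * `|j x|.
    rewrite -[z](subrK (L x)) (le_trans (ler_normD _ _)) // lerD //; exact: Lc.
  apply: (le_trans h4); have := ler_wpM2l c0 h3.
  have : e / (1 + c) * (1 + c) = e by rewrite divfK // gt_eqF.
  by move: (e / (1 + c)) => d; lra.
have Grl (a : R) y z y' z' : Gr y z -> Gr y' z' -> Gr (a *: y + y') (a *: z + z').
  move=> h h' e e0; have a1 : 0 < 1 + `|a| by rewrite ltr_wpDr.
  have d0 := divr_gt0 e0 a1; pose d := e / (1 + `|a|).
  have [x [Dx h1 h2]] := h d d0; have [x' [Dx' h1' h2']] := h' d d0.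
  have dE : d + `|a| * d = e by rewrite -[X in X + _]mul1r -mulrDl mulrC divfK // gt_eqF.
  exists (a *: x + x'); split; first exact: Dl.
    rewrite jl // opprD addrACA -scalerBr (le_trans (ler_normD _ _)) // normrZ.
    by rewrite -dE [leRHS]addrC lerD // ler_wpM2l.
  rewrite Ll // opprD addrACA -scalerBr (le_trans (ler_normD _ _)) // normrZ.
  by rewrite -dE [leRHS]addrC lerD // ler_wpM2l.
have Grf y z z' : Gr y z -> Gr y z' -> z = z'.
  move=> h h'; have := Grb _ _ (Grl (-1) _ _ _ _ h h').
  rewrite !scaleN1r [- y + y]addNr normr0 mulr0 normr_le0 addrC subr_eq0.
  by move=> /eqP.
have LB x x' : D x -> D x' -> `|L x - L x'| <= c * `|j x - j x'|.
  move=> Dx Dx'; have := Lc _ (Dl (-1) _ _ Dx' Dx).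
  by rewrite Ll // jl // !scaleN1r ![- _ + _]addrC.
have Grt y : exists z, Gr y z.
  have inv0 n : (0 : R) < n.+1%:R^-1 by rewrite invr_gt0.
  have /choice[x hx] : forall n : nat, exists x, D x /\ `|y - j x| < n.+1%:R^-1.
    by move=> n; have [x Dx h] := dense_approx y dD (inv0 n); exists x.
  have cinv : (fun n : nat => (c + 1) * n.+1%:R^-1) n @[n --> \oo] --> (0 : R).
    by rewrite -[X in _ --> X](mulr0 (c + 1)); apply: cvgMr; exact: cvg_harmonic.
  have cL : cvgn (fun n => L (x n)).
    apply: (cauchy_cvg_bound cinv) => n m.
    have [Dn hn] := hx n; have [Dm hm] := hx m.
    rewrite (le_trans (LB _ _ Dn Dm)) // -mulrDr.
    apply: (@le_trans _ _ (c * (n.+1%:R^-1 + m.+1%:R^-1))).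
      rewrite ler_wpM2l // -[j (x n)](subrK y) -addrA (le_trans (ler_normD _ _)) //.
      by rewrite distrC lerD // ltW.
    by rewrite ler_wpM2r ?lerDl // addr_ge0 // ltW.
  exists (limn (fun n => L (x n))) => e e0.
  have h1 : \forall n \near \oo, `|limn (fun n => L (x n)) - L (x n)| < e.
    by move/cvgrPdist_lt: cL; apply.
  have h2 : \forall n \near \oo, n.+1%:R^-1 < e.
    exact: (near_infty_natSinv_lt (PosNum e0)).
  have [N _ hN] : \forall n \near \oo, `|limn (fun n => L (x n)) - L (x n)| < e /\
    n.+1%:R^-1 < e by apply: filterS2 h1 h2.
  have [a b] := hN N (leqnn N); have [DN hxN] := hx N.
  by exists (x N); split; rewrite ?ltW // (lt_trans hxN).
have /choice[K hK] := Grt.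
exists K; split.
- split; first by move=> a y y'; apply: (Grf (a *: y + y')) => //; exact: Grl.
  by exists c => y; exact: Grb.
- by move=> y; exact: Grb.
- move=> x Dx; apply: (Grf (j x)) => // e e0.
  by exists x; split; rewrite ?subrr ?normr0 // ltW.
Qed.

End density_extension.

Section semigroup_quantitative.
Context {R : realType} {V : normedModType R}.

Let sub3_cancel (x y z u v : V) : x - (u + v) - (y - u) - (z - v) = x - y - z.
Proof.
by rewrite [- (y - u)]opprB [- (z - v)]opprB opprD [x + (- u - v)]addrA
  [x - u - v + _]addrAC !subrKA.
Qed.

(** The admissible [h] depend on [w] only, through the continuity of its
    orbit. This uniformity in [z] is what allows limits in [z] later on. *)
Lemma right_gen_quantitative M (E : R -> V -> V) z w (h e : R) :
  bounded_semigroup M E -> right_gen E z w -> 0 < h ->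
  (forall r, 0 < r < h -> `|E r w - w| <= e) -> `|E h z - z - h *: w| <= e * h.
Proof.
move=> bE zw h0 he.
pose F r := flow E z r - r *: w.
have cF : continuous F.
  move=> r; apply: cvgB; first exact: (flow_continuous bE).
  by apply: cvgZr_tmp; exact: cvg_id.
have := @mean_value R V F (fun r => E r w - w) 0 h e (ltW h0) cF.
rewrite /F scale0r subr0 (flowE _ _ (ltW h0)) flowE // subr0.
have E0 : E 0 z = z by case: bE.
rewrite E0 addrAC => H; apply: H => // r /andP[r0 rh] d d0.
have [a a0 ha] := flow_vderiv bE zw r0 d0; exists a => // k /ha.
apply: le_trans; rewrite le_eqVlt; apply/orP; left; apply/eqP; congr (`|_|).
by rewrite scalerBr scalerDl sub3_cancel.
Qed.

End semigroup_quantitative.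

(** The abstract situation to which the completion leads: a bounded semigroup
    [E] mapping into the domain of its generator, [S t] standing for the
    generator composed with [E t]. *)
Record smoothing {R : realType} {Y : normedModType R} (M K : R) (E S : R -> Y -> Y) := Smoothing {
  sm_sg : bounded_semigroup M E;
  sm_M0 : 0 <= M;
  sm_K0 : 0 <= K;
  sm_S : forall t, 0 < t -> bop (S t);
  sm_SE : forall s t y, 0 <= s -> 0 < t -> S (s + t) y = E s (S t y);
  sm_SE' : forall s t y, 0 <= s -> 0 < t -> S (s + t) y = S t (E s y);
  sm_gen : forall t y, 0 < t -> right_gen E (E t y) (S t y);
  sm_smeas : forall y : Y, smeas (cut (`]0%R, +oo[%classic : set R) (fun t => S t y));
  sm_int : forall y : Y, (L1n (cut (`]0%R, +oo[%classic : set R) (fun t => S t y)) <= (K * `|y|)%:E)%E }.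

(** The graph of the generator [H], described as [H (E e x) = E e (H x)] for
    all [e > 0]. The left side makes sense for every [x], and the relation is
    visibly linear and closed. *)
Definition smooth_graph {R : realType} {Y : normedModType R} (E S : R -> Y -> Y) (x y : Y) :=
  forall e : R, 0 < e -> S e x = E e y.

(** Fatou's lemma. *)
Lemma L1n_lim_le {R : realType} {V : normedModType R} (f : R -> V) (g : nat -> R -> V) (c : \bar R) :
  (forall n, smeas (g n)) -> (forall t, g n t @[n --> \oo] --> f t) ->
  (forall n, (L1n (g n) <= c)%E) -> (L1n f <= c)%E.
Proof.
move=> mg gf gc.
have -> : L1n f = (\int[@lebesgue_measure R]_t limn_einf (fun n => (`|g n t|)%:E))%E.
  apply: eq_integral => t _.
  have cn : (`|g n t|)%:E @[n --> \oo] --> (`|f t|)%:E.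
    by apply: cvg_EFin; [exact: nearW|exact: cvg_norm].
  by rewrite is_cvg_limn_einfE; [exact/esym/cvg_lim|apply/cvg_ex; exists (`|f t|)%:E].
apply: le_trans (fatou _ _ _ _) _ => //.
- by move=> n; exact: measurable_normE.
rewrite limn_einf_lim; apply: lime_le; first exact: is_cvg_einfs.
apply: nearW => n; apply: le_trans (gc n); apply: ereal_inf_lbound.
by exists n => //=.
Qed.

Lemma closure_pairP {R : realType} {V W : normedModType R} (A : set (V * W)) x y :
  closure A (x, y) <-> forall e : R, 0 < e -> exists x' y', [/\ A (x', y'), `|x - x'| < e & `|y - y'| < e].
Proof.
split=> [cA e e0|h B].
  have [|[x' y'] [Axy [/= h1 h2]]] := cA (ball (x, y) e).
    exact: nbhsx_ballx.
  by exists x', y'; move: h1 h2; rewrite -!ball_normE.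
rewrite -nbhs_ballE => -[e /= e0 he].
have [x' [y' [Axy h1 h2]]] := h e e0.
by exists (x', y'); split => //; apply: he; split => /=; rewrite -ball_normE.
Qed.

Section completed_semigroup.
Context {R : realType} {X : normedModType R} {Y : completeNormedModType R}.
Variables (M C p : R) (T : R -> X -> X) (G : operator X X) (j : X -> Y).
Hypothesis hT : analytic M C T G.
Hypothesis p01 : 0 < p < 1.
Hypothesis jlin : forall (a : R) x y, op_range G x -> op_range G y ->
  j (a *: x + y) = a *: j x + j y.
Hypothesis jnorm : forall x, op_range G x -> ((`|j x|)%:E = bnorm T p x)%E.
Hypothesis jdense : dense (j @` op_range G).

Let D := op_range G.

Lemma range_lin (a : R) x y : D x -> D y -> D (a *: x + y).
Proof.
move=> [u Du <-] [v Dv <-]; have [_ lG] := an_lin hT.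
by have [Dw Gw] := lG a u v Du Dv; exists (a *: u + v).
Qed.

Lemma range_T t x : 0 <= t -> D x -> D (T t x).
Proof.
move=> t0 [u Du <-]; have [Dw Gw] := an_comm hT t0 Du; by exists (T t u).
Qed.

Lemma range_GT t x : 0 < t -> D (G (T t x)).
Proof. by move=> t0; exists (T t x) => //; exact: (an_dom hT). Qed.

Lemma range_sub x y : D x -> D y -> D (x - y).
Proof. by move=> Dx Dy; have := range_lin (-1) Dy Dx; rewrite scaleN1r addrC. Qed.

Lemma range_scale (a : R) x : D x -> D (a *: x).
Proof.
move=> Dx; have D0 := range_sub Dx Dx; rewrite subrr in D0.
by have := range_lin a Dx D0; rewrite addr0.
Qed.

Lemma jsub x y : D x -> D y -> j (x - y) = j x - j y.
Proof.
by move=> Dx Dy; have := jlin (-1) Dy Dx; rewrite !scaleN1r ![- _ + _]addrC.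
Qed.

Lemma j0 : j 0 = 0.
Proof.
have [|_ [_ [x Dx _]]] := jdense _ openT; first by exists 0.
by have := jsub Dx Dx; rewrite !subrr.
Qed.

Lemma jscale (a : R) x : D x -> j (a *: x) = a *: j x.
Proof.
move=> Dx; have D0 := range_sub Dx Dx; rewrite subrr in D0.
by have := jlin a Dx D0; rewrite j0 !addr0.
Qed.

Lemma jnorm_le x y c : D x -> D y -> (bnorm T p x <= c%:E * bnorm T p y)%E ->
  `|j x| <= c * `|j y|.
Proof. by move=> Dx Dy; rewrite -!jnorm // -EFinM lee_fin. Qed.

Lemma extension_E t : 0 <= t -> exists K : Y -> Y,
  [/\ bop K, forall y, `|K y| <= M * `|y| & forall x, D x -> K (j x) = j (T t x)].
Proof.
move=> t0; have bt := an_bopT hT t0.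
apply: density_extension => //.
- exact: an_M0 hT.
- exact: range_lin.
- by move=> a x y Dx Dy; rewrite (bopD bt) (bopZ bt) jlin //; exact: range_T.
- move=> x Dx; apply: jnorm_le => //; first exact: range_T.
  exact: (bnorm_T hT).
Qed.

Lemma extension_S t : 0 < t -> exists K : Y -> Y,
  [/\ bop K, forall y, `|K y| <= C / t * `|y| & forall x, D x -> K (j x) = j (G (T t x))].
Proof.
move=> t0; have bt := an_bopT hT (ltW t0).
have Dt x := an_dom hT x t0.
apply: density_extension => //.
- by rewrite divr_ge0 ?(an_C0 hT) // ltW.
- exact: range_lin.
- move=> a x y Dx Dy; have [_ lG] := an_lin hT.
  rewrite (bopD bt) (bopZ bt); have [_ ->] := lG a _ _ (Dt x) (Dt y).
  by rewrite jlin //; exact: range_GT.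
- move=> x Dx; apply: jnorm_le => //; first exact: range_GT.
  exact: (bnorm_GT hT).
Qed.

Lemma extension_ES : exists E S : R -> Y -> Y,
  (forall t, 0 <= t -> [/\ bop (E t), forall y, `|E t y| <= M * `|y| &
     forall x, D x -> E t (j x) = j (T t x)]) /\
  (forall t, 0 < t -> [/\ bop (S t), forall y, `|S t y| <= C / t * `|y| &
     forall x, D x -> S t (j x) = j (G (T t x))]).
Proof.
have /choice[E hE] : forall t, exists K : Y -> Y, 0 <= t -> [/\ bop K,
    forall y, `|K y| <= M * `|y| & forall x, D x -> K (j x) = j (T t x)].
  move=> t; have [t0|t0] := leP 0 t.
    by have [K hK] := extension_E t0; exists K.
  by exists id.
have /choice[S hS] : forall t, exists K : Y -> Y, 0 < t -> [/\ bop K,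
    forall y, `|K y| <= C / t * `|y| & forall x, D x -> K (j x) = j (G (T t x))].
  move=> t; have [t0|t0] := leP t 0; last first.
    by have [K hK] := extension_S t0; exists K.
  by exists id.
by exists E, S.
Qed.

Variables (E S : R -> Y -> Y).
Hypothesis hE : forall t, 0 <= t -> [/\ bop (E t), forall y, `|E t y| <= M * `|y| &
     forall x, D x -> E t (j x) = j (T t x)].
Hypothesis hS : forall t, 0 < t -> [/\ bop (S t), forall y, `|S t y| <= C / t * `|y| &
     forall x, D x -> S t (j x) = j (G (T t x))].

Let Ej t x : 0 <= t -> D x -> E t (j x) = j (T t x).
Proof. by move=> /hE[_ _]; exact. Qed.
Let Sj t x : 0 < t -> D x -> S t (j x) = j (G (T t x)).
Proof. by move=> /hS[_ _]; exact. Qed.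
Let bE t : 0 <= t -> bop (E t). Proof. by move=> /hE[]. Qed.
Let bS t : 0 < t -> bop (S t). Proof. by move=> /hS[]. Qed.
Let EM t y : 0 <= t -> `|E t y| <= M * `|y|. Proof. by move=> /hE[_ + _]; exact. Qed.
Let SC t y : 0 < t -> `|S t y| <= C / t * `|y|. Proof. by move=> /hS[_ + _]; exact. Qed.

(** Right limits in the completion are obtained orbit by orbit in [X], by
    dominated convergence; this applies since [f h] is dominated along orbits
    by a fixed element of the range. *)
Lemma jcvg0 (f : R -> X) (x : X) (c : R) : 0 <= c -> D x ->
  (forall h, 0 < h -> D (f h)) ->
  (forall h r, 0 < h -> 0 < r -> `|T r (f h)| <= c * `|T r x|) ->
  (forall r, 0 < r -> T r (f h) @[h --> 0^'+] --> (0 : X)) ->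
  forall e : R, 0 < e -> exists2 a : R, 0 < a & forall h, 0 < h < a -> `|j (f h)| <= e.
Proof.
move=> c0 Dx Df fdom fcvg e e0.
have : (fun h => `|j (f h)|) h @[h --> 0^'+] --> (0 : R).
  apply/cvg_at_rightP => u [u0 ucvg].
  have xoo : (bnorm T p x < +oo)%E by rewrite -jnorm // ltry.
  have := bnorm_cvg0 hT c0 xoo (fun n r => fdom (u n) r (u0 n)).
  have h2 r : 0 < r -> T r (f (u n)) @[n --> \oo] --> (0 : X).
    move=> r0; apply: (cvg_right_seq (fcvg r r0) ucvg).
    by near=> n; exact: u0.
  move=> /(_ h2) /fine_cvgP[_]; apply: cvg_trans.
  rewrite (_ : (fun n => `|j (f (u n))|) = fine \o (fun n => bnorm T p (f (u n)))) //.
  by apply/funext => n; rewrite /= -jnorm //; exact: Df.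
move=> /cvgrPdist_le/(_ e e0); rewrite /at_right near_withinE => -[a /= a0 ha].
exists a => // h /andP[h0 hb]; have := ha h.
by rewrite /ball_ /= sub0r normrN gtr0_norm // => /(_ hb h0); rewrite sub0r normrN normr_id.
Unshelve. all: by end_near. Qed.

Lemma orbitC s t x : 0 <= s -> 0 <= t -> T s (T t x) = T t (T s x).
Proof. by move=> s0 t0; rewrite -!(an_TD hT) // addrC. Qed.

Lemma completed_right_cont x (e : R) : D x -> 0 < e ->
  exists2 a : R, 0 < a & forall h, 0 < h < a -> `|E h (j x) - j x| <= e.
Proof.
move=> Dx e0; have M0 := an_M0 hT.
have fdom h r : 0 < h -> 0 < r -> `|T r (T h x - x)| <= (M + 1) * `|T r x|.
  move=> h0 r0; have br := an_bopT hT (ltW r0).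
  have -> : T r (T h x - x) = T h (T r x) - T r x.
    by rewrite (bopB br) orbitC ?ltW.
  rewrite (le_trans (ler_normB _ _)) // mulrDl mul1r lerD2r.
  by apply: (an_TM hT); exact: ltW.
have fcvg r : 0 < r -> T r (T h x - x) @[h --> 0^'+] --> (0 : X).
  move=> r0; have br := an_bopT hT (ltW r0).
  have [_ _ _ _ cT] := an_sg hT.
  have : T h (T r x) - T r x @[h --> 0^'+] --> (0 : X).
    by rewrite -[X in _ --> X](subrr (T r x)); apply: cvgB; [exact: cT|exact: cvg_cst].
  apply: cvg_trans; apply: near_eq_cvg; near=> h.
  have h0 : 0 < h by near: h; exact: nbhs_right_gt.
  by rewrite (bopB br) orbitC ?ltW.
have [a a0 ha] := @jcvg0 (fun h => T h x - x) x (M + 1) (addr_ge0 M0 ler01) Dx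
  (fun h h0 => range_sub (range_T (ltW h0) Dx) Dx) fdom fcvg e e0.
exists a => // h ha'; have h0 : 0 < h by case/andP: ha'.
rewrite Ej ?(ltW h0) // -jsub //; last by apply: range_T => //; exact: ltW.
exact: ha.
Unshelve. all: by end_near. Qed.

Lemma completed_semigroup : bounded_semigroup M E.
Proof.
split.
- by move=> t /bE bt a x y; rewrite (bopD bt) (bopZ bt).
- exact: EM.
- apply: (bop_eq_dense jdense (bE (lexx 0)) bop_id) => x Dx.
  by rewrite Ej // (an_T0 hT).
- move=> s t y s0 t0.
  apply: (bop_eq_dense jdense (bE (addr_ge0 s0 t0)) (bop_comp (bE s0) (bE t0))) => x Dx.
  rewrite /= !Ej ?addr_ge0 //; last exact: range_T.
  by rewrite (an_TD hT).
- move=> y; apply/cvgrPdist_le => e e0; have M0 := an_M0 hT.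
  have M2 : 0 < M + 2 by rewrite ltr_wpDl.
  have d0 : 0 < e / (M + 2) by rewrite divr_gt0.
  have [x Dx yx] := dense_approx y jdense d0.
  have [a a0 ha] := completed_right_cont Dx d0.
  near=> h; have h0 : 0 < h by near: h; exact: nbhs_right_gt.
  have hh : 0 < h < a by rewrite h0; near: h; exact: nbhs_right_lt.
  have -> : y - E h y = (y - j x) + (j x - E h (j x)) + E h (j x - y).
    by rewrite (bopB (bE (ltW h0))) !subrKA.
  have n1 := ha h hh; rewrite distrC in n1.
  have n2 : `|E h (j x - y)| <= M * (e / (M + 2)).
    rewrite (le_trans (EM _ (ltW h0))) // ler_wpM2l // distrC ltW //.
  rewrite (le_trans (ler_normD _ _)) // (le_trans (lerD (ler_normD _ _) (lexx _))) //.
  have : e / (M + 2) * (M + 2) = e by rewrite divfK // gt_eqF.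
  move: n1 n2 yx; move: (e / (M + 2)) => d; lra.
Unshelve. all: by end_near. Qed.

Lemma completed_SE s t y : 0 <= s -> 0 < t -> S (s + t) y = E s (S t y).
Proof.
move=> s0 t0.
apply: (bop_eq_dense jdense (bS (ltr_wpDl s0 t0)) (bop_comp (bE s0) (bS t0))) => x Dx.
rewrite /= (Sj t0 Dx) (Sj (ltr_wpDl s0 t0) Dx) (Ej s0 (range_GT _ t0)).
by rewrite (an_GT hT).
Qed.

(** The mean value inequality along the orbit bounds the difference quotients
    of [z = T t x] by [G z], which is the domination required for passing to
    the limit in the Besov norm. *)
Lemma completed_gen_dense t x : 0 < t -> D x ->
  right_gen E (E t (j x)) (S t (j x)).
Proof.
move=> t0 Dx e e0; have M0 := an_M0 hT.
rewrite Ej ?(ltW t0) // Sj //.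
set z := T t x; have Dz : dom G z by exact: (an_dom hT).
have Rz : D z by exact: range_T (ltW t0) Dx.
have Rw : D (G z) by exists z.
pose f h := h^-1 *: (T h z - z) - G z.
have Rf h : 0 < h -> D (f h).
  move=> h0; apply: range_sub => //; apply: range_scale; apply: range_sub => //.
  by apply: range_T => //; exact: ltW.
have Tf h r : 0 < h -> 0 < r -> T r (f h) = h^-1 *: (T h (T r z) - T r z) - G (T r z).
  move=> h0 r0; have br := an_bopT hT (ltW r0).
  rewrite (orbitC z (ltW h0) (ltW r0)) /f (bopB br) (bopZ br) (bopB br).
  by have [_ ->] := an_comm hT (ltW r0) Dz.
have gr r : 0 < r -> right_gen T (T r z) (G (T r z)).
  by move=> r0; apply/(an_gen hT); split => //; case: (an_comm hT (ltW r0) Dz).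
have fdom h r : 0 < h -> 0 < r -> `|T r (f h)| <= (M + 1) * `|T r (G z)|.
  move=> h0 r0; rewrite Tf //.
  have -> : T r (G z) = G (T r z) by have [_ ->] := an_comm hT (ltW r0) Dz.
  set g := G (T r z).
  have mv : `|T h (T r z) - T r z| <= M * `|g| * h.
    have := @mean_value R X (flow T (T r z)) (fun u => T u g) 0 h (M * `|g|) (ltW h0)
      (flow_continuous (an_sg hT)).
    rewrite !flowE ?(ltW h0) // (an_T0 hT) subr0; apply => u /andP[u0 _].
      by apply: (flow_vderiv (an_sg hT)) u0; exact: gr.
    by apply: (an_TM hT); exact: ltW.
  rewrite (le_trans (ler_normB _ _)) // mulrDl mul1r lerD2r normrZ.
  by rewrite normrV ?unitfE ?gt_eqF // gtr0_norm // mulrC ler_pdivrMr.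
have fcvg r : 0 < r -> T r (f h) @[h --> 0^'+] --> (0 : X).
  move=> r0; have /right_genP := gr r r0 => cg.
  have : (h^-1 *: (T h (T r z) - T r z)) - G (T r z) @[h --> 0^'+] --> (0 : X).
    by rewrite -[X in _ --> X](subrr (G (T r z))); apply: cvgB; [exact: cg|exact: cvg_cst].
  apply: cvg_trans; apply: near_eq_cvg; near=> h.
  have h0 : 0 < h by near: h; exact: nbhs_right_gt.
  by rewrite Tf.
have [a a0 ha] := @jcvg0 f (G z) (M + 1) (addr_ge0 M0 ler01) Rw Rf fdom fcvg e e0.
exists a => // h hh; have h0 : 0 < h by case/andP: hh.
rewrite -[leRHS](gtr0_norm (mulr_gt0 e0 h0)) normrM (gtr0_norm e0).
have Th : D (T h z) by apply: range_T => //; exact: ltW.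
rewrite Ej ?(ltW h0) // -quot_dist ?gt_eqF // distrC.
have Rd := range_sub Th Rz.
rewrite -(jsub Th Rz) -(jscale _ Rd) -(jsub (range_scale _ Rd) Rw); exact: ha.
Unshelve. all: by end_near. Qed.

(** Approximation by elements of the range. By [right_gen_quantitative] the
    admissible [h] can be taken from the continuity of the orbit of [S t y]
    alone, the same for all approximations, so that the approximation error
    can be sent to zero for fixed [h]. *)
Lemma completed_gen t y : 0 < t -> right_gen E (E t y) (S t y).
Proof.
move=> t0 e e0; have bsE := completed_semigroup; have M0 := an_M0 hT.
have C0 := an_C0 hT.
have e2 : 0 < e / 2 by rewrite divr_gt0.
have [a a0 ha] := right_cont_modulus (S t y) bsE e2.
exists a => // h /andP[h0 hha]; apply/ler_addgt0Pl => d d0.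
have Ct0 : 0 <= C / t by rewrite divr_ge0 // ltW.
(* [c] bounds the difference quotient remainder of the error [v = y - j x],
   and [b] bounds the variation of the orbit of [S t v]. *)
pose c := M * M + M + h * (C / t).
have c0 : 0 <= c by rewrite /c !addr_ge0 // mulr_ge0 // ltW.
pose b := (M + 1) * (C / t).
have b0 : 0 <= b by rewrite mulr_ge0 // addr_ge0.
have c1 : 0 < c + 1 by rewrite ltr_wpDl.
have b1 : 0 < b + 1 by rewrite ltr_wpDl.
have dl0 : 0 < Num.min (d / (c + 1)) (e / 2 / (b + 1)).
  by rewrite lt_min !divr_gt0.
have [x Dx] := dense_approx y jdense dl0; rewrite lt_min => /andP[].
set v := y - j x => v1 v2.
have bt := bE (ltW t0); have bh := bE (ltW h0); have st := bS t0.
have vc : c * `|v| <= d.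
  have : d / (c + 1) * (c + 1) = d by rewrite divfK // gt_eqF.
  move: v1; move: (d / (c + 1)) (normr_ge0 v) => d' ? ? ?; nra.
have vb : b * `|v| <= e / 2.
  have : e / 2 / (b + 1) * (b + 1) = e / 2 by rewrite divfK // gt_eqF.
  move: v2; move: (e / 2 / (b + 1)) (normr_ge0 v) => d' ? ? ?; nra.
have Ex : `|E h (E t (j x)) - E t (j x) - h *: S t (j x)| <= e * h.
  apply: (right_gen_quantitative bsE (completed_gen_dense t0 Dx) h0) => r /andP[r0 rh].
  have br := bE (ltW r0).
  have -> : E r (S t (j x)) - S t (j x) = (E r (S t y) - S t y) - (E r (S t v) - S t v).
    by apply: eq_dual => l bl; rewrite /v (bopB st) (bopB br) !(bopB bl); ring.
  have h1 : `|E r (S t y) - S t y| <= e / 2 by apply: ha; rewrite (ltW r0) (lt_trans rh).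
  have h2 : `|E r (S t v) - S t v| <= b * `|v|.
    rewrite (le_trans (ler_normB _ _)) // /b -mulrA mulrDl mul1r lerD ?SC //.
    by rewrite (le_trans (EM _ (ltW r0))) // ler_wpM2l // SC.
  rewrite (le_trans (ler_normB _ _)) //; lra.
have -> : E h (E t y) - E t y - h *: S t y =
    (E h (E t (j x)) - E t (j x) - h *: S t (j x)) +
    (E h (E t v) - E t v - h *: S t v).
  by apply: eq_dual => l bl; rewrite /v (bopB bt) (bopB bh) (bopB st)
    !(bopB bl, bopD bl, bopN bl, bopZ bl); ring.
have h3 : `|E h (E t v) - E t v - h *: S t v| <= c * `|v|.
  rewrite (le_trans (ler_normB _ _)) // /c mulrDl lerD //; last first.
    by rewrite normrZ gtr0_norm // -mulrA ler_wpM2l ?SC // ltW.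
  rewrite (le_trans (ler_normB _ _)) // mulrDl lerD ?EM ?(ltW t0) //.
  by rewrite (le_trans (EM _ (ltW h0))) // -mulrA ler_wpM2l // EM // ltW.
rewrite (le_trans (ler_normD _ _)) // addrC lerD //.
exact: le_trans h3 vc.
Qed.

Lemma completed_smeas y : smeas (cut (`]0%R, +oo[%classic : set R) (fun t => S t y)).
Proof.
apply: smeas_right => // t /=; rewrite in_itv /= andbT => t0.
have t2 : 0 < t / 2 by rewrite divr_gt0.
have bsE := completed_semigroup.
have SEt s : t / 2 < s -> S s y = flow E (S (t / 2) y) (s - t / 2).
  by move=> ts; rewrite flowE ?subr_ge0 ?(ltW ts) // -completed_SE ?subr_ge0 ?(ltW ts) // subrK.
have tt : t / 2 < t by lra.
rewrite SEt //.
have c1 : (fun s => flow E (S (t / 2) y) (s - t / 2)) s @[s --> t] -->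
    flow E (S (t / 2) y) (t - t / 2).
  apply: (@continuous_comp R R Y (fun s : R => s - t / 2) (flow E (S (t / 2) y)) t).
    by apply: cvgB; [exact: cvg_id|exact: cvg_cst].
  exact: (flow_continuous bsE).
apply: cvg_trans (cvg_at_right_filter c1); apply: near_eq_cvg.
near=> s; rewrite -SEt //; apply: lt_trans tt _; near: s; exact: nbhs_right_gt.
Unshelve. all: by end_near. Qed.

(** [bnorm_gen_integral] on the dense range, and Fatou's lemma for the rest. *)
Lemma completed_int y :
  (L1n (cut (`]0%R, +oo[%classic : set R) (fun t => S t y)) <=
    ((M / p + M) * (4 * C / (1 - p)) * `|y|)%:E)%E.
Proof.
set K := (M / p + M) * (4 * C / (1 - p)).
have [p0 p1] := andP p01.
have K0 : 0 <= K.
  by rewrite /K mulr_ge0 // ?addr_ge0 ?divr_ge0 ?mulr_ge0 ?(an_M0 hT) ?(an_C0 hT) ?subr_ge0 // ltW.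
have inv0 n : (0 : R) < n.+1%:R^-1 by rewrite invr_gt0.
have K1 : 0 < K + 1 by rewrite ltr_wpDl.
apply/lee_addgt0Pr => e e0; rewrite -EFinD.
have /choice[x hx] : forall n : nat, exists x, D x /\
    (`|y - j x| < n.+1%:R^-1 /\ `|y - j x| < e / (K + 1)).
  move=> n; have m0 : 0 < Num.min n.+1%:R^-1 (e / (K + 1)).
    by rewrite lt_min inv0 divr_gt0.
  have [x Dx] := dense_approx y jdense m0; rewrite lt_min => /andP[h1 h2].
  by exists x.
have xy : j (x n) @[n --> \oo] --> y.
  apply/cvgrPdist_lt => d d0; near=> n; have [_ [h _]] := hx n.
  by apply: lt_trans h _; near: n; exact: (near_infty_natSinv_lt (PosNum d0)).
apply: (@L1n_lim_le R Y _ (fun n => cut (`]0%R, +oo[%classic : set R) (fun t => S t (j (x n))))).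
- by move=> n; exact: completed_smeas.
- move=> t; rewrite cutP; case: (boolP (0 < t)) => [t0|t0].
    rewrite (_ : (fun n => _) = (fun n => S t (j (x n)))); last first.
      by apply/funext => n; rewrite cutP t0.
    by apply: (cvg_comp _ _ xy); exact: (bop_continuous (bS t0)).
  rewrite (_ : (fun n => _) = (fun n => 0)); last first.
    by apply/funext => n; rewrite cutP (negbTE t0).
  exact: cvg_cst.
- move=> n; have [Dx [_ h]] := hx n.
  apply: (@le_trans _ _ (K%:E * bnorm T p (x n))%E).
    apply: le_trans (bnorm_gen_integral hT p01 (x n)).
    rewrite le_eqVlt; apply/orP; left; apply/eqP; apply: eq_integral => t _.
    rewrite cutP; case: ifP => t0; last by rewrite normr0.
    by rewrite Sj // jnorm //; exact: range_GT.
  rewrite -jnorm // -EFinM lee_fin.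
  have : `|j (x n)| <= `|y| + `|y - j (x n)|.
    by rewrite -[X in `|X| <= _](subKr y) (le_trans (ler_normB _ _)).
  have : e / (K + 1) * (K + 1) = e by rewrite divfK // gt_eqF.
  move: h; move: (e / (K + 1)) (`|y - j _|) (normr_ge0 (y - j (x n))) => d a.
  move: `|j _| => b; move: `|y| => c.
  by move=> ? ? ? ?; nra.
Unshelve. all: by end_near. Qed.

Lemma completed_smoothing :
  smoothing M ((M / p + M) * (4 * C / (1 - p))) E S.
Proof.
have [p0 p1] := andP p01.
split.
- exact: completed_semigroup.
- exact: an_M0 hT.
- by rewrite mulr_ge0 // ?addr_ge0 ?divr_ge0 ?mulr_ge0 ?(an_M0 hT) ?(an_C0 hT) ?subr_ge0 // ltW.
- by move=> t; exact: bS.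
- by move=> s t y; exact: completed_SE.
- move=> s t y s0 t0.
  apply: (bop_eq_dense jdense (bS (ltr_wpDl s0 t0)) (bop_comp (bS t0) (bE s0))) => x Dx.
  rewrite /= (Ej s0 Dx) (Sj (ltr_wpDl s0 t0) Dx) (Sj t0 (range_T s0 Dx)).
  by rewrite addrC (an_TD hT) // ltW.
- by move=> t y; exact: completed_gen.
- exact: completed_smeas.
- exact: completed_int.
Qed.

(** A pair of the smooth graph is approximated by its image under [E t] with
    small [t], and that image by an element coming from the range. Conversely,
    elements of the range satisfy the defining relation, which is closed. *)
Lemma smooth_graph_closure x y : smooth_graph E S x y <->
  closure [set (j u, j (G u)) | u in dom G `&` op_range G] (x, y).
Proof.
have M0 := an_M0 hT; have C0 := an_C0 hT; have bsE := completed_semigroup.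
rewrite closure_pairP; split=> [xy e e0|h e e0].
  have e2 : 0 < e / 2 by rewrite divr_gt0.
  have [a a0 ha] := right_cont_modulus x bsE e2.
  have [b b0 hb] := right_cont_modulus y bsE e2.
  pose t := Num.min (a / 2) (b / 2).
  have t0 : 0 < t by rewrite lt_min !divr_gt0.
  have ta : t < a by rewrite /t gt_min ltr_pdivrMr // ltr_pMr // ltr1n.
  have tb : t < b by rewrite /t gt_min orbC ltr_pdivrMr // ltr_pMr // ltr1n.
  have Ct0 : 0 <= C / t by rewrite divr_ge0 // ltW.
  have c1 : 0 < M + C / t + 1 by rewrite ltr_wpDl // addr_ge0.
  have [v Dv xv] := dense_approx x jdense (divr_gt0 e2 c1).
  have Rv := range_T (ltW t0) Dv.
  exists (j (T t v)), (j (G (T t v))); split.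
  - by exists (T t v) => //; split => //; exact: (an_dom hT).
  - have h1 : `|x - E t x| <= e / 2 by rewrite distrC; apply: ha; rewrite (ltW t0).
    have h2 : `|E t x - j (T t v)| <= M * `|x - j v|.
      by rewrite -Ej ?(ltW t0) // -(bopB (bE (ltW t0))) EM // ltW.
    rewrite -[x](subrK (E t x)) -addrA (le_lt_trans (ler_normD _ _)) //.
    have : e / 2 / (M + C / t + 1) * (M + C / t + 1) = e / 2 by rewrite divfK // gt_eqF.
    move: xv h2 Ct0; move: `|x - j v| (normr_ge0 (x - j v)) (C / t) (e / 2 / _) => f f0 g d.
    by move=> ? ? ? ?; nra.
  - have h1 : `|y - E t y| <= e / 2 by rewrite distrC; apply: hb; rewrite (ltW t0).
    have h2 : `|E t y - j (G (T t v))| <= C / t * `|x - j v|.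
      by rewrite -xy // -Sj // -(bopB (bS t0)) SC.
    rewrite -[y](subrK (E t y)) -addrA (le_lt_trans (ler_normD _ _)) //.
    have : e / 2 / (M + C / t + 1) * (M + C / t + 1) = e / 2 by rewrite divfK // gt_eqF.
    move: xv h2 Ct0; move: `|x - j v| (normr_ge0 (x - j v)) (C / t) (e / 2 / _) => f f0 g d.
    by move=> ? ? ? ?; nra.
have be := bE (ltW e0); have se := bS e0.
have Ce0 : 0 <= C / e by rewrite divr_ge0 // ltW.
have c1 : 0 < M + C / e + 1 by rewrite ltr_wpDl // addr_ge0.
apply/eqP; rewrite -subr_eq0 -normr_le0; apply/ler_addgt0Pl => d d0; rewrite addr0.
have [_ [_ [[u [Du Ru] [<- <-]] xu yu]]] := h _ (divr_gt0 d0 c1).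
have eqj : S e (j u) = E e (j (G u)).
  rewrite Sj // Ej ?(ltW e0) //; last by exists u.
  by have [_ ->] := an_comm hT (ltW e0) Du.
have -> : S e x - E e y = S e (x - j u) - E e (y - j (G u)).
  by rewrite (bopB be) (bopB se) eqj opprB addrA subrK.
rewrite (le_trans (ler_normB _ _)) //.
have h1 := SC (x - j u) e0; have h2 := EM (y - j (G u)) (ltW e0).
have dE : d / (M + C / e + 1) * (M + C / e + 1) = d by rewrite divfK // gt_eqF.
move: xu yu dE; set q := d / _ => xu yu dE.
have h3 : C / e * `|x - j u| <= C / e * q by rewrite ler_wpM2l // ltW.
have h4 : M * `|y - j (G u)| <= M * q by rewrite ler_wpM2l // ltW.
have q0 : 0 < q by rewrite divr_gt0.
move: h1 h2 h3 h4 dE; move: (C / e) => g; lra.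
Qed.

End completed_semigroup.

(** * Convolution *)

Section convolution_tools.
Context {R : realType}.
Local Notation mu := (@lebesgue_measure R).

Lemma lebesgue_measure_shift (r : R) (A : set R) : measurable A ->
  mu A = pushforward mu (fun t : R => t - r) A.
Proof.
move=> mA; pose ph (t : measurableTypeR R) : measurableTypeR R := t - r.
have mph : measurable_fun setT ph.
  by apply: measurable_funB; [exact: measurable_id|exact: measurable_cst].
apply: (@lebesgue_measure_unique R (pushforward mu ph)) => // _ [[a b] _ <-].
change (mu `]a, b] = mu (ph @^-1` `]a, b]%classic)).
rewrite (_ : ph @^-1` _ = `]a + r, b + r]%classic); last first.
  by apply/seteqP; split => t; rewrite /ph /= !in_itv /= ltrBrDr lerBlDr.
by rewrite !lebesgue_measure_itv /= !lte_fin ltrD2r; case: ifP => // _; rewrite -!EFinB; congr EFin; ring.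
Qed.

Lemma integral_shift (f : R -> R) (r : R) : measurable_fun setT f ->
  (forall t, 0 <= f t) ->
  (\int[mu]_t (f (t - r))%:E = \int[mu]_t (f t)%:E)%E.
Proof.
move=> mf f0; pose ph (t : measurableTypeR R) : measurableTypeR R := t - r.
have mph : measurable_fun setT ph.
  by apply: measurable_funB; [exact: measurable_id|exact: measurable_cst].
have <- : (\int[pushforward mu ph]_t (f t)%:E = \int[mu]_t (f t)%:E)%E.
  apply: eq_measure_integral => A mA _ /=; symmetry; exact: lebesgue_measure_shift.
rewrite ge0_integral_pushforward ?preimage_setT //.
  by apply/measurable_EFinP.
by move=> t _; rewrite lee_fin.
Qed.

Lemma Rintegral_fin (g : R -> R) : mu.-integrable setT (EFin \o g) ->
  ((\int[mu]_t g t)%:E = \int[mu]_t (g t)%:E)%E.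
Proof. by move=> ig; rewrite /Rintegral fineK //; exact: integrable_fin_num. Qed.

Lemma integral_scaled (g : R -> R) (c : R) : mu.-integrable setT (EFin \o g) ->
  (\int[mu]_t (c * g t)%:E = (c * \int[mu]_t g t)%:E)%E.
Proof.
move=> ig; rewrite EFinM (Rintegral_fin ig).
by under eq_integral do rewrite EFinM; rewrite integralZl.
Qed.

Lemma window_integrable (E : set R) (m : R -> R) (c : R) : measurable E ->
  (mu E < +oo)%E -> measurable_fun setT m -> (forall t, `|m t| <= c) ->
  mu.-integrable setT (EFin \o (fun r => \1_E r * m r)).
Proof.
move=> mE Efin mm mc.
apply: (@le_integrable _ _ _ mu setT _ _ (fun r => c%:E * (\1_E r)%:E)%E) => //.
- by apply/measurable_EFinP; apply: measurable_funM => //; exact: measurable_indic.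
- have c0 : 0 <= c := le_trans (normr_ge0 _) (mc 0).
  move=> t _; change (`|(\1_E t * m t)%:E| <= `|(c * \1_E t)%:E|)%E.
  rewrite /= lee_fin normrM ger0_norm ?indicE // mulrC.
  by rewrite [leRHS]ger0_norm ?mulr_ge0 // ler_wpM2r.
- by apply: integrableZl => //; exact: integrable_indic_lty.
Qed.

(** All integrals converge absolutely, as [phi] is supported in a bounded
    interval and [E] has finite measure. *)
Lemma window_fubini (E : set R) (m phi : R -> R) (a b N c : R) :
  measurable E -> (mu E < +oo)%E ->
  measurable_fun setT m -> (forall t, `|m t| <= c) ->
  measurable_fun setT phi -> (forall t, `|phi t| <= N) ->
  (forall t, ~~ (a <= t <= b) -> phi t = 0) ->
  [/\ mu.-integrable setT (EFin \o (fun t => phi t * \int[mu]_r (\1_E r * m (t - r)))),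
      mu.-integrable setT (EFin \o (fun r => \1_E r * \int[mu]_t (phi t * m (t - r)))) &
      \int[mu]_t (phi t * \int[mu]_r (\1_E r * m (t - r))) =
      \int[mu]_r (\1_E r * \int[mu]_t (phi t * m (t - r)))].
Proof.
move=> mE Efin mm mc mphi phiN phi0.
have c0 : 0 <= c := le_trans (normr_ge0 _) (mc 0).
have N0 : 0 <= N := le_trans (normr_ge0 _) (phiN 0).
have mE1 : measurable_fun setT (\1_E : R -> R) by exact: measurable_indic.
pose f (z : R * R) := (phi z.1 * (\1_E z.2 * m (z.1 - z.2)))%:E.
have mB : measurable_fun setT (fun z : R * R => z.1 - z.2).
  by apply: measurable_funB; [exact: measurable_fst|exact: measurable_snd].
have mf : measurable_fun setT f.
  apply/measurable_EFinP; apply: measurable_funM.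
    by apply: (measurableT_comp mphi); exact: measurable_fst.
  apply: measurable_funM.
    by apply: (measurableT_comp mE1); exact: measurable_snd.
  exact: (measurableT_comp mm mB).
have mI : measurable (`[a, b]%classic : set R) by exact: measurable_itv.
have Ifin : (mu (`[a, b]%classic : set R) < +oo)%E.
  by rewrite lebesgue_measure_itv /=; case: ifP => _; rewrite ?ltry.
have mt (t : R) : measurable_fun setT (fun r : R => m (t - r)).
  by apply: (measurableT_comp mm); apply: measurable_funB;
    [exact: measurable_cst|exact: measurable_id].
have mr (r : R) : measurable_fun setT (fun t : R => m (t - r)).
  by apply: (measurableT_comp mm); apply: measurable_funB;
    [exact: measurable_id|exact: measurable_cst].
have mfr (r : R) : measurable_fun setT (fun t : R => f (t, r)).
  apply/measurable_EFinP; apply: measurable_funM => //=.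
  by apply: measurable_funM; [exact: measurable_cst|exact: mr].
have it (t : R) : mu.-integrable setT (EFin \o (fun r => \1_E r * m (t - r))).
  by apply: (@window_integrable E (fun r => m (t - r)) c).
have phiE : phi = (fun t => \1_(`[a, b]%classic : set R) t * phi t).
  apply/funext => t; rewrite indicE; case: (boolP (t \in _)) => [|ti]; rewrite ?mul1r ?mul0r //.
  by apply: phi0; move: ti; apply: contra; rewrite inE /= in_itv.
have ir (r : R) : mu.-integrable setT (EFin \o (fun t => phi t * m (t - r))).
  rewrite phiE (_ : (fun t => _) = (fun t => \1_(`[a, b]%classic : set R) t * (phi t * m (t - r)))); last first.
    by apply/funext => t; rewrite mulrA.
  apply: (@window_integrable _ (fun t => phi t * m (t - r)) (N * c)) => //.
    exact: measurable_funM.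
  by move=> t; rewrite normrM ler_pM.
have fi : (mu \x mu)%E.-integrable setT f.
  apply/integrable12ltyP => //.
  apply: (@le_lt_trans _ _ (\int[mu]_t ((N * c)%:E * mu E * (\1_(`[a, b]%classic : set R) t)%:E))%E).
    apply: ge0_le_integral => //.
    - by move=> t _; apply: integral_ge0.
    - apply: (@measurable_fun_fubini_tonelli_F _ _ _ _ R mu (abse \o f)) => //=.
      exact: measurableT_comp.
    - apply: measurable_funeM; apply/measurable_EFinP; exact: measurable_indic.
    move=> t _; rewrite /f /=.
    have -> : ((N * c)%:E * mu E * (\1_(`[a, b]%classic : set R) t)%:E =
       \int[mu]_r (((N * c * \1_(`[a, b]%classic : set R) t)%:E * (\1_E r)%:E)))%E.
      rewrite ge0_integralZl_EFin ?mulr_ge0 // ?indicE //; last first.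
        by apply/measurable_EFinP.
      by rewrite integral_indicT // EFinM muleAC.
    apply: ge0_le_integral => //.
    - apply/measurable_EFinP; apply: measurableT_comp => //; apply: measurable_funM => //.
      by apply: (measurable_funM mE1); exact: mt.
    - by apply: measurable_funeM; apply/measurable_EFinP.
    move=> r _; change ((`|phi t * (\1_E r * m (t - r))|)%:E <=
      (N * c * \1_(`[a, b]%classic : set R) t * \1_E r)%:E)%E.
    rewrite lee_fin {1}phiE !normrM.
    rewrite ![`|\1__ _|]ger0_norm ?indicE //.
    rewrite [leRHS](_ : _ = ((t \in `[a, b]%classic)%:R * N) * ((r \in E)%:R * c)); last by ring.
    by rewrite ler_pM ?mulr_ge0 ?ler_wpM2l.
  rewrite ge0_integralZl //; first last.
  - by rewrite mule_ge0 // lee_fin mulr_ge0.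
  - by apply/measurable_EFinP; exact: measurable_indic.
  have mlt (x y : \bar R) : (0 <= x < +oo)%E -> (0 <= y < +oo)%E -> (x * y < +oo)%E.
    by move=> /andP[x0 x1] /andP[y0 y1]; apply: lte_mul_pinfty => //; rewrite ge0_fin_numE.
  by rewrite integral_indicT // !mlt // ?measure_ge0 // ?mule_ge0 ?lee_fin ?mulr_ge0 ?ltry // mlt ?measure_ge0 // lee_fin mulr_ge0 // ltry.
have hF (t : R) : (fubini_F mu f t = (phi t * \int[mu]_r (\1_E r * m (t - r)))%:E)%E.
  by rewrite /fubini_F /f /= integral_scaled.
have hG (r : R) : (fubini_G mu f r = (\1_E r * \int[mu]_t (phi t * m (t - r)))%:E)%E.
  rewrite /fubini_G /f /= -integral_scaled //.
  by apply: eq_integral => t _; congr EFin; ring.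
split.
- rewrite (_ : EFin \o _ = fubini_F mu f); last by apply/funext => t; rewrite hF.
  exact: integrable_fubini_F.
- rewrite (_ : EFin \o _ = fubini_G mu f); last by apply/funext => t; rewrite hG.
  have mG := measurable_fubini_G fi.
  apply/integrableP; split => //.
  have fi2 : (\int[mu]_y \int[mu]_x `|f (x, y)| < +oo)%E.
    exact/(integrable21ltyP mu mu mf).
  refine (le_lt_trans _ fi2).
  apply: ge0_le_integral => //.
  - exact: measurableT_comp.
  - apply: (@measurable_fun_fubini_tonelli_G _ _ _ _ R mu (abse \o f)) => //=.
    exact: measurableT_comp.
  move=> r _; apply: le_abse_integral => //.
  exact: mfr.
rewrite /Rintegral; congr fine.
transitivity (\int[mu]_t fubini_F mu f t)%E; first by apply: eq_integral => t _; rewrite hF.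
transitivity (\int[mu]_t fubini_G mu f t)%E; first exact: Fubini.
by apply: eq_integral => r _; exact: hG.
Qed.

Lemma L1n_fine_le {V W : normedModType R} (f : R -> V) (g : R -> W) : smeas f -> L1 g ->
  (forall t, `|f t| <= `|g t|) -> fine (L1n f) <= fine (L1n g).
Proof.
move=> sf Lg fg; have [sg _] := Lg; have Lf := L1_le sf Lg fg.
rewrite -lee_fin -(L1n_fin Lf) -(L1n_fin Lg); exact: L1n_le.
Qed.

Lemma pettis_integral {V : completeNormedModType R} (f : R -> V) : L1 f ->
  exists I, forall l : V -> R^o, bop l -> (l I : R) = \int[mu]_t (l (f t) : R).
Proof.
move=> fL.
have cT : cut setT f = f by apply/funext => t; rewrite /cut in_setT.
have L : L1 (cut setT f) by rewrite cT.
have [I hI] := bochner_ex measurableT L; exists I => l bl.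
by rewrite (pettis_int measurableT bl L hI) cT.
Qed.

Lemma pettis_norm {V : normedModType R} (f : R -> V) (I : V) : L1 f ->
  (forall l : V -> R^o, bop l -> (l I : R) = \int[mu]_t (l (f t) : R)) ->
  `|I| <= fine (L1n f).
Proof.
move=> fL hI; apply: norm_le_dual => l bl l1.
by rewrite hI // (le_trans (ler_norm _)) // dual_int_le.
Qed.

(** Uniform convergence of the functions and L1 convergence of the derivatives
    suffice to pass to the limit in both scalar integrals. *)
Lemma dual_derivative_lim {V : normedModType R} (u v : R -> V)
    (U W : nat -> R -> V) (d : nat -> R) :
  continuous u -> (forall n, continuous (U n)) -> L1 v -> (forall n, L1 (W n)) ->
  (forall n t, `|u t - U n t| <= d n) -> d n @[n --> \oo] --> (0 : R) ->
  L1n (fun t => v t - W n t) @[n --> \oo] --> 0%E ->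
  (forall n, dual_derivative +oo%E (U n) (W n)) -> dual_derivative +oo%E u v.
Proof.
move=> cu cU Lv LW ud d0 vW hU phi tphi l bl.
have [a [b [N [/andP[a0 ab] bT [cphi cd] phi0 phiN]]]] := test_functionE (ltry 0) tphi.
have [C C0 hC] := bop_bound bl.
have N0 : 0 <= N := le_trans (normr_ge0 _) (phiN 0).1.
have Lphi (w : R -> V) : continuous w -> L1 (fun t => derive1 phi t *: cut (open_time +oo) w t).
  move=> cw; apply: (@L1_test_cut R V +oo%E (derive1 phi) a b N w) => //.
  - exact: continuous_subspaceT.
  - by move=> t /phi0[].
have Lpsi (w : R -> V) : L1 w -> L1 (fun t => phi t *: w t).
  by move=> Lw; apply: (@L1_test R V phi N) => // t; case: (phiN t).
have lZ (k : R) (w : V) : k * l w = l (k *: w) by rewrite (bopZ bl).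
have il (w : R -> V) : L1 w -> mu.-integrable setT (EFin \o (fun t => l (w t) : R)).
  by move=> Lw; exact: dual_integrable.
have E1 (w : R -> V) : \int[mu]_t (derive1 phi t * l (cut (open_time +oo) w t) : R) =
   \int[mu]_t (l (derive1 phi t *: cut (open_time +oo) w t) : R).
  by apply: eq_Rintegral => t _; rewrite lZ.
have E2 (w : R -> V) : \int[mu]_t (phi t * l (w t) : R) = \int[mu]_t (l (phi t *: w t) : R).
  by apply: eq_Rintegral => t _; rewrite lZ.
have dint (w : R -> V) : L1 w -> `|\int[mu]_t (l (w t) : R)| <= C * fine (L1n w).
  move=> Lw; have [sw _] := Lw; have Llw := L1_comp bl Lw.
  have bi := @bop_id _ (R^o : normedModType R).
  apply: le_trans (dual_int_le bi (fun=> lexx _) Llw) _.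
  have -> : C * fine (L1n w) = fine (L1n (fun t => C *: w t)).
    by rewrite L1nZ // (L1n_fin Lw) -EFinM /= gtr0_norm.
  have LC : L1 (fun t => C *: w t).
    by split; [apply: smeas_comp sw => y; exact: scaler_continuous|
      rewrite L1nZ // (L1n_fin Lw) -EFinM ltry].
  have [sl _] := Llw; apply: L1n_fine_le => // t.
  by rewrite normrZ gtr0_norm //; exact: hC.
set k0 := fine (L1n (cut `[a, b]%classic (fun=> N : R^o))).
set tot1 := \int[mu]_t _; set tot2 := \int[mu]_t _.
have bnd n : `|tot1 + tot2| <= C * (`|d n| * k0 + N * fine (L1n (fun t => v t - W n t))).
  have LuU : continuous (fun t => u t - U n t).
    by move=> t; apply: cvgB; [exact: cu|exact: cU].
  have LvW := L1B Lv (LW n).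
  have := hU n phi tphi l bl => /eqP; rewrite -addr_eq0 => /eqP h0.
  have -> : tot1 + tot2 =
     \int[mu]_t (l (derive1 phi t *: cut (open_time +oo) (fun t => u t - U n t) t) : R) +
     \int[mu]_t (l (phi t *: (v t - W n t)) : R).
    rewrite -[tot1 + tot2]subr0 -h0 /tot1 /tot2 !E1 !E2 opprD addrACA.
    rewrite -!RintegralB //; try (by apply: il; auto).
    congr (_ + _); apply: eq_Rintegral => t _; rewrite -(bopB bl) -scalerBr //.
    by rewrite /cut; case: ifP => //; rewrite subrr.
  rewrite (le_trans (ler_normD _ _)) // mulrDr lerD //.
    have L2 := Lphi _ LuU.
    have Lk := @L1_cst_itv R (R^o : normedModType R) a b N.
    have [sk _] := Lk.
    apply: le_trans (dint _ L2) _; rewrite ler_wpM2l ?(ltW C0) //.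
    have -> : `|d n| * k0 = fine (L1n (fun t => d n *: cut `[a, b]%classic (fun=> N : R^o) t)).
      by rewrite L1nZ // (L1n_fin Lk) -EFinM.
    have LC : L1 (fun t => d n *: cut `[a, b]%classic (fun=> N : R^o) t).
      split; [apply: smeas_comp sk => y; exact: scaler_continuous|].
      by rewrite L1nZ // (L1n_fin Lk) -EFinM ltry.
    have [s2 _] := L2; apply: L1n_fine_le => // t.
    rewrite !normrZ /cut; case: (boolP (a < t < b)) => [tab|/phi0[_ ->]]; last first.
      by rewrite normr0 mul0r mulr_ge0.
    have tI : t \in (`[a, b]%classic : set R).
      by rewrite inE /= in_itv /=; case/andP: tab => /ltW -> /ltW ->.
    rewrite tI mulrC ler_pM //; last by rewrite (ger0_norm N0); case: (phiN t).
    case: ifP => _; last by rewrite normr0.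
    by rewrite (le_trans (ud n t)) // ler_norm.
  have L2 := Lpsi _ LvW.
  apply: le_trans (dint _ L2) _; rewrite ler_wpM2l ?(ltW C0) //.
  have [sv _] := LvW.
  have -> : N * fine (L1n (fun t => v t - W n t)) = fine (L1n (fun t => N *: (v t - W n t))).
    by rewrite L1nZ // (L1n_fin LvW) -EFinM /= ger0_norm.
  have LC : L1 (fun t => N *: (v t - W n t)).
    split; [apply: smeas_comp sv => y; exact: scaler_continuous|].
    by rewrite L1nZ // (L1n_fin LvW) -EFinM ltry.
  have [s2 _] := L2; apply: L1n_fine_le => // t.
  by rewrite !normrZ ler_wpM2r // (ger0_norm N0); case: (phiN t).
have lim0 : C * (`|d n| * k0 + N * fine (L1n (fun t => v t - W n t))) @[n --> \oo] --> (0 : R).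
  rewrite -[X in _ --> X](mulr0 C); apply: cvgMr.
  rewrite -[X in _ --> X](addr0 (0 : R)); apply: cvgD.
    rewrite -[X in _ --> X](mul0r k0); apply: cvgMl.
    by rewrite -[X in _ --> X](@normr0 _ R); apply: cvg_norm.
  rewrite -[X in _ --> X](mulr0 N); apply: cvgMr.
  by have /fine_cvgP[] := vW.
apply/eqP; rewrite -addr_eq0 -normr_le0.
by apply: (cvgr_to_ge lim0); apply: nearW.
Qed.

End convolution_tools.

(** * Solutions for a forcing constant on a window *)

Section integration_lemmas.
Context {R : realType}.
Local Notation mu := (@lebesgue_measure R).

Lemma Rintegral_supp (D : set R) (f g : R -> R) : (forall t, D t -> f t = g t) ->
  (forall t, ~ D t -> f t = 0) -> \int[mu]_t f t = \int[mu]_(t in D) g t.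
Proof.
move=> fg f0; rewrite /Rintegral [in RHS]integral_mkcond; congr fine.
apply: eq_integral => t _; rewrite patchE.
case: (boolP (t \in D)) => [/set_mem tD|/negP tD]; first by rewrite fg.
by rewrite f0 // => /mem_set.
Qed.

Lemma L1n_indic {V : normedModType R} (F : set R) (y : V) : measurable F ->
  (mu F < +oo)%E -> L1n (fun r => (\1_F r : R) *: y) = (fine (mu F) * `|y|)%:E.
Proof.
move=> mF Ff; rewrite /L1n EFinM fineK; last by rewrite ge0_fin_numE.
rewrite -(integral_indicT mF) muleC -ge0_integralZl_EFin //.
  by apply: eq_integral => t _; rewrite normrZ ger0_norm ?indicE // -EFinM mulrC.
by apply/measurable_EFinP; exact: measurable_indic.
Qed.

Lemma L1_indic {V : normedModType R} (F : set R) (y : V) : measurable F ->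
  (mu F < +oo)%E -> L1 (fun r => (\1_F r : R) *: y).
Proof.
move=> mF Ff; split; last by rewrite L1n_indic // ltry.
apply: smeasZ; first exact: (smeas_simple (simple_indic mF)).
exact: (smeas_simple (simple_cst y)).
Qed.

Lemma vderiv_shift {V : normedModType R} (f : R -> V) (a t : R) d :
  vderiv f (t - a) d -> vderiv (fun s => f (s - a)) t d.
Proof.
move=> fd e e0; have [c c0 hc] := fd e e0; exists c => // h /hc.
by rewrite [t - a + h]addrAC.
Qed.

Lemma continuous_shift {V : normedModType R} (f : R -> V) (a : R) :
  continuous f -> continuous (fun s => f (s - a)).
Proof.
move=> cf t; apply: (@continuous_comp R R V (fun s : R => s - a) f t); last exact: cf.
by apply: cvgB; [exact: cvg_id|exact: cvg_cst].
Qed.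

Lemma Rintegral_oppD (f g k : R -> R) : mu.-integrable setT (EFin \o g) ->
  mu.-integrable setT (EFin \o k) -> (forall r, f r = - (g r + k r)) ->
  \int[mu]_t f t = - (\int[mu]_t g t + \int[mu]_t k t).
Proof.
move=> ig ik fE; have igk : mu.-integrable setT (EFin \o (fun r => g r + k r)).
  exact: (integrableD measurableT ig ik).
rewrite -RintegralD // -mulN1r -RintegralZl //.
by apply: eq_Rintegral => t _; rewrite fE mulN1r.
Qed.

End integration_lemmas.

Section existence.
Context {R : realType} {Y : completeNormedModType R}.
Local Notation mu := (@lebesgue_measure R).
Local Notation P := (`]0, +oo[%classic : set R).
Variables (M K : R) (E S : R -> Y -> Y).
Hypothesis hE : smoothing M K E S.

Let bE := sm_sg hE.
Let M0 := sm_M0 hE.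
Let K0 := sm_K0 hE.

(** [h] stands for the generator applied to [u]. One constant [c] bounds both
    [u] uniformly and [h] in L1, so that the constants of superposed solutions
    simply add up. *)
Definition solves (x : Y) (g : R -> Y) (c : R) := exists u h : R -> Y,
  [/\ continuous u /\ u 0 = x, forall t, `|u t| <= c,
      [/\ L1 h, forall t, t <= 0 -> h t = 0 & (L1n h <= c%:E)%E],
      {ae mu, forall t, 0 < t -> smooth_graph E S (u t) (h t)} &
      dual_derivative +oo%E u (fun t => h t + g t)].

Lemma sm_bE t : 0 <= t -> bop (E t). Proof. exact: (bounded_semigroup_bop bE). Qed.

Lemma sm_EM t x : 0 <= t -> `|E t x| <= M * `|x|.
Proof. by case: bE => _ h _ _ _; exact: h. Qed.

Lemma sm_EC s t x : 0 <= s -> 0 <= t -> E s (E t x) = E t (E s x).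
Proof. by case: bE => _ _ _ h _ s0 t0; rewrite -!h // addrC. Qed.

Lemma sm_comm s t x : 0 <= s -> 0 < t -> S t (E s x) = E s (S t x).
Proof. by move=> s0 t0; rewrite -(sm_SE' hE) // (sm_SE hE). Qed.

Lemma flow_bound x t : `|flow E x t| <= M * `|x|.
Proof. by apply: sm_EM; rewrite le_max lexx orbT. Qed.

Lemma smooth_graph_orbit t x : 0 < t -> smooth_graph E S (E t x) (S t x).
Proof. by move=> t0 e e0; rewrite sm_comm ?(ltW t0) // -(sm_SE hE) ?(ltW t0) // addrC (sm_SE hE) // ltW. Qed.

(** Integration by parts against the orbit started at time [a]; the boundary
    term is the initial value. *)
Lemma flow_parts (phi : R -> R) (l : Y -> R^o) z w (a b : R) : bop l ->
  right_gen E z w -> a < b -> (forall t, derivable phi t 1) ->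
  continuous (derive1 phi) -> phi b = 0 ->
  \int[mu]_(t in `[a, b]) (derive1 phi t * l (flow E z (t - a)) : R) =
  - (phi a * l z) - \int[mu]_(t in `[a, b]) (phi t * l (flow E w (t - a)) : R).
Proof.
move=> bl zw ab dphi cd pb.
have cl z0 : continuous (fun t => l (flow E z0 (t - a)) : R).
  apply: (@continuous_shift R (R^o : normedModType R) (fun s => l (flow E z0 s)) a) => t.
  apply: continuous_comp; first exact: (flow_continuous bE).
  exact: (bop_continuous bl).
rewrite (parts ab dphi cd (cl z) (cl w)).
  by rewrite pb mul0r sub0r subrr flowE //; case: bE => _ _ -> _ _.
move=> t /andP[at0 _]; apply: (@vderiv_shift R (R^o : normedModType R) (fun s => l (flow E z s))).
apply: (vderiv_bop bl); rewrite (@flowE _ _ E w (t - a)) ?subr_ge0 ?(ltW at0) //.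
by apply: (flow_vderiv bE zw); rewrite subr_gt0.
Qed.

(** The orbit of the initial value; [S t x] is integrable by the smoothing
    estimate. *)
Lemma solves_initial x : solves x (fun=> 0) ((M + K) * `|x|).
Proof.
exists (flow E x), (cut P (fun t => S t x)); split.
- split; first exact: (flow_continuous bE).
  by rewrite flowE //; case: bE => _ _ -> _ _.
- by move=> t; rewrite (le_trans (flow_bound _ _)) // ler_wpM2r // lerDl.
- have hi : (L1n (cut P (fun t => S t x)) <= ((M + K) * `|x|)%:E)%E.
    by apply: le_trans (sm_int hE x) _; rewrite lee_fin ler_wpM2r // lerDr.
  split => //; first by split; [exact: sm_smeas hE x|exact: le_lt_trans hi (ltry _)].
  by move=> t; rewrite cutP ltNge => ->.
- by apply: aeW => t t0; rewrite cutP_gt0 // flowE ?(ltW t0) //; exact: smooth_graph_orbit.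
move=> phi tphi l bl.
have [a [b [N [/andP[a0 ab] bT [cphi cd] phi0 phiN]]]] := test_functionE (ltry 0) tphi.
have [dphi _ _] := tphi.
have ea : phi a = 0 by have [] := phi0 a; rewrite ?ltxx.
have eb : phi b = 0 by have [] := phi0 b; rewrite ?ltxx ?andbF.
have := flow_parts bl (sm_gen hE x a0) ab dphi cd eb.
rewrite ea mul0r oppr0 sub0r => h.
have off t : ~ `[a, b]%classic t -> phi t = 0 /\ derive1 phi t = 0.
  move=> ti; apply: phi0; apply/negP => /andP[/ltW h1 /ltW h2]; apply: ti.
  by rewrite /= in_itv /= h1.
rewrite (@Rintegral_supp R `[a, b]%classic _ (fun t => derive1 phi t * l (flow E (E a x) (t - a)) : R)).
- rewrite h; congr (- _); symmetry; apply: Rintegral_supp => t; last first.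
    by move=> /off[-> _]; rewrite mul0r.
  rewrite /= in_itv /= => /andP[at0 _]; have t0 := lt_le_trans a0 at0.
  rewrite cutP_gt0 // addr0 flowE ?subr_ge0 //; congr (_ * l _).
  by rewrite -(sm_SE hE) ?subr_ge0 // subrK.
- move=> t; rewrite /= in_itv /= => /andP[at0 _]; have t0 := lt_le_trans a0 at0.
  rewrite /cut mem_set; last by split => //; exact: ltry.
  rewrite !flowE ?subr_ge0 ?(ltW t0) //; congr (_ * l _).
  by case: bE => _ _ _ h' _; rewrite -h' ?subr_ge0 ?(ltW a0) // subrK.
- by move=> t /off[_ ->]; rewrite mul0r.
Qed.

Section convolution.
Variables (F : set R).
Hypotheses (mF : measurable F) (FP : F `<=` P) (Ffin : (mu F < +oo)%E).

(** The orbit vanishes at negative times, so that the Duhamel integral over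
    [0, t] is a convolution over the line. *)
Let orb z : R -> Y := cut `[0, +oo[%classic (flow E z).

Lemma orbE z t : orb z t = if 0 <= t then flow E z t else 0.
Proof. by rewrite /orb /cut mem_setE in_itv /= andbT. Qed.

Lemma orb_bound z t : `|orb z t| <= M * `|z|.
Proof.
rewrite orbE; case: ifP => _; first exact: flow_bound.
by rewrite normr0 mulr_ge0.
Qed.

Lemma orb_smeas z : smeas (orb z).
Proof.
by apply: smeas_cut; [exact: measurable_itv|exact/smeas_continuous/(flow_continuous bE)].
Qed.

Lemma orb_window z t : L1 (fun r => (\1_F r : R) *: orb z (t - r)).
Proof.
apply: (L1_le _ (L1_indic (M * `|z| : R^o) mF Ffin)).
  apply: smeasZ; first exact: (smeas_simple (simple_indic mF)).
  rewrite (_ : (fun r => _) = cut `]-oo, t]%classic (fun r => flow E z (t - r))).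
    apply: smeas_cut; first exact: measurable_itv.
    apply: smeas_continuous => r.
    apply: (@continuous_comp R R Y (fun s : R => t - s) (flow E z) r); last exact: (flow_continuous bE).
    by apply: cvgB; [exact: cvg_cst|exact: cvg_id].
  by apply/funext => r; rewrite orbE /cut mem_setE in_itv /= subr_ge0.
by move=> r; rewrite !normrZ normr_id (ger0_norm M0) ler_wpM2l // orb_bound.
Qed.

Lemma convolution_ex z : exists U : R -> Y, [/\
  forall t l, bop l -> (l (U t) : R) = \int[mu]_r (\1_F r * l (orb z (t - r)) : R),
  forall t, `|U t| <= M * `|z| * fine (mu F) & forall t, t <= 0 -> U t = 0].
Proof.
have /choice[U hU] := fun t => pettis_integral (orb_window z t).
exists U; split.
- by move=> t l bl; rewrite hU //; apply: eq_Rintegral => r _; rewrite (bopZ bl).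
- move=> t; rewrite (le_trans (pettis_norm (orb_window z t) (hU t))) //.
  have -> : M * `|z| * fine (mu F) = fine (L1n (fun r => (\1_F r : R) *: (M * `|z| : R^o))).
    by rewrite L1n_indic //= mulrC ger0_norm // mulr_ge0.
  apply: L1n_fine_le; [by case: (orb_window z t)|exact: L1_indic|].
  by move=> r; rewrite !normrZ normr_id (ger0_norm M0) ler_wpM2l // orb_bound.
move=> t t0; apply: eq_dual => l bl; rewrite hU // (bop0 bl).
transitivity (\int[mu]_r (0 : R)); last by rewrite /Rintegral integral0.
apply: eq_Rintegral => r _; rewrite indicE; case: (boolP (r \in F)) => [rF|_]; last by rewrite scale0r (bop0 bl).
rewrite orbE ifN ?scaler0 ?(bop0 bl) // -ltNge subr_lt0 (le_lt_trans t0) //.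
by have := FP (set_mem rF); rewrite /= in_itv /= andbT.
Qed.

(** The orbit of [z] jumps at 0 but is Lipschitz on both sides, since [z] is
    in the domain of the generator; the jump contributes the measure of an
    interval, so the convolution is Lipschitz. *)
Lemma convolution_continuous z w U : right_gen E z w ->
  (forall t (l : Y -> R^o), bop l -> (l (U t) : R) = \int[mu]_r (\1_F r * l (orb z (t - r)) : R)) ->
  continuous U.
Proof.
move=> zw hU.
pose c := M * `|w| * fine (mu F) + M * `|z|.
have c0 : 0 <= c by rewrite addr_ge0 ?mulr_ge0 // fine_ge0.
have lip s t : s <= t -> `|U t - U s| <= c * (t - s).
  move=> st; have ts : 0 <= t - s by rewrite subr_ge0.
  have mI : measurable (`[s, t]%classic : set R) by exact: measurable_itv.
  have muI : mu (`[s, t]%classic : set R) = (t - s)%:E.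
    move: st; rewrite lebesgue_measure_itv /= lte_fin le_eqVlt => /predU1P[->|->] //.
    by rewrite ltxx subrr.
  have Ifin : (mu (`[s, t]%classic : set R) < +oo)%E by rewrite muI ltry.
  have LB := L1B (orb_window z t) (orb_window z s).
  have Lw := L1_indic (M * `|w| * (t - s) : R^o) mF Ffin.
  have Lz := L1_indic (M * `|z| : R^o) mI Ifin.
  have LD := L1D Lw Lz.
  apply: (@le_trans _ _ (fine (L1n (fun r => (\1_F r : R) *: orb z (t - r) - (\1_F r : R) *: orb z (s - r))))).
    apply: pettis_norm => // l bl; rewrite (bopB bl) !hU //.
    have il t0 : mu.-integrable setT (EFin \o (fun r => \1_F r * l (orb z (t0 - r)) : R)).
      rewrite (_ : (fun r => _) = (fun r => l ((\1_F r : R) *: orb z (t0 - r)) : R)).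
        by apply: dual_integrable => //; exact: orb_window.
      by apply/funext => r; rewrite (bopZ bl).
    rewrite -RintegralB //; apply: eq_Rintegral => r _.
    by rewrite (bopB bl) !(bopZ bl).
  have [sB _] := LB.
  apply: le_trans (L1n_fine_le sB LD _) _ => [r|]; last first.
    have [sw _] := Lw; have [sz _] := Lz.
    rewrite -lee_fin -(L1n_fin LD); apply: le_trans (L1nD sw sz) _.
    rewrite !L1n_indic // muI -EFinD lee_fin /= !ger0_norm ?mulr_ge0 // le_eqVlt.
    by apply/orP; left; apply/eqP; rewrite /c; ring.
  rewrite -scalerBr.
  set f1 := (\1_F r : R); set f2 := (\1__ r : R).
  have f10 : 0 <= f1 by rewrite /f1 indicE.
  have f11 : f1 <= 1 by rewrite /f1 indicE; case: (_ \in _).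
  have f20 : 0 <= f2 by rewrite /f2 indicE.
  have pos : 0 <= f1 *: (M * `|w| * (t - s) : R^o) + f2 *: (M * `|z| : R^o).
    by rewrite addr_ge0 // mulr_ge0 // ?mulr_ge0.
  rewrite normrZ [leRHS]ger0_norm // (ger0_norm f10).
  have [rs|sr] := leP r s.
    apply: (@le_trans _ _ (f1 * (M * `|w| * (t - s)))); last by rewrite lerDl mulr_ge0 // mulr_ge0.
    rewrite ler_wpM2l // !orbE !ifT ?subr_ge0 // ?(le_trans rs) //.
    have e1 : t - s = t - r - (s - r) by rewrite opprB addrA subrK.
    rewrite e1; apply: (@mean_value R Y (flow E z) (fun u => E u w)).
    - by rewrite lerD2r.
    - exact: (flow_continuous bE).
    - by move=> u /andP[u0 _]; apply: (flow_vderiv bE zw); rewrite (le_lt_trans _ u0) // subr_ge0.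
    - by move=> u /andP[u0 _]; apply: sm_EM; rewrite ltW // (le_lt_trans _ u0) // subr_ge0.
  rewrite [orb z (s - r)]orbE ifN; last by rewrite -ltNge subr_lt0.
  rewrite subr0; have [tr|rt] := ltP t r.
    by rewrite orbE ifN ?normr0 ?mulr0 // -ltNge subr_lt0.
  have -> : f2 = 1.
    by rewrite /f2 indicE mem_set //= in_itv /= (ltW sr).
  apply: (@le_trans _ _ (M * `|z|)); first by rewrite (le_trans (ler_piMl _ f11)) ?orb_bound.
  rewrite scale1r lerDr; apply: mulr_ge0 => //; apply: mulr_ge0 => //; exact: mulr_ge0.
move=> t; apply/cvgrPdist_le => e e0.
have c1 : 0 < c + 1 by rewrite ltr_wpDl.
near=> s.
have h : `|U t - U s| <= c * `|t - s|.
  have [st|ts] := leP s t; first by rewrite ger0_norm ?subr_ge0 //; exact: lip.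
  by rewrite distrC ler0_norm ?opprB ?lip ?subr_le0 // ltW.
have : `|t - s| < e / (c + 1) by near: s; apply: near_dist; rewrite divr_gt0.
have : e / (c + 1) * (c + 1) = e by rewrite divfK // gt_eqF.
move: (e / (c + 1)) (`|t - s|) (normr_ge0 (t - s)) h => d a a0 h h1 h2.
by rewrite (le_trans h) //; nra.
Unshelve. all: by end_near. Qed.

Lemma orb_parts (phi : R -> R) (l : Y -> R^o) z w (b r : R) : bop l ->
  right_gen E z w -> (forall t, derivable phi t 1) -> continuous (derive1 phi) ->
  (forall t, b <= t -> phi t = 0 /\ derive1 phi t = 0) ->
  \int[mu]_t (derive1 phi t * l (orb z (t - r)) : R) =
  - (phi r * l z) - \int[mu]_t (phi t * l (orb w (t - r)) : R).
Proof.
move=> bl zw dphi cd phi0; have [rb|br] := ltP r b; last first.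
  have [-> _] := phi0 r br.
  have zr v (ps : R -> R) : (forall t, b <= t -> ps t = 0) ->
     \int[mu]_t (ps t * l (orb v (t - r)) : R) = 0.
    move=> ps0; transitivity (\int[mu]_t (0 : R)); last by rewrite /Rintegral integral0.
    apply: eq_Rintegral => t _; have [bt|tb] := leP b t; first by rewrite ps0 // mul0r.
    by rewrite orbE ifN ?(bop0 bl) ?mulr0 // -ltNge subr_lt0 (lt_le_trans tb).
  rewrite (zr z) => [|t /phi0[]//]; rewrite (zr w) => [|t /phi0[]//].
  by rewrite mul0r oppr0 addr0.
have [eb _] := phi0 b (lexx b).
have loc v (ps : R -> R) : (forall t, b <= t -> ps t = 0) ->
    \int[mu]_t (ps t * l (orb v (t - r)) : R) =
    \int[mu]_(t in `[r, b]) (ps t * l (flow E v (t - r)) : R).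
  move=> ps0; apply: Rintegral_supp => t /=; rewrite in_itv /=.
    by move=> /andP[rt _]; rewrite orbE subr_ge0 rt.
  have [rt|tr] := leP r t; last by rewrite orbE ifN ?(bop0 bl) ?mulr0 // -ltNge subr_lt0.
  by move=> /= /negP; rewrite -ltNge => /ltW/ps0 ->; rewrite mul0r.
rewrite (loc z) => [|t /phi0[]//]; rewrite (loc w) => [|t /phi0[]//].
exact: (flow_parts bl zw rb dphi cd eb).
Qed.

(** The forcing takes a single value, in the range of [E e], on the set [F] of
    times, so that the solution and its image under the generator are both
    convolutions of continuous orbits. The L1 norm of the latter is at most
    that of [S t y] times the measure of [F], by Tonelli's theorem and
    translation invariance, and Fubini's theorem yields the equation in weak
    form. *)
Lemma solves_window y0 (e : R) : 0 < e ->
  solves 0 (fun r => (\1_F r : R) *: E e y0)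
    ((M + K) * (fine (mu F) * `|E e y0|)).
Proof.
move=> e0; set y := E e y0; pose q := S e y0.
have e2 : 0 < e / 2 by rewrite divr_gt0.
have yq : right_gen E y q by exact: (sm_gen hE).
have qE : q = E (e / 2) (S (e / 2) y0) by rewrite -(sm_SE hE) ?(ltW e2) // -splitr.
have qq : right_gen E q (S (e / 2) (S (e / 2) y0)) by rewrite qE; exact: (sm_gen hE).
have [u [hu bu u0]] := convolution_ex y.
have [h [hh bh h0]] := convolution_ex q.
have cu := convolution_continuous yq hu.
have ch := convolution_continuous qq hh.
have mu0 : 0 <= fine (mu F) by rewrite fine_ge0.
(* The orbit of [q] is the image of the orbit of [y] under the generator, so
   the smoothing estimate gives its integral. *)
have Eq t : 0 < t -> E t q = S t y.
  by move=> t0; rewrite /q /y sm_comm ?(ltW e0) // -(sm_SE hE) ?(ltW t0) // addrC (sm_SE hE) ?(ltW e0).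
have orbq : (L1n (orb q) <= (K * `|y|)%:E)%E.
  apply: le_trans (sm_int hE y).
  apply: (@ge0_integral_le_off_null _ _ R mu _ _ [set 0]).
  - exact: measurable_set1.
  - exact: lebesgue_measure_set1.
  - by move=> t; rewrite lee_fin.
  - by move=> t; rewrite lee_fin.
  move=> t /eqP t0; rewrite orbE cutP lee_fin lt_def t0 /=; case: ifP => t1 //.
  by rewrite flowE // Eq // lt_def t0.
have Lh : (L1n h <= (K * `|y| * fine (mu F))%:E)%E.
  pose f (z : R * R) := (\1_F z.2 * `|orb q (z.1 - z.2)|)%:E.
  have mo : measurable_fun setT (fun t => `|orb q t|) := smeas_norm (orb_smeas q).
  have m1 : measurable_fun setT (\1_F : R -> R) by exact: measurable_indic.
  have mB : measurable_fun setT (fun z : R * R => z.1 - z.2).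
    by apply: measurable_funB; [exact: measurable_fst|exact: measurable_snd].
  have mf : measurable_fun setT f.
    apply/measurable_EFinP; apply: measurable_funM.
      by apply: (measurableT_comp m1); exact: measurable_snd.
    exact: (measurableT_comp mo mB).
  have f0 z : (0 <= f z)%E by rewrite lee_fin mulr_ge0 // indicE.
  apply: (@le_trans _ _ (\int[mu]_t \int[mu]_r f (t, r))%E).
    apply: ge0_le_integral => //.
    - apply: measurable_normE; exact: smeas_continuous.
    - exact: (@measurable_fun_fubini_tonelli_F _ _ _ _ R mu f).
    move=> t _; have LW := orb_window q t.
    have -> : (\int[mu]_r f (t, r) = L1n (fun r => (\1_F r : R) *: orb q (t - r)))%E.
      by apply: eq_integral => r _; rewrite /f /= normrZ ger0_norm // indicE.
    rewrite (L1n_fin LW) lee_fin; apply: pettis_norm => // l bl.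
    by rewrite hh //; apply: eq_Rintegral => r _; rewrite (bopZ bl).
  rewrite (@fubini_tonelli _ _ _ _ R mu mu f mf f0).
  have -> : (\int[mu]_r \int[mu]_t f (t, r) = \int[mu]_r (L1n (orb q) * (\1_F r)%:E))%E.
    apply: eq_integral => r _; rewrite muleC.
    have sh := integral_shift r mo (fun t => normr_ge0 _).
    rewrite /= in sh; rewrite [L1n _](_ : _ = (\int[mu]_t (`|orb q (t - r)|)%:E)%E); last by rewrite sh.
    rewrite -ge0_integralZl_EFin //.
    apply/measurable_EFinP; apply: (measurableT_comp mo).
    by apply: measurable_funB; [exact: measurable_id|exact: measurable_cst].
  have fq : (L1n (orb q) \is a fin_num)%E by rewrite ge0_fin_numE ?L1n_ge0 // (le_lt_trans orbq) // ltry.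
  rewrite -(fineK fq) ge0_integralZl_EFin //; first last.
  - by rewrite fine_ge0 // L1n_ge0.
  - by apply/measurable_EFinP.
  rewrite integral_indicT // -(fineK (x := mu F)) ?ge0_fin_numE // -EFinM lee_fin.
  by rewrite ler_wpM2r // -lee_fin fineK.
have cle1 : M * `|y| * fine (mu F) <= (M + K) * (fine (mu F) * `|y|).
  by rewrite -mulrA [`|y| * _]mulrC ler_wpM2r ?mulr_ge0 // lerDl.
have cle2 : K * `|y| * fine (mu F) <= (M + K) * (fine (mu F) * `|y|).
  by rewrite -mulrA [`|y| * _]mulrC ler_wpM2r ?mulr_ge0 // lerDr.
exists u, h; split.
- by split => //; exact: u0.
- by move=> t; exact: le_trans (bu t) cle1.
- have Lh' : (L1n h <= ((M + K) * (fine (mu F) * `|y|))%:E)%E.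
    by apply: le_trans Lh _; rewrite lee_fin.
  by split => //; split; [exact: smeas_continuous|exact: le_lt_trans Lh' (ltry _)].
- apply: aeW => t t0 d d0; apply: eq_dual => l bl.
  have bSd := sm_S hE d0; have bEd := sm_bE (ltW d0).
  transitivity (\int[mu]_r (\1_F r * l (S d (orb y (t - r))) : R)).
    exact: (hu t (l \o S d) (bop_comp bl bSd)).
  transitivity (\int[mu]_r (\1_F r * l (E d (orb q (t - r))) : R)); last first.
    symmetry; exact: (hh t (l \o E d) (bop_comp bl bEd)).
  apply: eq_Rintegral => r _ /=; congr (_ * l _); rewrite !orbE.
  case: ifP => tr; last by rewrite (bop0 bSd) (bop0 bEd).
  rewrite !flowE // sm_comm // sm_EC ?(ltW d0) //; congr (E _ _).
  by rewrite /y /q; exact: smooth_graph_orbit.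
move=> phi tphi l bl.
have [a [b [N [/andP[a0 ab] bT [cphi cd] phi0 phiN]]]] := test_functionE (ltry 0) tphi.
have [dphi _ _] := tphi.
have [C C0 hC] := bop_bound bl.
have ml z : measurable_fun setT (fun t => l (orb z t) : R).
  apply: smeas_measurable; exact: (smeas_comp (bop_continuous bl) (orb_smeas z)).
have mlb z t : `|l (orb z t) : R| <= C * (M * `|z|).
  by rewrite (le_trans (hC _)) // ler_wpM2l ?orb_bound // ltW.
have off t : ~~ (a <= t <= b) -> phi t = 0 /\ derive1 phi t = 0.
  by move=> h'; apply: phi0; apply: contra h' => /andP[/ltW -> /ltW ->].
have offp t : ~~ (a <= t <= b) -> phi t = 0 by case/off.
have offd t : ~~ (a <= t <= b) -> derive1 phi t = 0 by case/off.
have mphi : measurable_fun setT phi by exact: (continuous_measurable_fun cphi).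
have mdphi : measurable_fun setT (derive1 phi) by exact: (continuous_measurable_fun cd).
have i5 : mu.-integrable setT (EFin \o (fun r => \1_F r * (phi r * l y) : R)).
  have mk : measurable_fun setT (fun r => phi r * l y : R).
    by apply: (measurable_funM mphi); exact: measurable_cst.
  apply: (window_integrable (c := N * `|l y : R|) mF Ffin mk) => t.
  by rewrite normrM ler_wpM2r //; case: (phiN t).
have [i1 i2 fub1] := window_fubini mF Ffin (ml y) (mlb y) mdphi (fun t => (phiN t).2) offd.
have [i3 i4 fub2] := window_fubini mF Ffin (ml q) (mlb q) mphi (fun t => (phiN t).1) offp.
have -> : \int[mu]_t (derive1 phi t * l (cut (open_time +oo) u t) : R) =
   \int[mu]_t (derive1 phi t * \int[mu]_r (\1_F r * l (orb y (t - r)) : R)).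
  apply: eq_Rintegral => t _; congr (_ * _).
  transitivity (l (u t) : R); last exact: (hu t l bl).
  rewrite /cut; case: ifPn => [_|tn]; first by [].
  rewrite u0; first by [].
  rewrite leNgt; apply: contra tn => t0; rewrite inE; split; [by []|exact: ltry].
rewrite fub1.
have -> : \int[mu]_t (phi t * l (h t + (\1_F t : R) *: y) : R) =
   \int[mu]_t (phi t * \int[mu]_r (\1_F r * l (orb q (t - r)) : R)) +
   \int[mu]_r (\1_F r * (phi r * l y) : R).
  rewrite -(RintegralD measurableT i3 i5); apply: eq_Rintegral => t _.
  rewrite -(hh t l bl) (bopD bl) (bopZ bl) mulrDr; congr (_ + _).
  by rewrite mulrCA.
rewrite fub2; apply: (Rintegral_oppD i4 i5) => r.
rewrite -mulrDr -mulrN indicE.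
case: (boolP (r \in F)) => [/set_mem /FP|_]; last by rewrite !mul0r.
rewrite /= in_itv /= andbT => r0; rewrite !mul1r opprD addrC.
apply: (@orb_parts phi l y q b r bl yq dphi cd) => t bt; apply: phi0.
by rewrite [t < b]ltNge bt andbF.
Qed.

End convolution.
End existence.

(** * Superposition *)

Section superposition.
Context {R : realType} {Y : completeNormedModType R}.
Local Notation mu := (@lebesgue_measure R).
Variables (M K : R) (E S : R -> Y -> Y).
Hypothesis hE : smoothing M K E S.

Lemma bop_opp (l : Y -> R^o) : bop l -> bop (fun x => - l x : R^o).
Proof.
move=> bl; split=> [a x y|]; first by rewrite (bopD bl) (bopZ bl) opprD scalerN.
by have [C _ hC] := bop_bound bl; exists C => x; rewrite normrN.
Qed.

Lemma cutN (D : set R) (u : R -> Y) t : cut D (fun t => - u t) t = - cut D u t.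
Proof. by rewrite /cut; case: ifP => // _; rewrite oppr0. Qed.

Lemma dual_derivative0 : dual_derivative +oo%E (fun _ : R => 0 : Y) (fun=> 0).
Proof.
move=> phi tphi l bl.
have z0 (k : R -> R) (w : R -> Y) : (forall t, w t = 0) -> \int[mu]_t (k t * l (w t) : R) = 0.
  move=> w0; transitivity (\int[mu]_t (0 : R)); last by rewrite /Rintegral integral0.
  by apply: eq_Rintegral => t _; rewrite w0 (bop0 bl) mulr0.
by rewrite !z0 ?oppr0 // => t; rewrite /cut if_same.
Qed.

Lemma dual_derivativeD (T : \bar R) (u u' v v' : R -> Y) : (0 < T)%E ->
  {within halfopen_time T, continuous u} -> {within halfopen_time T, continuous u'} ->
  L1 v -> L1 v' -> dual_derivative T u v -> dual_derivative T u' v' ->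
  dual_derivative T (fun t => u t + u' t) (fun t => v t + v' t).
Proof.
move=> T0 cu cu' Lv Lv' du du' phi tphi l bl.
have [a [b [N [/andP[a0 ab] bT [cphi cd] phi0 phiN]]]] := test_functionE T0 tphi.
have lZ (k : R) (w : Y) : k * l w = l (k *: w) by rewrite (bopZ bl).
have i1 (w : R -> Y) : {within halfopen_time T, continuous w} ->
    mu.-integrable setT (EFin \o (fun t => derive1 phi t * l (cut (open_time T) w t) : R)).
  move=> cw; rewrite (_ : (fun t => _) = (fun t => l (derive1 phi t *: cut (open_time T) w t) : R)).
    apply: dual_integrable => //; apply: (@L1_test_cut R Y T (derive1 phi) a b N w) => //.
    by move=> t /phi0[].
  by apply/funext => t; rewrite lZ.
have i2 (w : R -> Y) : L1 w -> mu.-integrable setT (EFin \o (fun t => phi t * l (w t) : R)).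
  move=> Lw; rewrite (_ : (fun t => _) = (fun t => l (phi t *: w t) : R)).
    by apply: dual_integrable => //; apply: (@L1_test R Y phi N) => // t; case: (phiN t).
  by apply/funext => t; rewrite lZ.
have -> : \int[mu]_t (phi t * l (v t + v' t) : R) =
    \int[mu]_t (phi t * l (v t) : R) + \int[mu]_t (phi t * l (v' t) : R).
  rewrite -(RintegralD measurableT (i2 _ Lv) (i2 _ Lv')).
  by apply: eq_Rintegral => t _; rewrite (bopD bl) mulrDr.
have -> : \int[mu]_t (derive1 phi t * l (cut (open_time T) (fun t => u t + u' t) t) : R) =
    \int[mu]_t (derive1 phi t * l (cut (open_time T) u t) : R) +
    \int[mu]_t (derive1 phi t * l (cut (open_time T) u' t) : R).
  rewrite -(RintegralD measurableT (i1 _ cu) (i1 _ cu')).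
  apply: eq_Rintegral => t _; rewrite -mulrDr; congr (_ * _); rewrite /cut.
  by case: ifP => _; rewrite -(bopD bl) // addr0.
by rewrite (du phi tphi l bl) (du' phi tphi l bl) opprD.
Qed.

Lemma dual_derivativeN (T : \bar R) (u v : R -> Y) :
  dual_derivative T u v -> dual_derivative T (fun t => - u t) (fun t => - v t).
Proof.
move=> du phi tphi l bl.
have := du phi tphi (fun x => - l x) (bop_opp bl).
by under eq_Rintegral do rewrite -(bopN bl) -cutN; under [in RHS]eq_Rintegral do rewrite -(bopN bl).
Qed.

Lemma smooth_graph0 : smooth_graph E S 0 0.
Proof. by move=> e e0; rewrite (bop0 (sm_S hE e0)) (bop0 (sm_bE hE (ltW e0))). Qed.

Lemma smooth_graphD x y x' y' : smooth_graph E S x y -> smooth_graph E S x' y' ->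
  smooth_graph E S (x + x') (y + y').
Proof.
move=> h h' e e0; rewrite (bopD (sm_S hE e0)) (bopD (sm_bE hE (ltW e0))).
by rewrite h // h'.
Qed.

(** Closedness of the generator. *)
Lemma smooth_graph_lim (x y : nat -> Y) x0 y0 :
  (forall n, smooth_graph E S (x n) (y n)) -> x n @[n --> \oo] --> x0 ->
  y n @[n --> \oo] --> y0 -> smooth_graph E S x0 y0.
Proof.
move=> h xc yc e e0.
have c1 : S e (x n) @[n --> \oo] --> S e x0.
  by apply: (cvg_comp _ _ xc); exact: (bop_continuous (sm_S hE e0)).
have c2 : S e (x n) @[n --> \oo] --> E e y0.
  rewrite (_ : (fun n => _) = (fun n => E e (y n))); last by apply/funext => n; rewrite h.
  by apply: (cvg_comp _ _ yc); exact: (bop_continuous (sm_bE hE (ltW e0))).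
exact: (cvg_unique _ c1 c2).
Qed.

Local Notation solves := (solves E S).

Lemma solves0 : solves 0 (fun=> 0) 0.
Proof.
have n0 : L1n (fun _ : R => 0 : Y) = 0%E.
  by rewrite /L1n; under eq_integral do rewrite normr0; rewrite integral0.
exists (fun=> 0), (fun=> 0); split.
- by split => //; exact: cst_continuous.
- by move=> t; rewrite normr0.
- by split => //; [split; [exact: (smeas_simple (simple_cst _))|rewrite n0]|rewrite n0].
- by apply: aeW => t _; exact: smooth_graph0.
rewrite (_ : (fun t => 0 + 0) = (fun=> 0)); first exact: dual_derivative0.
by apply/funext => t; rewrite addr0.
Qed.

Lemma solvesD x g c x' g' c' : L1 g -> L1 g' -> solves x g c -> solves x' g' c' ->
  solves (x + x') (fun t => g t + g' t) (c + c').
Proof.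
move=> Lg Lg' [u [h [[cu u0] ub [Lh h0 hb] gr d]]] [u' [h' [[cu' u0'] ub' [Lh' h0' hb'] gr' d']]].
exists (fun t => u t + u' t), (fun t => h t + h' t); split.
- split; last by rewrite u0 u0'.
  by move=> t; apply: cvgD; [exact: cu|exact: cu'].
- by move=> t; rewrite (le_trans (ler_normD _ _)) // lerD.
- split; first exact: L1D.
    by move=> t t0; rewrite h0 // h0' // addr0.
  have [sh _] := Lh; have [sh' _] := Lh'.
  by apply: (le_trans (L1nD sh sh')); rewrite EFinD leeD.
- by apply: ae_imp2 gr gr' => t g1 g2 t0; apply: smooth_graphD; [exact: g1|exact: g2].
have -> : (fun t => h t + h' t + (g t + g' t)) = (fun t => (h t + g t) + (h' t + g' t)).
  by apply/funext => t; rewrite addrACA.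
by apply: dual_derivativeD => //; solve [exact: L1D|exact: continuous_subspaceT].
Qed.

(** The partial sums converge uniformly, their images under the generator
    converge in L1 and almost everywhere, and the generator is closed. *)
Lemma solves_series (g : R -> Y) (G : nat -> R -> Y) (c : nat -> R) (C : R) :
  (forall k, L1 (G k)) -> (forall k, solves 0 (G k) (c k)) ->
  (forall k, 0 <= c k) -> (forall N, \sum_(0 <= k < N) c k <= C) -> L1 g ->
  L1n (fun t => g t - \sum_(0 <= k < n) G k t) @[n --> \oo] --> 0%E ->
  solves 0 g C.
Proof.
move=> LG sG c0 cC Lg gG.
have /choice[u /choice[h hyp]] := sG.
have cu k : continuous (u k) by case: (hyp k) => -[].
have u0 k : u k 0 = 0 by case: (hyp k) => -[].
have ub k t : `|u k t| <= c k by case: (hyp k).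
have Lh k : L1 (h k) by case: (hyp k) => _ _ [].
have h0 k t : t <= 0 -> h k t = 0 by case: (hyp k) => _ _ [_ + _] _ _; exact.
have hb k : (L1n (h k) <= (c k)%:E)%E by case: (hyp k) => _ _ [].
have gr k : {ae mu, forall t, 0 < t -> smooth_graph E S (u k t) (h k t)} by case: (hyp k).
have dd k : dual_derivative +oo%E (u k) (fun t => h k t + G k t) by case: (hyp k).
pose U n t := \sum_(0 <= k < n) u k t.
pose H n t := \sum_(0 <= k < n) h k t.
have mono : nondecreasing_seq (series c).
  apply/nondecreasing_seqP => n; rewrite /series /= big_nat_recr //= lerDl //.
have cc : cvgn (series c).
  by apply: nondecreasing_is_cvgn => //; exists C => _ [n _ <-]; exact: cC.
pose d n := limn (series c) - series c n.
have d0 n : 0 <= d n by rewrite subr_ge0; exact: nondecreasing_cvgn_le.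
have dlim : d n @[n --> \oo] --> (0 : R).
  rewrite -[X in _ --> X](subrr (limn (series c))).
  by apply: cvgB; [exact: cvg_cst|exact: cc].
have UB n m t : (n <= m)%N -> `|U m t - U n t| <= d n.
  move=> nm; have -> : U m t - U n t = \sum_(n <= k < m) u k t.
    by rewrite /U (big_cat_nat (leq0n n) nm) /= addrAC subrr add0r.
  apply: le_trans (ler_norm_sum _ _ _) _.
  apply: (@le_trans _ _ (\sum_(n <= k < m) c k)); first by apply: ler_sum => k _.
  rewrite /d lerBrDl -(big_cat_nat (leq0n n) nm) /=.
  exact: (nondecreasing_cvgn_le mono cc m).
have /choice[w hw] : forall t, exists y, forall n, `|y - U n t| <= d n.
  move=> t.
  have cU : cvgn (fun n => U n t).
    apply: (cauchy_cvg_bound dlim) => n m; have [nm|/ltnW mn] := leqP n m.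
      by rewrite distrC (le_trans (UB _ _ _ nm)) // lerDl.
    by rewrite (le_trans (UB _ _ _ mn)) // lerDr.
  exists (limn (fun n => U n t)) => n.
  have cn : `|U m t - U n t| @[m --> \oo] --> `|limn (fun n => U n t) - U n t|.
    by apply: cvg_norm; apply: cvgB; [exact: cU|exact: cvg_cst].
  apply: (cvgr_to_le cn); near=> m; apply: UB; near: m; exact: nbhs_infty_ge.
have Ucont n : continuous (U n).
  elim: n => [|n IH].
    rewrite (_ : U 0%N = fun=> 0); first exact: cst_continuous.
    by apply/funext => t; rewrite /U big_geq.
  rewrite (_ : U n.+1 = fun t => U n t + u n t).
    by move=> t; apply: cvgD; [exact: IH|exact: cu].
  by apply/funext => t; rewrite /U big_nat_recr.
have wU t : U n t @[n --> \oo] --> w t.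
  apply/cvgrPdist_le => e e0; near=> n; apply: (le_trans (hw t n)).
  have : `|0 - d n| <= e by near: n; move/cvgrPdist_le: dlim; apply.
  by rewrite sub0r normrN ger0_norm.
have cw : continuous w.
  move=> t; apply/cvgrPdist_le => e e0; have e3 : 0 < e / 3 by rewrite divr_gt0.
  have [n hn] : exists n, d n <= e / 3.
    have [N _ hN] : \forall n \near \oo, `|0 - d n| <= e / 3 by move/cvgrPdist_le: dlim; apply.
    by exists N; have := hN N (leqnn N); rewrite sub0r normrN ger0_norm.
  near=> s.
  have h1 : `|U n t - U n s| <= e / 3.
    by near: s; move/cvgrPdist_le: (Ucont n t); apply.
  have -> : w t - w s = (w t - U n t) + (U n t - U n s) - (w s - U n s).
    by apply: eq_dual => l bl; rewrite !(bopB bl, bopD bl); ring.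
  have h2 := hw t n; have h3 := hw s n.
  rewrite (le_trans (ler_normB _ _)) // (le_trans (lerD (ler_normD _ _) (lexx _))) //; lra.
have hC N : (\sum_(0 <= n < N) L1n (h n) <= C%:E)%E.
  apply: (@le_trans _ _ (\sum_(0 <= n < N) (c n)%:E)%E).
    by apply: lee_sum => n _.
  by rewrite sumEFin lee_fin.
have [F [LF FC Fae Flim F0]] := L1_series Lh (ltry C) hC.
exists w, F; split.
- split => //; apply/eqP; rewrite -normr_le0.
  apply: (cvgr_to_ge dlim); apply: nearW => n.
  by have := hw 0 n; rewrite /U big1 ?subr0.
- move=> t; have := hw t 0%N; rewrite /U big_geq // subr0 => h1.
  apply: (le_trans h1); rewrite /d /series /= big_geq // subr0.
  by apply: limr_le => //; apply: nearW => n; exact: cC.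
- by split => // t t0; apply: F0 => n; exact: h0.
- have gr' := ae_foralln gr.
  apply: ae_imp2 gr' Fae => t g1 g2 t0.
  apply: (smooth_graph_lim (x := fun n => U n t) (y := fun n => H n t)) => // n.
  elim: n => [|n IH]; first by rewrite /U /H !big_geq //; exact: smooth_graph0.
  by rewrite /U /H !big_nat_recr //=; apply: smooth_graphD => //; exact: g1.
have LW n : L1 (fun t => H n t + \sum_(0 <= k < n) G k t).
  by apply: L1D; exact: L1_sum.
apply: (@dual_derivative_lim R Y w _ U (fun n t => H n t + \sum_(0 <= k < n) G k t) d) => //.
- exact: L1D.
- have sub n : (L1n (fun t => (F t + g t - (H n t + \sum_(0 <= k < n) G k t))%R) <=
     L1n (fun t => F t - H n t)%R + L1n (fun t => g t - \sum_(0 <= k < n) G k t)%R)%E.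
    have [s1 _] : L1 (fun t => F t - H n t) by apply: L1B => //; exact: L1_sum.
    have [s2 _] : L1 (fun t => g t - \sum_(0 <= k < n) G k t) by apply: L1B => //; exact: L1_sum.
    apply: le_trans (L1nD s1 s2); rewrite le_eqVlt; apply/orP; left; apply/eqP.
    by apply: eq_integral => t _; rewrite opprD addrACA.
  apply: (@squeeze_cvge _ _ _ _ (cst 0%E) _ (fun n => L1n (fun t => F t - H n t)%R + L1n (fun t => g t - \sum_(0 <= k < n) G k t)%R)%E).
  + by apply: nearW => n; rewrite sub andbT; exact: L1n_ge0.
  + exact: cvg_cst.
  + rewrite -[X in _ --> X](adde0 (0%E : \bar R)); apply: cvgeD => //.
elim=> [|n IH].
  rewrite (_ : U 0%N = fun=> 0); last by apply/funext => t; rewrite /U big_geq.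
  have -> : (fun t => H 0%N t + \sum_(0 <= k < 0) G k t) = fun=> 0.
    by apply/funext => t; rewrite /H !big_geq // addr0.
  exact: dual_derivative0.
rewrite (_ : U n.+1 = fun t => U n t + u n t); last by apply/funext => t; rewrite /U big_nat_recr.
have -> : (fun t => H n.+1 t + \sum_(0 <= k < n.+1) G k t) =
    fun t => (H n t + \sum_(0 <= k < n) G k t) + (h n t + G n t).
  by apply/funext => t; rewrite /H !big_nat_recr //= addrACA.
by apply: dual_derivativeD => //; solve [exact: L1D|exact: continuous_subspaceT].
Unshelve. all: by end_near. Qed.

End superposition.

(** * General forcing *)

Section forcing.
Context {R : realType} {Y : completeNormedModType R}.
Local Notation mu := (@lebesgue_measure R).
Local Notation P := (`]0, +oo[%classic : set R).
Variables (M K : R) (E S : R -> Y -> Y).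
Hypothesis hE : smoothing M K E S.
Let bE := sm_sg hE.
Let M0 := sm_M0 hE.
Let K0 := sm_K0 hE.
Let MK0 : 0 <= M + K. Proof. exact: addr_ge0. Qed.
Local Notation solves := (solves E S).

(** The values are treated one at a time. Since the sets on which they are
    taken are disjoint, the L1 norms add up exactly and the constant does not
    depend on the number of values. *)
Lemma solves_simple (s : R -> Y) (e : R) : 0 < e -> simple_fun s -> L1 s ->
  (forall t, t <= 0 -> s t = 0) ->
  solves 0 (E e \o s) ((M + K) * fine (L1n (E e \o s))).
Proof.
move=> e0 ss Ls s0.
have be := sm_bE hE (ltW e0).
have Les := L1_comp be Ls; have [ses _] := Les.
have mpre A : measurable (s @^-1` A) by exact: simple_preimage.
pose piece (ys : seq Y) := cut (s @^-1` [set` ys]) (E e \o s).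
have pieceE ys t : piece ys t = if s t \in ys then E e (s t) else 0.
  by rewrite /piece /cut; congr (if _ then _ else _); apply/idP/idP; rewrite inE.
have Lpiece ys : L1 (piece ys) by exact: L1_cut.
have [/finite_seqP[ys0 hys] _] := ss.
suff H (ys : seq Y) : uniq ys -> solves 0 (piece ys) ((M + K) * fine (L1n (piece ys))).
  have := H _ (undup_uniq ys0); rewrite (_ : piece _ = E e \o s) //.
  apply/funext => t; rewrite pieceE mem_undup ifT //.
  have : range s (s t) by exists t.
  by rewrite hys.
elim: ys => [_|y ys IH /= /andP[yn uys]].
  have -> : piece [::] = fun=> 0 by apply/funext => t; rewrite pieceE.
  rewrite /L1n; under eq_integral do rewrite normr0.
  by rewrite integral0 mulr0; exact: (solves0 hE).
pose F := s @^-1` [set y].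
pose term (r : R) := (\1_F r : R) *: E e y.
have termE t : term t = if s t == y then E e y else 0.
  rewrite /term indicE /F; case: eqP => [<-|sy].
    by rewrite mem_set // scale1r.
  by rewrite memNset // scale0r.
have pE : piece (y :: ys) = fun t => piece ys t + term t.
  apply/funext => t; rewrite !pieceE termE inE; case: eqP => [->|_] /=.
    by rewrite (negbTE yn) add0r.
  by rewrite addr0.
have nE t : `|piece (y :: ys) t| = `|piece ys t| + `|term t|.
  rewrite !pieceE termE inE; case: eqP => [->|_] /=.
    by rewrite (negbTE yn) normr0 add0r.
  by rewrite normr0 addr0.
have [y0|yn0] := eqVneq (E e y) 0.
  have -> : piece (y :: ys) = piece ys.
    by rewrite pE; apply/funext => t; rewrite /term y0 scaler0 addr0.
  exact: IH.
have yn1 : y != 0 by apply: contraNneq yn0 => ->; rewrite (bop0 be).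
have FP : F `<=` P.
  move=> t; rewrite /F /= in_itv /= andbT ltNge => st.
  by apply: contra yn1 => /s0; rewrite st => ->.
have Ff : (mu F < +oo)%E.
  by have [_ /(_ y yn1)] := simple_L1_integrable measurableT ss Ls; rewrite setTI.
have Lt : L1 term by exact: (L1_indic _ (mpre _) Ff).
have := solvesD hE (Lpiece ys) Lt (IH uys) (solves_window hE (mpre _) FP Ff y e0).
rewrite addr0 -pE -mulrDr (_ : fine _ + _ = fine (L1n (piece (y :: ys)))) //.
rewrite -/F (_ : fine (mu F) * `|E e y| = fine (L1n term)); last first.
  by rewrite (L1n_indic _ (mpre _) Ff).
have [sp _] := Lpiece ys; have [st _] := Lt.
have -> : (L1n (piece (y :: ys)) = L1n (piece ys) + L1n term)%E.
  rewrite /L1n -ge0_integralD //; try exact: measurable_normE.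
  by apply: eq_integral => t _; rewrite nE.
have fp : (L1n (piece ys) \is a fin_num)%E by rewrite (L1n_fin (Lpiece ys)).
have ft : (L1n term \is a fin_num)%E by rewrite (L1n_fin Lt).
by rewrite (fineD fp ft).
Qed.

(** First [E e] with small [e], by strong continuity and dominated
    convergence, then an approximation by simple functions. *)
Lemma smooth_simple_approx (g : R -> Y) (d : R) : L1 g -> (forall t, t <= 0 -> g t = 0) ->
  0 < d -> exists (e : R) (s : R -> Y), [/\ 0 < e, simple_fun s, L1 s,
    forall t, t <= 0 -> s t = 0 & fine (L1n (fun t => g t - E e (s t))) <= d].
Proof.
move=> Lg g0 d0; have [sg _] := Lg.
have d2 : 0 < d / 2 by rewrite divr_gt0.
have inv0 n : (0 : R) < n.+1%:R^-1 by rewrite invr_gt0.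
have Lgn n : L1 (fun t => g t - E n.+1%:R^-1 (g t)).
  by apply: L1B => //; exact: (L1_comp (sm_bE hE (ltW (inv0 n))) Lg).
have [n hn] : exists n, fine (L1n (fun t => g t - E n.+1%:R^-1 (g t))) <= d / 2.
  have cE0 x : E n.+1%:R^-1 x @[n --> \oo] --> x.
    case: (bE) => _ _ _ _ c; apply: (cvg_right_seq (c x)); first exact: cvg_harmonic.
    by apply: nearW.
  have [|||||_ + _] := @dominated_convergence _ _ R mu setT measurableT
     (fun n t => (`|g t - E n.+1%:R^-1 (g t)|)%:E) (cst 0%E)
     (fun t => ((1 + M) * `|g t|)%:E).
  - by move=> n; apply: measurable_normE; case: (Lgn n).
  - exact: measurable_cst.
  - apply: aeW => t _; apply: cvg_EFin; first exact: nearW.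
    rewrite -[X in _ --> X](@normr0 _ Y); apply: cvg_norm.
    by rewrite -[X in _ --> X](subrr (g t)); apply: cvgB; [exact: cvg_cst|exact: cE0].
  - rewrite (_ : (fun t => _) = (fun t => (1 + M)%:E * (`|g t|)%:E)%E); last first.
      by apply/funext => t; rewrite EFinM.
    by apply: integrableZl => //; exact: L1_integrable.
  - apply: aeW => t n _; rewrite /= lee_fin normr_id.
    rewrite (le_trans (ler_normB _ _)) // mulrDl mul1r lerD2l.
    exact: (sm_EM hE _ (ltW (inv0 n))).
  move=> c; have {}c : L1n (fun t => g t - E n.+1%:R^-1 (g t)) @[n --> \oo] --> 0%E.
    apply: cvg_trans c; apply: near_eq_cvg; apply: nearW => n.
    by apply: eq_integral => t _; rewrite /= subr0 normr_id.
  have /fine_cvgP[_ /cvgrPdist_le/(_ _ d2)] := c.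
  move=> [N _ hN]; exists N; have := hN N (leqnn N).
  by rewrite /= sub0r normrN ger0_norm // fine_ge0 // L1n_ge0.
set e := n.+1%:R^-1 in hn.
have M1 : 0 < M + 1 by rewrite ltr_wpDl.
have [s [ss Ls _ lims]] := L1_approx Lg.
have d3 : 0 < d / 2 / (M + 1) by rewrite divr_gt0.
have [m hm] : exists m, fine (L1n (fun t => g t - s m t)) <= d / 2 / (M + 1).
  have /fine_cvgP[_ /cvgrPdist_le/(_ _ d3)] := lims.
  move=> [N _ hN]; exists N; have := hN N (leqnn N).
  by rewrite /= sub0r normrN ger0_norm // fine_ge0 // L1n_ge0.
have mP : measurable P by exact: measurable_itv.
exists e, (cut P (s m)).
have e0 : 0 < e by exact: inv0.
have Lc : L1 (cut P (s m)) by exact: L1_cut.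
have Lgs : L1 (fun t => g t - s m t) by exact: L1B.
split => //.
- rewrite (_ : cut P (s m) = fun t => (\1_P t : R) *: s m t).
    exact: (simple2 (fun a b => (a : R) *: b) (simple_indic mP) (ss m)).
  by apply/funext => t; rewrite cutE.
- by move=> t t0; rewrite cutP ltNge t0.
have be := sm_bE hE (ltW e0).
have LA : L1 (fun t => g t - E e (g t)) := Lgn n.
have LB : L1 (fun t => M *: (g t - s m t)).
  have [s1 _] := Lgs; split; [apply: smeas_comp s1 => y; exact: scaler_continuous|].
  by rewrite L1nZ // (L1n_fin Lgs) -EFinM ltry.
have LC : L1 (fun t => g t - E e (cut P (s m) t)).
  by apply: L1B => //; exact: (L1_comp be Lc).
have [s1 _] := LA; have [s2 _] := LB; have [s3 _] := LC; have [s4 _] := Lgs.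
have : (L1n (fun t => g t - E e (cut P (s m) t))%R <=
   L1n (fun t => g t - E e (g t))%R + L1n (fun t => M *: (g t - s m t))%R)%E.
  rewrite /L1n -ge0_integralD //; try exact: measurable_normE.
  apply: ge0_le_integral => //; first exact: measurable_normE.
  - by apply: emeasurable_funD; exact: measurable_normE.
  move=> t _; rewrite -EFinD lee_fin.
  have -> : g t - E e (cut P (s m) t) = (g t - E e (g t)) + E e (g t - cut P (s m) t).
    by rewrite (bopB be) addrA subrK.
  rewrite (le_trans (ler_normD _ _)) // lerD2l (le_trans (sm_EM hE _ (ltW e0))) //.
  rewrite normrZ (ger0_norm M0) ler_wpM2l // cutP.
  by case: ltP => // t0; rewrite g0 // subr0 normr0.
rewrite (L1n_fin LC) (L1n_fin LA) (L1n_fin LB) -EFinD lee_fin => h.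
apply: (le_trans h); rewrite [leRHS]splitr lerD //.
rewrite L1nZ // (L1n_fin Lgs) -EFinM /= (ger0_norm M0).
have : d / 2 / (M + 1) * (M + 1) = d / 2 by rewrite divfK // gt_eqF.
have := ler_wpM2l M0 hm; move: d3; set b := d / 2 / (M + 1) => b0 h1.
rewrite (_ : b * (M + 1) = M * b + b); last by ring.
by move=> h2; rewrite (le_trans h1) // -h2 lerDl ltW.
Qed.

(** A telescoping series of smoothed simple functions that approximate [g]
    with errors decreasing geometrically; the L1 norms of its terms add up to
    at most three times that of [g]. *)
Lemma solves_forcing (g : R -> Y) : L1 g -> (forall t, t <= 0 -> g t = 0) ->
  solves 0 g ((M + K) * (3 * fine (L1n g))).
Proof.
move=> Lg g0; set L := fine (L1n g).
have L0 : 0 <= L by rewrite fine_ge0 // L1n_ge0.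
have [LL|Ln] := eqVneq L 0.
  rewrite LL !mulr0.
  have Lz : L1 (fun _ : R => 0 : Y) by split; [exact: (smeas_simple (simple_cst _))|
    rewrite /L1n; under eq_integral do rewrite normr0; rewrite integral0].
  apply: (@solves_series _ _ _ _ _ _ hE g (fun _ _ => 0) (fun=> 0)) => //.
  - by move=> k; exact: (solves0 hE).
  - by move=> N; rewrite big1.
  rewrite (_ : (fun n => _) = (fun=> 0%E)); first exact: cvg_cst.
  apply/funext => n; rewrite (_ : (fun t => _) = g).
    by rewrite (L1n_fin Lg) -/L LL.
  by apply/funext => t; rewrite big1 // subr0.
have Lp : 0 < L by rewrite lt_def Ln.
(* The errors are proportional to [L], which is why [L = 0] is treated apart. *)
pose dl n := L / 2 * 2^-1 ^+ n.
have dl0 n : 0 < dl n by rewrite mulr_gt0 ?divr_gt0 // exprn_gt0 // invr_gt0.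
have /choice[e /choice[s hs]] : forall n, exists (e : R) (s : R -> Y), [/\ 0 < e, simple_fun s, L1 s,
    forall t, t <= 0 -> s t = 0 & fine (L1n (fun t => g t - E e (s t))) <= dl n].
  by move=> n; exact: smooth_simple_approx.
have e0 n : 0 < e n by case: (hs n).
have ss n : simple_fun (s n) by case: (hs n).
have Ls n : L1 (s n) by case: (hs n).
have sn n t : t <= 0 -> s n t = 0 by case: (hs n) => _ _ _ + _; exact.
have app n : fine (L1n (fun t => g t - E (e n) (s n t))) <= dl n by case: (hs n).
pose T n t := E (e n) (s n t).
have LT n : L1 (T n) by exact: (L1_comp (sm_bE hE (ltW (e0 n))) (Ls n)).
pose G n t := if n is k.+1 then T k.+1 t - T k t else T 0%N t.
have LG n : L1 (G n) by case: n => [|n]; [exact: LT|exact: L1B].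
have sumG n t : \sum_(0 <= k < n.+1) G k t = T n t.
  elim: n => [|n IH]; first by rewrite big_nat1.
  by rewrite big_nat_recr //= IH addrC subrK.
have LgT n : L1 (fun t => g t - T n t) by exact: L1B.
have sG k : solves 0 (G k) ((M + K) * fine (L1n (G k))).
  case: k => [|k]; first exact: (solves_simple (e0 0%N) (ss 0%N) (Ls 0%N) (sn 0%N)).
  (* Both terms factor through [E m], so that [G k.+1] is again [E m] composed
     with a simple function. *)
  pose m := Num.min (e k.+1) (e k).
  have m0 : 0 < m by rewrite lt_min !e0.
  have m1 : 0 <= e k.+1 - m by rewrite subr_ge0 ge_min lexx.
  have m2 : 0 <= e k - m by rewrite subr_ge0 ge_min lexx orbT.
  pose r t := E (e k.+1 - m) (s k.+1 t) - E (e k - m) (s k t).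
  have GE : G k.+1 = E m \o r.
    apply/funext => t; rewrite /G /T /r /= (bopB (sm_bE hE (ltW m0))).
    by case: (bE) => _ _ _ D _; rewrite -!D ?(ltW m0) // ![m + _]addrC !subrK.
  rewrite GE; apply: solves_simple => //.
  - exact: (simple2 (fun a b => E (e k.+1 - m) a - E (e k - m) b) (ss k.+1) (ss k)).
  - by apply: L1B; [exact: (L1_comp (sm_bE hE m1) (Ls _))|exact: (L1_comp (sm_bE hE m2) (Ls _))].
  - by move=> t t0; rewrite /r !sn // (bop0 (sm_bE hE m1)) (bop0 (sm_bE hE m2)) subrr.
have fn0 k : 0 <= fine (L1n (G k)) by rewrite fine_ge0 // L1n_ge0.
have G0 : fine (L1n (G 0%N)) <= L + dl 0%N.
  have [s1 _] := Lg; have [s2 _] := LgT 0%N.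
  have h : (L1n (G 0%N) <= L1n g + L1n (fun t => g t - T 0%N t)%R)%E.
    apply: le_trans (L1nB s1 s2); rewrite le_eqVlt; apply/orP; left; apply/eqP.
    by apply: eq_integral => t _; rewrite subKr.
  move: h; rewrite (L1n_fin (LG 0%N)) (L1n_fin Lg) (L1n_fin (LgT 0%N)) -EFinD lee_fin.
  by move=> h; rewrite (le_trans h) // lerD2l; exact: app.
have GS k : fine (L1n (G k.+1)) <= dl k + dl k.+1.
  have [s1 _] := LgT k; have [s2 _] := LgT k.+1.
  have h : (L1n (G k.+1) <= L1n (fun t => g t - T k t)%R + L1n (fun t => g t - T k.+1 t)%R)%E.
    apply: le_trans (L1nB s1 s2); rewrite le_eqVlt; apply/orP; left; apply/eqP.
    by apply: eq_integral => t _; congr (`|_|%:E); rewrite opprB [RHS]addrC addrA subrK.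
  move: h; rewrite (L1n_fin (LG k.+1)) (L1n_fin (LgT k)) (L1n_fin (LgT k.+1)) -EFinD lee_fin.
  by move=> h; rewrite (le_trans h) // lerD //; exact: app.
have sumL N : \sum_(0 <= k < N.+1) fine (L1n (G k)) <= 3 * L - 3 * dl N.
  elim: N => [|N IH].
    rewrite big_nat1; apply: (le_trans G0); rewrite /dl expr0 mulr1; lra.
  rewrite big_nat_recr //= (le_trans (lerD IH (GS N))) //.
  have -> : dl N.+1 = dl N / 2 by rewrite /dl exprSr mulrA.
  lra.
apply: (@solves_series _ _ _ _ _ _ hE g G (fun k => (M + K) * fine (L1n (G k)))) => //.
- by move=> k; rewrite mulr_ge0.
- move=> N; rewrite -mulr_sumr ler_wpM2l //.
  case: N => [|N]; first by rewrite big_geq // mulr_ge0.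
  by rewrite (le_trans (sumL N)) // lerBlDr lerDl mulr_ge0 // ltW.
have dlc : dl n @[n --> \oo] --> (0 : R).
  rewrite -[X in _ --> X](mulr0 (L / 2)); apply: cvgMr; apply: cvg_expr.
  by rewrite ger0_norm ?invr_ge0 // invf_lt1 // ltr1n.
have cv : L1n (fun t => g t - T n t) @[n --> \oo] --> 0%E.
  apply: (@squeeze_cvge _ _ _ _ (cst 0%E) _ (fun n => (dl n)%:E)).
  - apply: nearW => n; rewrite /= L1n_ge0 /= (L1n_fin (LgT n)) lee_fin; exact: app.
  - exact: cvg_cst.
  - by apply: cvg_EFin => //; exact: nearW.
rewrite -cvg_shiftS; apply: cvg_trans cv; apply: near_eq_cvg; apply: nearW => n /=.
by congr L1n; apply/funext => t; rewrite sumG.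
Qed.

Theorem mild_solution (x : Y) (g : R -> Y) : L1 g -> (forall t, t <= 0 -> g t = 0) ->
  solves x g ((M + K) * `|x| + (M + K) * (3 * fine (L1n g))).
Proof.
move=> Lg g0.
have Lz : L1 (fun _ : R => 0 : Y) by split; [exact: (smeas_simple (simple_cst _))|
    rewrite /L1n; under eq_integral do rewrite normr0; rewrite integral0].
have := solvesD hE Lz Lg (solves_initial hE x) (solves_forcing Lg g0).
rewrite addr0 (_ : (fun t => 0 + g t) = g) //.
by apply/funext => t; rewrite add0r.
Qed.

End forcing.

(** * The lemma of du Bois-Reymond *)

Section du_bois_reymond.
Context {R : realType}.
Local Notation mu := (@lebesgue_measure R).

Lemma derivable_vderiv (F : R -> R) t : derivable F t 1 ->
  vderiv (F : R -> R^o) t (derive1 F t).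
Proof.
move=> dF e e0.
have := dF; rewrite /derivable => /cvg_ex[d cd].
have dE : derive1 F t = d.
  by rewrite derive1E; exact: (cvg_lim (@norm_hausdorff R R^o) cd).
rewrite dE; move/cvgrPdist_le: cd => /(_ e e0).
rewrite near_withinE => -[a /= a0 ha]; exists a => // h hh.
have [->|h0] := eqVneq h 0.
  by rewrite addr0 subrr scale0r subr0 !normr0 mulr0.
rewrite -(@quot_dist R (R^o : normedModType R)) //.
have := ha h; rewrite /ball_ /= sub0r normrN => /(_ hh h0).
by rewrite [h *: 1]mulr1 [h + t]addrC.
Qed.

(** Since [psi] vanishes outside the interval, its primitive is constant on
    both sides and differentiable on the whole line. *)
Lemma primitive_ex (psi : R -> R) (a b : R) : a < b -> continuous psi ->
  (forall t, ~~ (a < t < b) -> psi t = 0) ->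
  exists Phi : R -> R, [/\ forall t, derivable Phi t 1, derive1 Phi = psi,
    forall t, t <= a -> Phi t = 0 &
    forall t, b <= t -> Phi t = \int[mu]_(t in `[a, b]) psi t].
Proof.
move=> ab cpsi psi0.
have [M M0 hM] := continuous_bounded_itv (fun t _ => cpsi t) (a := a) (b := b).
have bd t : `|psi t| <= M.
  have [/hM//|h] := boolP (a <= t <= b).
  by rewrite psi0 ?normr0 //; apply: contra h => /andP[/ltW -> /ltW ->].
have ip : mu.-integrable setT (EFin \o psi).
  have L : L1 (psi : R -> R^o).
    apply: (@L1_bounded_itv R (R^o : normedModType R) psi a b M) => //.
      exact: smeas_continuous.
    by move=> t h; apply: psi0; apply: contra h => /andP[/ltW -> /ltW ->].
  exact: (dual_integrable (@bop_id _ (R^o : normedModType R)) L).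
have D t : derivable (fun u : R => \int[mu]_(s in `]-oo, u]) psi s) t 1 /\
    derive1 (fun u : R => \int[mu]_(s in `]-oo, u]) psi s) t = psi t.
  have t1 : t < t + 1 by rewrite ltrDl.
  have iu : mu.-integrable [set` Interval (BInfty R true) (BRight (t + 1))] (EFin \o psi).
    by apply: integrableS ip.
  exact: (continuous_FTC1 t1 iu (ltNyr t) (cpsi t)).
exists (fun u => \int[mu]_(s in `]-oo, u]) psi s); split.
- by move=> t; case: (D t).
- by apply/funext => t; case: (D t).
- move=> t ta; transitivity (\int[mu]_(s in `]-oo, t]) (0 : R)); last first.
    by rewrite /Rintegral integral0.
  apply: eq_Rintegral => s; rewrite inE /= in_itv /= => st.
  by apply: psi0; rewrite [a < s]ltNge (le_trans st ta).
- move=> t bt; transitivity (\int[mu]_s psi s).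
    symmetry; apply: Rintegral_supp => // s; rewrite /= in_itv /= => /negP.
    by rewrite -ltNge => ts; apply: psi0; rewrite [s < b]ltNge (le_trans bt (ltW ts)) andbF.
  apply: Rintegral_supp => // s; rewrite /= in_itv /= => /negP h; apply: psi0.
  by apply: contra h => /andP[/ltW -> /ltW ->].
Qed.

(** A primitive is nondecreasing and takes the same value at both ends, so it
    is constant. *)
Lemma ge0_integral_eq0 (F : R -> R) (a b : R) : a < b -> continuous F ->
  (forall t, ~~ (a < t < b) -> F t = 0) -> (forall t, 0 <= F t) ->
  \int[mu]_(t in `[a, b]) F t = 0 -> forall t, F t = 0.
Proof.
move=> ab cF F0 Fp I0.
have [G [dG GE Ga Gb]] := primitive_ex ab cF F0.
have cG : continuous G.
  by move=> t; apply/differentiable_continuous/derivable1_diffP.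
have mono s t : s < t -> G s <= G t.
  move=> st; rewrite -subr_ge0.
  have [|x xst ->] := @MVT R G F s t st _ (continuous_subspaceT cG).
    by move=> x _; rewrite -GE derive1E; exact: derivableP.
  by rewrite mulr_ge0 // subr_ge0 ltW.
have Ga0 := Ga a (lexx a); have Gb0 : G b = 0 by rewrite Gb.
move=> t; have [/andP[ta tb]|/F0//] := boolP (a < t < b).
rewrite -GE derive1E (near_eq_derive (g := cst 0)) ?derive_cst //.
near=> s; apply/eqP; rewrite eq_le; apply/andP; split.
  rewrite -Gb0; apply: mono; near: s; exact: lt_nbhsl.
by rewrite -Ga0; apply: mono; near: s; exact: lt_nbhsr.
Unshelve. all: by end_near. Qed.

Lemma continuous_maxr (f g : R -> R) : continuous f -> continuous g ->
  continuous (fun t => Num.max (f t) (g t)).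
Proof.
move=> cf cg; rewrite (_ : (fun t => _) = (fun t => (f t + g t + `|f t - g t|) / 2)).
  move=> t; apply: cvgMl; apply: cvgD; first by apply: cvgD; [exact: cf|exact: cg].
  by apply: cvg_norm; apply: cvgB; [exact: cf|exact: cg].
by apply/funext => t; rewrite maxr_absE.
Qed.

Lemma continuous_minr (f g : R -> R) : continuous f -> continuous g ->
  continuous (fun t => Num.min (f t) (g t)).
Proof.
move=> cf cg; rewrite (_ : (fun t => _) = (fun t => (f t + g t - `|f t - g t|) / 2)).
  move=> t; apply: cvgMl; apply: cvgB; first by apply: cvgD; [exact: cf|exact: cg].
  by apply: cvg_norm; apply: cvgB; [exact: cf|exact: cg].
by apply/funext => t; rewrite minr_absE.
Qed.

(** Let [K] be a primitive of [k] and [rho = r - K], whose weak derivative is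
    zero. With a bump [chi] and the [chi]-weighted mean [c] of [rho], the
    function [(rho - c) * chi] has integral zero, so its primitive is a test
    function. Testing with it gives that [(rho - c)^2 * chi] has integral
    zero, whence [rho = c]. *)
Lemma du_bois_reymond (r k : R -> R) (a b : R) : a < b -> continuous r ->
  continuous k ->
  (forall phi : R -> R, (forall t, derivable phi t 1) -> continuous (derive1 phi) ->
     (forall t, ~~ (a < t < b) -> phi t = 0) ->
     \int[mu]_(t in `[a, b]) (derive1 phi t * r t) =
     - \int[mu]_(t in `[a, b]) (phi t * k t)) ->
  forall t, a < t < b -> vderiv (r : R -> R^o) t (k t).
Proof.
move=> ab cr ck weak.
have cmul (f g : R -> R) : continuous f -> continuous g -> continuous (fun t => f t * g t).
  by move=> cf cg t; apply: cvgM; [exact: cf|exact: cg].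
have cbump (c d : R) : continuous (fun t : R => Num.max 0 (Num.min (t - c) (d - t))).
  apply: continuous_maxr; first exact: cst_continuous.
  apply: continuous_minr => t.
    by apply: cvgB; [exact: cvg_id|exact: cvg_cst].
  by apply: cvgB; [exact: cvg_cst|exact: cvg_id].
have bump0 (c d t : R) : ~~ (c < t < d) -> Num.max 0 (Num.min (t - c) (d - t)) = 0.
  rewrite negb_and -!leNgt => h; apply: max_l; rewrite ge_min !subr_le0; exact: h.
(* The cut-off [eta], equal to 1 on [[a, b]], confines [k] to a bounded
   interval on which it has a primitive. *)
pose eta t := Num.min 1 (Num.max 0 (Num.min (t - (a - 1)) (b + 1 - t))).
have ceta : continuous eta.
  by apply: continuous_minr; [exact: cst_continuous|exact: cbump].
have eta1 t : a <= t <= b -> eta t = 1.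
  move=> /andP[ta tb]; apply: min_l; rewrite le_max; apply/orP; right.
  by rewrite le_min; apply/andP; split; lra.
have eta0 t : ~~ (a - 1 < t < b + 1) -> eta t = 0.
  by move=> h; rewrite /eta bump0 //; apply: min_r.
have ab1 : a - 1 < b + 1 by lra.
have ck1 := cmul _ _ ck ceta.
have [|K [dK KE _ _]] := primitive_ex ab1 ck1; first by move=> t /eta0 ->; rewrite mulr0.
have cK : continuous K.
  by move=> t; apply/differentiable_continuous/derivable1_diffP.
have KV t : vderiv (K : R -> R^o) t (k t * eta t).
  by have := derivable_vderiv (dK t); rewrite KE.
pose rho t := r t - K t.
have crho : continuous rho by move=> t; apply: cvgB; [exact: cr|exact: cK].
pose chi t := Num.max 0 (Num.min (t - a) (b - t)).
have cchi : continuous chi by exact: cbump.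
have chi0 t : ~~ (a < t < b) -> chi t = 0 by exact: bump0.
have chi_ge0 t : 0 <= chi t by rewrite le_max lexx.
have chip t : a < t < b -> 0 < chi t.
  by move=> /andP[ta tb]; rewrite lt_max lt_min !subr_gt0 ta tb orbT.
pose I := \int[mu]_(t in `[a, b]) chi t.
have I0 : I != 0.
  apply/eqP => Iz; have mid : a < (a + b) / 2 < b by apply/andP; split; lra.
  have := ge0_integral_eq0 ab cchi chi0 chi_ge0 Iz ((a + b) / 2) => h.
  by have := chip _ mid; rewrite h ltxx.
have ii f : continuous f -> mu.-integrable `[a, b] (EFin \o f).
  exact: continuous_itv_integrable.
have mI : measurable (`[a, b]%classic : set R) by exact: measurable_itv.
pose c := (\int[mu]_(t in `[a, b]) (rho t * chi t)) / I.
pose psi t := (rho t - c) * chi t.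
have crc : continuous (fun t => rho t - c).
  by move=> t; apply: cvgB; [exact: crho|exact: cvg_cst].
have cpsi : continuous psi by exact: cmul.
have psi0 t : ~~ (a < t < b) -> psi t = 0 by move=> /chi0 h; rewrite /psi h mulr0.
have psiI : \int[mu]_(t in `[a, b]) psi t = 0.
  transitivity (\int[mu]_(t in `[a, b]) (rho t * chi t) - \int[mu]_(t in `[a, b]) (c * chi t)).
    rewrite -RintegralB //; first by apply: eq_Rintegral => t _; rewrite /psi mulrBl.
    - by apply: ii; exact: cmul.
    - by apply: ii; apply: cmul => //; exact: cst_continuous.
  by rewrite RintegralZl //; [rewrite -/I /c divfK // subrr|exact: ii].
have [phi [dphi phiE phia phib]] := primitive_ex ab cpsi psi0.
have phi0 t : ~~ (a < t < b) -> phi t = 0.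
  by rewrite negb_and -!leNgt => /orP[/phia//|/phib ->].
have cphi : continuous phi.
  by move=> t; apply/differentiable_continuous/derivable1_diffP.
have cd : continuous (derive1 phi) by rewrite phiE.
have w := weak phi dphi cd phi0.
have pa : phi a = 0 by rewrite phi0 // ltxx.
have pb : phi b = 0 by rewrite phi0 // ltxx andbF.
have := parts ab dphi cd cK ck1 (fun t _ => KV t).
rewrite pa pb !mul0r subrr sub0r => w2.
have w3 : \int[mu]_(t in `[a, b]) (phi t * (k t * eta t)) = \int[mu]_(t in `[a, b]) (phi t * k t).
  by apply: eq_Rintegral => t; rewrite inE /= in_itv /= => /eta1 ->; rewrite mulr1.
rewrite w3 -w phiE in w2.
have sq : \int[mu]_(t in `[a, b]) ((rho t - c) * psi t) = 0.
  transitivity (\int[mu]_(t in `[a, b]) (psi t * r t) - \int[mu]_(t in `[a, b]) (psi t * K t)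
    - \int[mu]_(t in `[a, b]) (c * psi t)).
    rewrite -!RintegralB //; try (by apply: ii; apply: cmul => //; exact: cst_continuous).
      by apply: eq_Rintegral => t _; rewrite /rho; ring.
    rewrite (_ : _ \o _ = EFin \o (fun t => psi t * r t - psi t * K t)) //.
    by apply: ii => t; apply: cvgB; apply: cmul.
  by rewrite w2 subrr sub0r RintegralZl ?psiI ?mulr0 ?oppr0 //; exact: ii.
have z := ge0_integral_eq0 ab (cmul _ _ crc cpsi) _ _ sq.
have rc t : a < t < b -> rho t = c.
  move=> tab; have : (rho t - c) * psi t = 0.
    apply: z => s; first by move=> /psi0 ->; rewrite mulr0.
    by rewrite /psi mulrA mulr_ge0 // -expr2 sqr_ge0.
  move/eqP; rewrite /psi !mulf_eq0 (gt_eqF (chip _ tab)) orbF orbb subr_eq0.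
  by move/eqP.
move=> t /andP[ta tb] e e0.
have [d d0 hd] := KV t e e0.
exists (Num.min d (Num.min (t - a) (b - t))); first by rewrite !lt_min d0 !subr_gt0 ta.
move=> h; rewrite !lt_min => /and3P[h1 h2 h3].
have th : a < t + h < b.
  by move: h2 h3; rewrite !ltr_norml => /andP[? ?] /andP[? ?]; apply/andP; split; lra.
have := hd h h1; rewrite eta1 ?(ltW ta) ?(ltW tb) // mulr1.
have := rc _ th; have := rc t; rewrite ta tb => /(_ isT); rewrite /rho => e1 e2.
have -> : r (t + h) = c + K (t + h) by rewrite -e2 subrK.
have -> : r t = c + K t by rewrite -e1 subrK.
by rewrite opprD addrACA subrr add0r.
Qed.

(** The continuity of [k] makes the remainder uniform over functionals of norm
    at most 1. *)
Lemma dual_vderiv {V : normedModType R} (Z k : R -> V) (a b : R) :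
  continuous Z -> continuous k ->
  (forall l : V -> R^o, bop l -> forall t, a < t < b -> vderiv (fun s => l (Z s)) t (l (k t))) ->
  forall t, a < t < b -> vderiv Z t (k t).
Proof.
move=> cZ ck dv t /andP[ta tb] e e0.
have /cvgrPdist_le/(_ e e0) [d /= d0 hd] := ck t.
exists (Num.min d (Num.min (t - a) (b - t))); first by rewrite !lt_min d0 !subr_gt0 ta.
move=> h; rewrite !lt_min => /and3P[h1 h2 h3].
apply: norm_le_dual => l bl l1.
pose f s : R^o := l (Z s) - s * l (k t).
have cf : continuous f.
  move=> s; apply: cvgB; first by apply: (cvg_comp _ _ (cZ s)); exact: (bop_continuous bl).
  by apply: cvgMl; exact: cvg_id.
have df s : a < s < b -> vderiv f s (l (k s) - l (k t)).
  move=> sab e' e'0; have [d' d'0 hd'] := dv l bl s sab e' e'0.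
  exists d' => // h' /hd'; apply: le_trans; rewrite le_eqVlt; apply/orP; left; apply/eqP.
  congr (`|_|); rewrite /f /GRing.scale /=; ring.
have bnd s : `|s - t| < d -> `|l (k s) - l (k t) : R^o| <= e.
  move=> sd; rewrite -(bopB bl) (le_trans (l1 _)) // distrC; apply: hd.
  by rewrite /ball_ /= distrC.
have goalE : (l (Z (t + h) - Z t - h *: k t) : R) = f (t + h) - f t.
  by rewrite /f !(bopB bl) (bopZ bl) /GRing.scale /=; ring.
rewrite goalE; apply: (le_trans (ler_norm _)).
move: h2 h3; rewrite !ltr_norml => /andP[? ?] /andP[? ?].
have [h0|h0] := leP 0 h.
  rewrite (ger0_norm h0) in h1 *.
  rewrite [X in e * X](_ : h = t + h - t); last by rewrite addrC addKr.
  apply: (@mean_value R R^o f (fun s => l (k s) - l (k t))) => //; first by rewrite lerDl.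
  - by move=> s /andP[? ?]; apply: df; apply/andP; split; lra.
  - by move=> s /andP[? ?]; apply: bnd; rewrite ger0_norm ?subr_ge0; lra.
rewrite (ltr0_norm h0) in h1 *; rewrite distrC.
rewrite [X in e * X](_ : - h = t - (t + h)); last by rewrite opprD addNKr.
apply: (@mean_value R R^o f (fun s => l (k s) - l (k t))) => //; first by rewrite gerDl ltW.
- by move=> s /andP[? ?]; apply: df; apply/andP; split; lra.
- by move=> s /andP[? ?]; apply: bnd; rewrite ltr0_norm ?subr_lt0; lra.
Qed.

End du_bois_reymond.

(** * Uniqueness *)

Section uniqueness.
Context {R : realType} {Y : completeNormedModType R}.
Local Notation mu := (@lebesgue_measure R).
Variables (M K : R) (E S : R -> Y -> Y).
Hypothesis hE : smoothing M K E S.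
Let bE := sm_sg hE.
Let M0 := sm_M0 hE.

(** The product rule: moving backwards along the semigroup compensates the
    growth of [Z]. *)
Lemma transport_vderiv (Z : R -> Y) (t0 tau : R) d : tau < t0 ->
  vderiv Z tau d -> right_gen E (Z tau) d ->
  vderiv (fun s => flow E (Z s) (t0 - s)) tau 0.
Proof.
move=> tt Zd gZ e e0; set sg := t0 - tau.
have sg0 : 0 < sg by rewrite subr_gt0.
have M2 : 0 < M + 2 by rewrite ltr_wpDl.
have e1 : 0 < e / (M + 2) by rewrite divr_gt0.
have [a1 a10 h1] := Zd _ e1.
have [a2 a20 h2] := flow_vderiv bE gZ sg0 e1.
have cfl : continuous (flow E d) := flow_continuous bE.
have /cvgrPdist_le/(_ _ e1) [a3 /= a30 h3] := cfl sg.
exists (Num.min (Num.min a1 a2) (Num.min a3 sg)).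
  by rewrite !lt_min a10 a20 a30 sg0.
move=> h; rewrite !lt_min -andbA => /and4P[ha1 ha2 ha3 ha].
have sh : 0 <= sg - h by move: ha; rewrite ltr_norml => /andP[_ ?]; rewrite subr_ge0 ltW.
have bsh := sm_bE hE sh.
have E1 := h1 h ha1.
have := h2 (- h); rewrite normrN => /(_ ha2) E2.
have := h3 (sg - h); rewrite /ball_ /= [sg - (sg - h)]subKr => /(_ ha3) E3.
have -> : t0 - (tau + h) = sg - h by rewrite opprD addrA.
rewrite scaler0 subr0 !flowE ?(ltW sg0) // in E2 E3 *.
have -> : E (sg - h) (Z (tau + h)) - E sg (Z tau) =
    E (sg - h) (Z (tau + h) - Z tau - h *: d) +
    (E (sg - h) (Z tau) - E sg (Z tau) - (- h) *: E sg d) -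
    h *: (E sg d - E (sg - h) d).
  apply: eq_dual => l bl; rewrite !(bopB bsh) (bopZ bsh).
  by rewrite scaleNr !(bopB bl, bopD bl, bopN bl, bopZ bl); ring.
rewrite (le_trans (ler_normB _ _)) // (le_trans (lerD (ler_normD _ _) (lexx _))) //.
have F1 : `|E (sg - h) (Z (tau + h) - Z tau - h *: d)| <= M * (e / (M + 2) * `|h|).
  by rewrite (le_trans (sm_EM hE _ sh)) // ler_wpM2l.
have F3 : `|h *: (E sg d - E (sg - h) d)| <= e / (M + 2) * `|h|.
  by rewrite normrZ mulrC ler_wpM2r.
rewrite (le_trans (lerD (lerD F1 E2) F3)) // le_eqVlt; apply/orP; left; apply/eqP.
have eE : e = e / (M + 2) * (M + 2) by rewrite divfK // gt_eqF.
by rewrite [in RHS]eE; ring.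
Qed.

Lemma transport_continuous (Z : R -> Y) (t0 : R) : continuous Z ->
  continuous (fun s => flow E (Z s) (t0 - s)).
Proof.
move=> cZ t; apply/cvgrPdist_le => e e0.
have M2 : 0 < M + 1 by rewrite ltr_wpDl.
have e2 : 0 < e / 2 by rewrite divr_gt0.
have e3 : 0 < e / 2 / (M + 1) by rewrite divr_gt0.
have c1 : (fun s => flow E (Z t) (t0 - s)) s @[s --> t] --> flow E (Z t) (t0 - t).
  apply: (@continuous_comp R R Y (fun s : R => t0 - s) (flow E (Z t)) t).
    by apply: cvgB; [exact: cvg_cst|exact: cvg_id].
  exact: (flow_continuous bE).
near=> s.
have h1 : `|flow E (Z t) (t0 - t) - flow E (Z t) (t0 - s)| <= e / 2.
  by near: s; move/cvgrPdist_le: c1; apply.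
have h2 : `|Z t - Z s| <= e / 2 / (M + 1).
  by near: s; move/cvgrPdist_le: (cZ t); apply.
have m0 : 0 <= Num.max (t0 - s) 0 by rewrite le_max lexx orbT.
rewrite -[flow E (Z t) (t0 - t)](subrK (flow E (Z t) (t0 - s))) -addrA.
rewrite (le_trans (ler_normD _ _)) // [leRHS]splitr lerD //.
rewrite /flow -(bopB (sm_bE hE m0)) (le_trans (sm_EM hE _ m0)) //.
apply: (le_trans (ler_wpM2l M0 h2)).
have : e / 2 / (M + 1) * (M + 1) = e / 2 by rewrite divfK // gt_eqF.
by rewrite mulrDr mulr1 mulrC => {2}<-; rewrite lerDl ltW.
Unshelve. all: by end_near. Qed.

Lemma time_extend (T : \bar R) (t : R) : (t%:E < T)%E ->
  exists2 b, t < b & (b%:E < T)%E.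
Proof.
case: T => [r| |] //= tr; last by exists (t + 1); [rewrite ltrDl|exact: ltry].
by rewrite lte_fin in tr; exists ((t + r) / 2); rewrite ?lte_fin; lra.
Qed.

Lemma derive1_off (phi : R -> R) (a b t : R) :
  (forall s, ~~ (a < s < b) -> phi s = 0) -> ~~ (a <= t <= b) -> derive1 phi t = 0.
Proof.
move=> phi0 tab; have hz : \forall u \near t, phi u = 0.
  move: tab; rewrite negb_and -!ltNge => /orP[ta|bt]; near=> u; apply: phi0.
    by rewrite [a < u]ltNge ltW //; near: u; exact: lt_nbhsl.
  by rewrite [u < b]ltNge ltW ?andbF //; near: u; exact: lt_nbhsr.
rewrite derive1E (near_eq_derive (g := cst 0)) ?derive_cst //.
Unshelve. all: by end_near. Qed.

Section homogeneous.
Variables (T : \bar R) (w h : R -> Y).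
Hypothesis cw : {within halfopen_time T, continuous w}.
Hypothesis Lh : L1 h.
Hypothesis wh : {ae mu, forall t, open_time T t -> smooth_graph E S (w t) (h t)}.
Hypothesis dw : dual_derivative T w h.

(** Smoothing by [E e] turns the weak equation into one with a continuous
    right-hand side, [S e (w t)]; then [E e w] is differentiable in the
    ordinary sense, and its transport to time [t0] has derivative zero. *)
Lemma transported_constant (a t0 e : R) : 0 < a < t0 -> (t0%:E < T)%E -> 0 < e ->
  E e (w t0) = E (t0 - a) (E e (w a)).
Proof.
move=> /andP[a0 at0] tT e0; have [b tb bT] := time_extend tT.
have ab := lt_trans at0 tb.
have be := sm_bE hE (ltW e0); have se := sm_S hE e0.
(* Freezing [w] outside [[a, b]] gives a continuous function on the line that
   agrees with [w] where test functions live. *)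
pose clamp t := Num.max a (Num.min t b).
have ccl : continuous clamp.
  apply: continuous_maxr; first exact: cst_continuous.
  by apply: continuous_minr; [move=> t; exact: cvg_id|exact: cst_continuous].
have clE t : a <= t <= b -> clamp t = t.
  by move=> /andP[ta tb']; rewrite /clamp min_l // max_r.
have clab t : a <= clamp t <= b.
  by rewrite le_max lexx /= ge_max (ltW ab) ge_min lexx orbT.
have opn t : a <= t <= b -> open_time T t.
  move=> /andP[ta tb']; split; first exact: lt_le_trans a0 ta.
  by rewrite (le_lt_trans _ bT) // lee_fin.
pose W t := w (clamp t).
have cW : continuous W.
  move=> t; apply: (@continuous_comp R R Y clamp w t); first exact: ccl.
  by apply: (halfopen_continuous cw); apply: opn.
pose Z t := E e (W t); pose k t := S e (W t).
have cZ : continuous Z by move=> t; apply: (cvg_comp _ _ (cW t)); exact: (bop_continuous be).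
have ck : continuous k by move=> t; apply: (cvg_comp _ _ (cW t)); exact: (bop_continuous se).
have Zk : forall t, a < t < b -> vderiv Z t (k t).
  apply: dual_vderiv => // l bl.
  have cl (f : R -> Y) : continuous f -> continuous (fun t => l (f t) : R).
    by move=> cf t; apply: (cvg_comp _ _ (cf t)); exact: (bop_continuous bl).
  apply: (@du_bois_reymond R (fun t => l (Z t)) (fun t => l (k t)) a b ab (cl _ cZ) (cl _ ck)).
  move=> phi dphi cd phi0.
  have cphi : continuous phi.
    by move=> t; apply/differentiable_continuous/derivable1_diffP.
  have tphi : test_function T phi.
    split => //; exists a, b; split => // t tab; apply: phi0.
    by apply: contra tab => /andP[/ltW -> /ltW ->].
  have := dw tphi (bop_comp bl be).
  have -> : \int[mu]_t (derive1 phi t * (l \o E e) (cut (open_time T) w t) : R) =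
      \int[mu]_(t in `[a, b]) (derive1 phi t * l (Z t) : R).
    apply: Rintegral_supp => t; rewrite /= in_itv /= => tab; last first.
      by rewrite (derive1_off phi0) ?mul0r //; exact/negP.
    by rewrite /cut mem_set ?/Z ?/W ?clE //; exact: opn.
  move=> ->; congr (- _).
  transitivity (\int[mu]_t (phi t * l (k t) : R)); last first.
    apply: Rintegral_supp => // t; rewrite /= in_itv /= => /negP tab.
    by rewrite phi0 ?mul0r //; apply: contra tab => /andP[/ltW -> /ltW ->].
  rewrite /Rintegral; congr fine; apply: ae_eq_integral => //.
  - apply/measurable_EFinP; apply: measurable_funM; first exact: continuous_measurable_fun.
    have [sh _] := Lh; apply: smeas_measurable.
    exact: (smeas_comp (bop_continuous (bop_comp bl be)) sh).
  - apply/measurable_EFinP; apply: measurable_funM; first exact: continuous_measurable_fun.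
    exact: (continuous_measurable_fun (cl _ ck)).
  apply: ae_imp wh => t hwt _; congr EFin => /=.
  have [/andP[ta tb']|tab] := boolP (a < t < b); last by rewrite phi0 // !mul0r.
  have tab : a <= t <= b by rewrite !ltW.
  by rewrite /k /W clE // (hwt (opn t tab)).
pose v s := flow E (Z s) (t0 - s).
have cv : continuous v by exact: transport_continuous.
have /eqP : v t0 == v a.
  rewrite -subr_eq0 -normr_le0 -(mul0r (t0 - a)).
  apply: (@mean_value R Y v (fun=> 0) a t0 0 (ltW at0) cv) => t /andP[ta tt0]; last first.
    by rewrite normr0.
  have tab : a < t < b by rewrite ta (lt_trans tt0).
  apply: (transport_vderiv tt0 (Zk t tab)).
  exact: (sm_gen hE).
rewrite /v subrr !flowE ?subr_ge0 ?(ltW at0) // /Z /W !clE ?lexx ?(ltW ab) ?(ltW at0) ?(ltW tb) //.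
by case: (bE) => _ _ -> _ _.
Qed.

(** As [a] tends to 0, [w a] tends to 0 while the semigroup stays bounded, so
    [E e (w t) = 0] for all [e > 0]; then [e] tends to 0. *)
Lemma homogeneous_zero : w 0 = 0 -> forall t, halfopen_time T t -> w t = 0.
Proof.
move=> w0 t [t0 tT]; move: t0; rewrite le_eqVlt => /predU1P[<- //|t0].
have Ez (e : R) : 0 < e -> E e (w t) = 0.
  move=> e0; apply/eqP; rewrite -normr_le0; apply/ler_addgt0Pl => d d0; rewrite addr0.
  have M1 : 0 < M * M + 1 by rewrite ltr_wpDl // mulr_ge0.
  have [a [a0 at0 wa]] : exists a, [/\ 0 < a, a < t & `|w a| <= d / (M * M + 1)].
    have h00 : halfopen_time T 0 by split => //; apply: le_lt_trans tT; rewrite lee_fin ltW.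
    have /subspace_continuousP/(_ 0 h00)/cvgrPdist_le/(_ _ (divr_gt0 d0 M1)) := cw.
    rewrite near_withinE => -[c /= c0 hc].
    pose a := Num.min (c / 2) (t / 2).
    have a0 : 0 < a by rewrite lt_min !divr_gt0.
    have ac : a < c by rewrite /a gt_min ltr_pdivrMr // ltr_pMr // ltr1n.
    have at0 : a < t by rewrite /a gt_min orbC ltr_pdivrMr // ltr_pMr // ltr1n.
    exists a; split => //.
    have ba : ball_ (fun x : R => `|x|) 0 c a by rewrite /ball_ /= sub0r normrN gtr0_norm.
    have ha : halfopen_time T a by split; [exact: ltW|apply: lt_trans tT; rewrite lte_fin].
    by have := hc a ba ha; rewrite /from_subspace /= w0 sub0r normrN.
  rewrite (@transported_constant a t e) ?a0 //.
  have sa : 0 <= t - a by rewrite subr_ge0 ltW.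
  rewrite (le_trans (sm_EM hE _ sa)) //.
  rewrite (le_trans (ler_wpM2l M0 (sm_EM hE _ (ltW e0)))) // mulrA.
  have MM : 0 <= M * M by rewrite mulr_ge0.
  apply: (le_trans (ler_wpM2l MM wa)).
  have : d / (M * M + 1) * (M * M + 1) = d by rewrite divfK // gt_eqF.
  by rewrite mulrDr mulr1 mulrC => {2}<-; rewrite lerDl ltW // divr_gt0.
apply/eqP; rewrite -normr_le0; apply/ler_addgt0Pl => d d0; rewrite addr0.
have [a a0 ha] := right_cont_modulus (w t) bE d0.
have a2 : 0 < a / 2 by rewrite divr_gt0.
have := ha (a / 2); rewrite Ez // sub0r normrN => -> //.
by rewrite ltW //= ltr_pdivrMr // ltr_pMr // ltr1n.
Qed.

End homogeneous.
End uniqueness.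

(** * The Cauchy problem in the completion *)

Section linear_maps.
Context {R : realType}.

Lemma bop_of_linear {V W : normedModType R} (f : {linear V -> W}) :
  continuous f -> bop f.
Proof.
move=> cf; split; first by move=> a x y; rewrite linearP.
have [/(_ cf) /linear_boundedP [r [_ hr]] _] : (continuous f -> bounded_near f (nbhs 0)) /\ True.
  by split => //; move/linear_bounded_continuous.
exists (r + 1); apply: hr; by rewrite ltrDl.
Qed.

Lemma bop_linear {V W : normedModType R} (f : V -> W) : bop f -> linear f.
Proof. by case=> lf _ a x y; rewrite lf. Qed.

(** [xget] returns the extension because a continuous map is determined by its
    values on a dense set. *)
Lemma continuous_extensionE {X : Type} {U V : normedModType R} (j : X -> U) (j' : X -> V)
    (D : set X) (L : X -> X) (K : U -> V) : dense (j @` D) -> bop K ->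
  (forall x, D x -> K (j x) = j' (L x)) ->
  continuous_extension j j' D L = K.
Proof.
move=> dD bK KL; apply: xget_unique.
  by split => //; [exact: bop_linear|exact: bop_continuous].
move=> K' [lK' cK' K'L]; apply/funext => y.
have lK'' : GRing.linear_for *:%R K' by [].
pose m := GRing.isLinear.Build _ _ _ _ K' lK''.
pose K'l : {linear U -> V} := HB.pack K' m.
have bK' : bop K' by exact: (@bop_of_linear U V K'l cK').
by apply: (bop_eq_dense dD bK' bK) => x Dx; rewrite K'L // KL.
Qed.

Lemma two_sided_inverseE {U V : normedModType R} (K : U -> V) (L : V -> U) :
  cancel K L -> cancel L K -> two_sided_inverse K = L.
Proof.
move=> KL LK; apply: xget_unique => // L' [KL' _]; apply/funext => y.
by rewrite -[y in LHS]LK KL'.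
Qed.

End linear_maps.

Section smooth_graph_unique.
Context {R : realType} {Y : completeNormedModType R}.
Variables (M K : R) (E S : R -> Y -> Y).
Hypothesis hE : smoothing M K E S.

(** [E e] tends to the identity as [e] tends to 0. *)
Lemma smooth_graph_uniq x y y' : smooth_graph E S x y -> smooth_graph E S x y' -> y = y'.
Proof.
move=> h h'; apply/eqP; rewrite -subr_eq0 -normr_le0; apply/ler_addgt0Pl => d d0.
have bE := sm_sg hE.
have [a a0 ha] := right_cont_modulus (y - y') bE d0.
have a2 : 0 < a / 2 by rewrite divr_gt0.
have z : E (a / 2) (y - y') = 0.
  by rewrite (bopB (sm_bE hE (ltW a2))) -h // -h' // subrr.
have := ha (a / 2); rewrite z sub0r normrN addr0 => -> //.
by rewrite ltW //= ltr_pdivrMr // ltr_pMr // ltr1n.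
Qed.

Lemma smooth_graphN x y : smooth_graph E S x y -> smooth_graph E S (- x) (- y).
Proof.
move=> h e e0; rewrite (bopN (sm_S hE e0)) (bopN (sm_bE hE (ltW e0))).
by rewrite h.
Qed.

End smooth_graph_unique.

Section besov_norms.
Context {R : realType} {X : normedModType R}.
Local Notation mu := (@lebesgue_measure R).

Lemma besov_normE (s : R) (T : R -> {linear X -> X}) x :
  besov_norm s T x = bnorm (fun t => T t : X -> X) (s / 2) x.
Proof.
rewrite /besov_norm /bnorm /weighted integral_mkcond.
apply: eq_integral => t _; rewrite patchE mem_setE in_itv /= andbT.
have [t0|t0] := ltP 0 t; last by rewrite /besov_weight cutP ltNge t0 mul0r.
by rewrite besov_weightE // orbit_normE // mulrAC.
Qed.

Lemma bochner_normy_le {V : normedModType R} (D : set R) (f : R -> V) (c : R) :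
  0 <= c -> (forall t, D t -> `|f t| <= c) -> (bochner_norm +oo%E D f <= c%:E)%E.
Proof.
move=> c0 fc; rewrite /bochner_norm unlock; case: ifP => _; last by rewrite lee_fin.
apply: ereal_inf_lbound; apply: aeW => t /=; case: (boolP (t \in D)) => [/set_mem/fc h|_].
  by rewrite gee0_abs ?lee_fin.
by rewrite abse0 lee_fin.
Qed.

End besov_norms.

Section cauchy_problem.
Context {R : realType} {Y Z : completeNormedModType R}.
Local Notation mu := (@lebesgue_measure R).
Variables (M N : R) (E S : R -> Y -> Y) (K : Z -> Y) (L : Y -> Z) (A : operator Y Z).
Hypothesis hE : smoothing M N E S.
Hypotheses (bK : bop K) (bL : bop L) (KL : cancel K L) (LK : cancel L K).
Variables (cK cL : R).
Hypotheses (cK0 : 0 <= cK) (cL0 : 0 <= cL).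
Hypotheses (hcK : forall z, `|K z| <= cK * `|z|) (hcL : forall y, `|L y| <= cL * `|y|).
(** [A] is [L] composed with the operator of graph [smooth_graph E S]. *)
Hypothesis domA : forall x, dom A x <-> exists y, smooth_graph E S x (K y).
Hypothesis valA : forall x y, smooth_graph E S x (K y) -> A x = y.

Let smA x : dom A x -> smooth_graph E S x (K (A x)).
Proof. by move=> /domA[y xy]; rewrite (valA xy). Qed.

Let smL x y : smooth_graph E S x y -> dom A x /\ A x = L y.
Proof.
move=> xy; have xy' : smooth_graph E S x (K (L y)) by rewrite LK.
by split; [apply/domA; exists (L y)|exact: valA].
Qed.

Lemma dual_derivative_restrict (T : \bar R) (u v : R -> Y) : (0 < T)%E ->
  dual_derivative +oo%E u v -> dual_derivative T u (cut (open_time T) v).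
Proof.
move=> T0 d phi tphi l bl.
have [a [b [B [/andP[a0 ab] bT [cphi cd] phi0 phiN]]]] := test_functionE T0 tphi.
have tphi' : test_function +oo%E phi.
  by have [h1 h2 [c [e [c0 eT h3]]]] := tphi; split => //; exists c, e; rewrite ltry.
have off t : t \notin open_time T -> phi t = 0 /\ derive1 phi t = 0.
  move=> tn; apply: phi0; apply: contra tn => /andP[ta tb]; rewrite inE; split.
    exact: lt_trans ta.
  by apply: lt_trans bT; rewrite lte_fin.
transitivity (\int[mu]_t (derive1 phi t * l (cut (open_time +oo) u t) : R)).
  apply: eq_Rintegral => t _; have [tT|/off[_ ->]] := boolP (t \in open_time T); last by rewrite !mul0r.
  rewrite /cut tT mem_set //; move: tT; rewrite inE => -[t0 _].
  by split => //; exact: ltry.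
rewrite (d phi tphi' l bl); congr (- _); apply: eq_Rintegral => t _.
have [tT|/off[-> _]] := boolP (t \in open_time T); last by rewrite !mul0r.
by rewrite /cut tT.
Qed.

(** With [g = K f], the equation is [u' = H u + g] for the operator [H] of
    graph [smooth_graph E S]: existence and bounds come from [mild_solution],
    restricted to the time interval, and uniqueness from [homogeneous_zero]
    applied to a difference. *)
Theorem cauchy_well_posed (T : \bar R) (x : Y) (f : R -> Z) : (0 < T)%E ->
  bochner_L1 (open_time T) f ->
  exists u u' : R -> Y,
    [/\ strong_solution T L A f x u u',
        forall w w' : R -> Y, strong_solution T L A f x w w' ->
          forall t, halfopen_time T t -> w t = u t &
        (bochner_norm +oo (open_time T) (L \o u)
         + bochner_norm 1 (open_time T) (L \o u')
         + bochner_norm 1 (open_time T) (A \o u)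
         <= (9 * cL * cK * (M + N) + cL * cK)%:E * `|L x|%:E
            + (9 * cL * cK * (M + N) + cL * cK)%:E * bochner_norm 1 (open_time T) f)%E].
Proof.
move=> T0 Lf; have mD := open_time_measurable T.
have [f1 [Lf1 f10 ff1 nf1]] := bochner_L1_rep mD Lf.
have Lg : L1 (K \o f1) by exact: L1_comp.
set g := K \o f1 in Lg.
have off0 t : t <= 0 -> ~ open_time T t by move=> t0 [t1 _]; rewrite ltNge t0 in t1.
have g0 t : t <= 0 -> g t = 0 by move=> /off0 h; rewrite /g /= f10 // (bop0 bK).
have [u [h [[cu u0] ub [Lh h0 hb] gr dd]]] := mild_solution hE x Lg g0.
set c := (M + N) * `|x| + (M + N) * (3 * fine (L1n g)) in ub hb.
have M0 := sm_M0 hE; have N0 := sm_K0 hE.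
have MN0 : 0 <= M + N by rewrite addr_ge0.
have fg0 : 0 <= fine (L1n g) by rewrite fine_ge0 // L1n_ge0.
have c0 : 0 <= c by rewrite addr_ge0 ?mulr_ge0.
pose v := cut (open_time T) (fun t => h t + g t).
have Lv : L1 v by apply: L1_cut => //; exact: L1D.
have v0 t : ~ open_time T t -> v t = 0 by move=> tn; rewrite /v /cut memNset.
have cuT : {within halfopen_time T, continuous u} by exact: continuous_subspaceT.
have duv : dual_derivative T u v by exact: dual_derivative_restrict.
have grT : {ae mu, forall t, open_time T t -> smooth_graph E S (u t) (h t)}.
  by apply: ae_imp gr => t gt [t0 _]; exact: gt.
have sol : strong_solution T L A f x u v.
  split => //.
  - split; first by apply/(weak_derivativeP (v0 := v) T0 cuT Lv v0) => //; exact: aeW.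
    by apply: (bochner_L1_of mD Lv); exact: aeW.
  - by apply: ae_imp grT => t gt tT; have [] := smL (gt tT).
  - apply: (bochner_L1_of mD (L1_comp bL Lh)).
    by apply: ae_imp grT => t gt tT; have [] := smL (gt tT).
  - apply: ae_imp2 grT ff1 => t gt ft tT; have [_ ->] := smL (gt tT).
    by rewrite /v /cut mem_set // -(bopB bL) addrAC subrr add0r /g /= KL ft.
exists u, v; split => //.
  move=> w w' [[cw w0] [dw Lw'] dAw _ eqw] t tT.
  have [v1 [Lv1 v10 wv1 _]] := bochner_L1_rep mD Lw'.
  have dwv1 : dual_derivative T w v1.
    exact/(weak_derivativeP T0 cw Lv1 v10 wv1).
  have cwu : {within halfopen_time T, continuous (fun t => w t - u t)}.
    by move=> s; apply: cvgB; [exact: cw|exact: cuT].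
  have cNu : {within halfopen_time T, continuous (fun t => - u t)}.
    by move=> s; apply: cvgN; exact: cuT.
  have dwu := dual_derivativeD T0 cw cNu Lv1 (L1N Lv) dwv1 (dual_derivativeN duv).
  have gw : {ae mu, forall t, open_time T t -> smooth_graph E S (w t - u t) (v1 t - v t)}.
    have := ae_imp2 (fun t a b => conj a b) dAw eqw.
    move=> /(ae_imp2 (fun t a b => conj a b) grT).
    move=> /(ae_imp2 (fun t a b => conj a b) wv1).
    move=> /(ae_imp2 (fun t a b => conj a b) ff1).
    apply: ae_imp => s [fs [ws [us [dAs es]]]] sT.
    have gs := smA (dAs sT).
    have Ae : A (w s) = L (v1 s) - f1 s by rewrite -ws // -fs // -(es sT) subKr.
    have -> : v1 s - v s = K (A (w s)) - h s.
      rewrite Ae (bopB bK) LK /v /cut mem_set // /g /=.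
      by rewrite opprD addrA addrAC.
    by apply: (smooth_graphD hE) => //; apply: (smooth_graphN hE); exact: us.
  have wu0 : w 0 - u 0 = 0 by rewrite w0 u0 subrr.
  have := homogeneous_zero hE cwu (L1B Lv1 Lv) gw dwu wu0 tT.
  by move/eqP; rewrite subr_eq0 => /eqP.
have nu : (bochner_norm +oo (open_time T) (L \o u) <= (cL * c)%:E)%E.
  apply: bochner_normy_le; first by rewrite mulr_ge0.
  by move=> t _; rewrite /= (le_trans (hcL _)) // ler_wpM2l.
have Ln (w : R -> Y) (d : R) : L1 w -> (L1n w <= d%:E)%E ->
    (L1n (cut (open_time T) (L \o w)) <= (cL * d)%:E)%E.
  move=> Lw wd; have [sw _] := Lw.
  apply: (@le_trans _ _ (L1n (fun t => cL *: w t))).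
    have [s1 _] := L1_cut mD (L1_comp bL Lw).
    apply: L1n_le => //; first by apply: smeas_comp sw => y; exact: scaler_continuous.
    move=> t; rewrite normrZ (ger0_norm cL0) /cut; case: ifP => _; first exact: hcL.
    by rewrite normr0 mulr_ge0.
  by rewrite L1nZ // (ger0_norm cL0) EFinM lee_wpmul2l.
have Lg1 : fine (L1n g) <= cK * fine (L1n f1).
  have -> : cK * fine (L1n f1) = fine (L1n (fun t => cK *: f1 t)).
    by have [s1 _] := Lf1; rewrite L1nZ // (L1n_fin Lf1) -EFinM /= ger0_norm.
  have [s1 _] := Lf1; have [s2 _] := Lg.
  apply: L1n_fine_le => //.
    split; first by apply: smeas_comp s1 => y; exact: scaler_continuous.
    by rewrite L1nZ // (L1n_fin Lf1) -EFinM ltry.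
  by move=> t; rewrite normrZ (ger0_norm cK0); exact: hcK.
have nv : (bochner_norm 1 (open_time T) (L \o v) <= (cL * (c + fine (L1n g)))%:E)%E.
  rewrite bochner_norm1E; apply: Ln => //.
  apply: (@le_trans _ _ (L1n h + L1n g)%E).
    have [s1 _] := Lh; have [s2 _] := Lg; have [s3 _] := Lv.
    apply: le_trans (L1nD s1 s2); apply: L1n_le => //; first exact: smeasD.
    by move=> t; rewrite /v /cut; case: ifP => _ //; rewrite normr0.
  by rewrite (L1n_fin Lg) EFinD leeD.
have nA : (bochner_norm 1 (open_time T) (A \o u) <= (cL * c)%:E)%E.
  rewrite bochner_norm1E (_ : L1n _ = L1n (cut (open_time T) (L \o h))); first exact: Ln.
  apply: bochner_norm1_ae => //.
  by apply: ae_imp grT => t gt tT; have [] := smL (gt tT).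
apply: le_trans (leeD (leeD nu nv) nA) _.
rewrite -nf1 (L1n_fin Lf1) -!EFinM -!EFinD lee_fin.
have hx : `|x| <= cK * `|L x| by rewrite -[x in leLHS]LK.
have F0 : 0 <= fine (L1n f1) by rewrite fine_ge0 // L1n_ge0.
have e1 : cL * c <= cL * ((M + N) * (cK * `|L x|) + (M + N) * (3 * (cK * fine (L1n f1)))).
  rewrite ler_wpM2l // /c lerD // ler_wpM2l //.
  by rewrite ler_wpM2l.
have e2 : cL * fine (L1n g) <= cL * (cK * fine (L1n f1)) by rewrite ler_wpM2l.
have p1 : 0 <= cL * cK * (M + N) * `|L x| by rewrite !mulr_ge0.
have p2 : 0 <= cL * cK * `|L x| by rewrite !mulr_ge0.
rewrite (mulrDr cL c).
move: (cL * c) (cL * fine (L1n g)) e1 e2 p1 p2 => a b.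
move: (M + N) (fine (L1n f1)) `|L x| => m F n e1 e2 p1 p2.
rewrite -subr_ge0 (_ : _ - _ =
   3 * (cL * (m * (cK * n) + m * (3 * (cK * F))) - a) + (cL * (cK * F) - b) +
   (6 * (cL * cK * m * n) + cL * cK * n)); last by ring.
apply: addr_ge0; last by apply: addr_ge0 => //; apply: mulr_ge0.
by apply: addr_ge0; [apply: mulr_ge0; rewrite ?subr_ge0|rewrite subr_ge0].
Qed.

End cauchy_problem.

Theorem theorem4p9 (R : realType) (X : completeNormedModType R)
  (A : operator X X) (eA : R -> {linear X -> X})
  (hAlin : linear_operator A) (hAinj : one_to_one A)
  (hA : bounded_analytic_semigroup eA A) (hAdecay : decays eA)
  (B Binv : {linear X -> X})
  (hB : continuous B) (hBinv : continuous Binv)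
  (hBK : cancel B Binv) (hBinvK : cancel Binv B)
  (eS : R -> {linear X -> X})
  (hS : bounded_analytic_semigroup eS (op_comp B A)) (hSdecay : decays eS)
  (s : R) (hs : 0 < s < 2)
  (YA YS : completeNormedModType R) (jA : X -> YA) (jS : X -> YS)
  (hYA : besov_completion s eA A jA)
  (hYS : besov_completion s eS (op_comp B A) jS) :
  let Bbar : YA -> YS := continuous_extension jA jS (op_range A) B in
  let Bbarinv : YS -> YA := two_sided_inverse Bbar in
  let Abar : operator YS YA :=
    op_closure [set (jS x, jA (A x)) |
                  x in dom A `&` op_range (op_comp B A)] in
  exists C : R, forall (T : \bar R) (x : YS) (f : R -> YA),
    (0 < T)%E -> bochner_L1 (open_time T) f ->
    exists u u' : R -> YS,
      [/\ strong_solution T Bbarinv Abar f x u u',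
          forall w w' : R -> YS, strong_solution T Bbarinv Abar f x w w' ->
            forall t, halfopen_time T t -> w t = u t &
          (bochner_norm +oo (open_time T) (Bbarinv \o u)
           + bochner_norm 1 (open_time T) (Bbarinv \o u')
           + bochner_norm 1 (open_time T) (Abar \o u)
           <= C%:E * `|Bbarinv x|%:E
              + C%:E * bochner_norm 1 (open_time T) f)%E].
Proof.
move=> Bbar Bbarinv Abar; set S := op_comp B A.
have p01 : 0 < s / 2 < 1.
  by case/andP: hs => s0 s2; rewrite divr_gt0 //= ltr_pdivrMr // mul1r.
have [p0 p1] := andP p01.
have hSlin : linear_operator S.
  have [A0 Al] := hAlin; split => // a x y Dx Dy; have [Dxy Axy] := Al a x y Dx Dy.
  by split => //=; rewrite Axy linearP.
have [M1 [C1 aA]] := analytic_of hA hAlin.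
have [M2 [C2 aS]] := analytic_of hS hSlin.
have [jAlin jAn jAd] := hYA; have [jSlin jSn jSd] := hYS.
have {}jAn x : op_range A x -> ((`|jA x|)%:E = bnorm (fun t => eA t : X -> X) (s / 2) x)%E.
  by move=> /jAn ->; exact: besov_normE.
have {}jSn x : op_range S x -> ((`|jS x|)%:E = bnorm (fun t => eS t : X -> X) (s / 2) x)%E.
  by move=> /jSn ->; exact: besov_normE.
have [bB bBi] := (bop_of_linear hB, bop_of_linear hBinv).
have [b b0 hb] := bop_bound bB; have [b' b'0 hb'] := bop_bound bBi.
have RB x : op_range A x -> op_range S (B x) by move=> [u Du <-]; exists u.
have RBi x : op_range S x -> op_range A (Binv x).
  by move=> [u Du <-]; exists u => //=; rewrite hBK.
have cst (c Mx Cx : R) : 0 <= Mx -> 0 <= Cx -> 0 < c -> 0 <= Cx / (1 - s / 2) + Mx * c.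
  by move=> *; rewrite addr_ge0 ?divr_ge0 ?mulr_ge0 ?subr_ge0 // ltW.
pose cB := C2 / (1 - s / 2) + M2 * b; pose cB' := C1 / (1 - s / 2) + M1 * b'.
have cB0 : 0 <= cB by apply: cst => //; [exact: an_M0 aS|exact: an_C0 aS].
have cB'0 : 0 <= cB' by apply: cst => //; [exact: an_M0 aA|exact: an_C0 aA].
(* [bnorm_transfer] from one semigroup to the other, and back for the inverse. *)
have [K [bK hK Kj]] : exists K : YA -> YS, [/\ bop K, forall y, `|K y| <= cB * `|y| &
    forall x, op_range A x -> K (jA x) = jS (B x)].
  apply: density_extension => //; first exact: (range_lin aA).
    by move=> a x y Rx Ry; rewrite linearP jSlin //; exact: RB.
  move=> _ [u Du <-]; rewrite -lee_fin EFinM jAn; last by exists u.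
  rewrite jSn; last by exists u.
  by apply: (bnorm_transfer aA aS p01 (ltW b0)) => // x Dx; exact: hb.
have [L [bL hL Lj]] : exists L : YS -> YA, [/\ bop L, forall y, `|L y| <= cB' * `|y| &
    forall x, op_range S x -> L (jS x) = jA (Binv x)].
  apply: density_extension => //; first exact: (range_lin aS).
    by move=> a x y Rx Ry; rewrite linearP jAlin //; exact: RBi.
  move=> _ [u Du <-]; rewrite -lee_fin EFinM jSn; last by exists u.
  rewrite /= hBK jAn; last by exists u.
  by apply: (bnorm_transfer aS aA p01 (ltW b'0)) => // x Dx /=; rewrite -{1}[A x]hBK; exact: hb'.
have KL : cancel K L.
  apply: (bop_eq_dense jAd (bop_comp bL bK) bop_id) => x Rx /=.
  by rewrite Kj // Lj ?hBK //; exact: RB.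
have LK : cancel L K.
  apply: (bop_eq_dense jSd (bop_comp bK bL) bop_id) => x Rx /=.
  by rewrite Lj // Kj ?hBinvK //; exact: RBi.
have BbarE : Bbar = K by exact: continuous_extensionE.
have BinvE : Bbarinv = L by rewrite /Bbarinv BbarE; exact: two_sided_inverseE.
have [E [St [hE hSt]]] := extension_ES aS jSlin jSn jSd.
have sm := completed_smoothing aS p01 jSlin jSn jSd hE hSt.
(* [K] is an isomorphism that carries the second component of one graph to
   that of the other, so the closures correspond. *)
have graphE x y : closure [set (jS u, jA (A u)) | u in dom A `&` op_range S] (x, y) <->
    smooth_graph E St x (K y).
  rewrite (smooth_graph_closure aS jSlin jSn jSd hE hSt) !closure_pairP; split=> h e e0.
    have cB1 : 0 < cB + 1 by rewrite ltr_wpDl.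
    have m0 : 0 < Num.min e (e / (cB + 1)) by rewrite lt_min e0 divr_gt0.
    have [_ [_ [[u [Du Ru] [<- <-]]]]] := h _ m0.
    rewrite !lt_min => /andP[h1 _] /andP[_ h2].
    exists (jS u), (jS (S u)); split; [by exists u|by []|].
    have -> : jS (S u) = K (jA (A u)) by rewrite Kj //; exists u.
    rewrite -(bopB bK) (le_lt_trans (hK _)) //.
    by move: h2; rewrite ltr_pdivlMr // => h2; apply: le_lt_trans h2; rewrite mulrC ler_wpM2l // lerDl.
  have cB1 : 0 < cB' + 1 by rewrite ltr_wpDl.
  have m0 : 0 < Num.min e (e / (cB' + 1)) by rewrite lt_min e0 divr_gt0.
  have [_ [_ [[u [Du Ru] [<- <-]]]]] := h _ m0.
  rewrite !lt_min => /andP[h1 _] /andP[_ h2].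
  exists (jS u), (jA (A u)); split; [by exists u|by []|].
  have -> : jA (A u) = L (jS (S u)) by rewrite Lj /= ?hBK //; exists u.
  rewrite -[y]KL -(bopB bL) (le_lt_trans (hL _)) //.
  by move: h2; rewrite ltr_pdivlMr // => h2; apply: le_lt_trans h2; rewrite mulrC ler_wpM2l // lerDl.
have domA x : dom Abar x <-> exists y, smooth_graph E St x (K y).
  by split=> -[y hy]; exists y; apply/graphE.
have valA x y : smooth_graph E St x (K y) -> Abar x = y.
  move=> xy; apply: xget_unique; first exact/graphE.
  move=> y' /graphE xy'; rewrite -[y]KL -[y']KL.
  by rewrite (smooth_graph_uniq sm xy xy').
rewrite BinvE.
eexists => T x f T0 Lf.
exact: (cauchy_well_posed sm bK bL KL LK cB0 cB'0 hK hL domA valA x T0 Lf).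
Qed.
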